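(* Let $(u_{PP},p_{PP})$ and $(u_\varepsilon,p_\varepsilon)$ ($\varepsilon>0$) be the solutions of problems (PP') and (ES') defined in the context. Let $k\ge1$ be an arbitrary integer and let $v^{(0)}:=u_{PP}$. If functions $v^{(1)},\dots,v^{(k)}\in H^1_0(\Omega)^n$ and $q^{(1)},\dots,q^{(k)}\in Q$ satisfy $$\int_\Omega\nabla v^{(i)}:\nabla\varphi+\int_\Omega\nabla q^{(i)}\cdot\varphi=0\quad\text{for all }\varphi\in H^1_0(\Omega)^n,$$ $$\int_\Omega\nabla q^{(i)}\cdot\nabla\psi=-\int_\Omega(\operatorname{div}v^{(i-1)})\psi\quad\text{for all }\psi\in Q$$ for all $1\le i\le k$, then there exists a constant $c>0$ independent of $\varepsilon$ such that, for all $\varepsilon>0$, $$\left\|u_\varepsilon-\left(u_{PP}+\frac1\varepsilon v^{(1)}+\cdots+\left(\frac1\varepsilon\right)^kv^{(k)}\right)\right\|_{H^1(\Omega)^n}\le\frac{c}{\varepsilon^{k+1}}\|\operatorname{div}v^{(k)}\|_{Q^*},$$ $$\left\|p_\varepsilon-\left(p_{PP}+\frac1\varepsilon q^{(1)}+\cdots+\left(\frac1\varepsilon\right)^kq^{(k)}\right)\right\|_{H^1(\Omega)}\le\frac{c}{\varepsilon^{k+1}}\|\operatorname{div}v^{(k)}\|_{Q^*}.$$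
   Context: $n\ge2$ is an integer and $\Omega\subset\mathbb{R}^n$ is a bounded domain with Lipschitz continuous boundary $\Gamma$ and unit outward normal $\nu$. $\gamma_0:H^1(\Omega)\to H^{1/2}(\Gamma)$ is the trace operator, applied componentwise to vector fields. $\nabla u:\nabla\varphi:=\sum_i\frac{\partial u}{\partial x_i}\cdot\frac{\partial\varphi}{\partial x_i}$. $Q\subset H^1(\Omega)$ is a closed subspace for which there is a constant $c>0$ with $\|q\|_{L^2(\Omega)}\le c\|\nabla q\|_{L^2(\Omega)^n}$ for all $q\in Q$; its dual $Q^*$ has the norm $\|f\|_{Q^*}:=\sup\{\langle f,\psi\rangle:\psi\in Q,\ \|\nabla\psi\|_{L^2(\Omega)^n}=1\}$, and a function $h\in L^2(\Omega)$ is regarded as the element $\psi\mapsto\int_\Omega h\psi$ of $Q^*$. The data are $F\in L^2(\Omega)^n$, $u_b\in H^{1/2}(\Gamma)^n$ with $\int_\Gamma u_b\cdot\nu=0$, $p_b\in H^1(\Omega)$ and $G\in Q^*$. Each of the following problems has a unique solution. (PP'): $(u_{PP},p_{PP})\in H^1(\Omega)^n\times H^1(\Omega)$ with $\int_\Omega\nabla u_{PP}:\nabla\varphi+\int_\Omega\nabla p_{PP}\cdot\varphi=\int_\Omega F\cdot\varphi$ for all $\varphi\in H^1_0(\Omega)^n$, $\int_\Omega\nabla p_{PP}\cdot\nabla\psi=\langle G,\psi\rangle$ for all $\psi\in Q$, $\gamma_0u_{PP}=u_b$, $p_{PP}-p_b\in Q$. (ES') for $\varepsilon>0$: $(u_\varepsilon,p_\varepsilon)\in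 H^1(\Omega)^n\times H^1(\Omega)$ with $\int_\Omega\nabla u_\varepsilon:\nabla\varphi+\int_\Omega\nabla p_\varepsilon\cdot\varphi=\int_\Omega F\cdot\varphi$ for all $\varphi\in H^1_0(\Omega)^n$, $\varepsilon\int_\Omega\nabla p_\varepsilon\cdot\nabla\psi+\int_\Omega(\operatorname{div}u_\varepsilon)\psi=\varepsilon\langle G,\psi\rangle$ for all $\psi\in Q$, $\gamma_0u_\varepsilon=u_b$, $p_\varepsilon-p_b\in Q$. *)

(* Defs.v *)
From HB Require Import structures.
From mathcomp Require Import all_boot all_order all_algebra.
From mathcomp Require Import all_classical all_reals all_analysis.

Set Implicit Arguments.
Unset Strict Implicit.
Unset Printing Implicit Defensive.

Import Order.TTheory GRing.Theory Num.Theory.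
Import numFieldNormedType.Exports.

Local Open Scope classical_set_scope.
Local Open Scope ring_scope.

Definition rV_display : measure_display -> measure_display.
Proof. exact. Qed.

(* The Borel sigma-algebra of R^n, generated by the coordinate functions. *)
Section measurable_rV.
Context (R : realType) (n : nat).

Definition rV_measurable : set (set 'rV[R]_n) :=
  g_sigma_preimage (fun (i : 'I_n) (x : 'rV[R]_n) => x ord0 i).

Let rV_measurable0 : rV_measurable set0.
Proof. exact: sigma_algebra0. Qed.

Let rV_measurableC A : rV_measurable A -> rV_measurable (~` A).
Proof. exact: sigma_algebraC. Qed.

Let rV_measurableU (F : (set 'rV[R]_n)^nat) :
  (forall i, rV_measurable (F i)) -> rV_measurable (\bigcup_i F i).
Proof. exact: sigma_algebra_bigcup. Qed.

HB.instance Definition _ := @isMeasurable.Build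
  (rV_display default_measure_display) 'rV[R]_n rV_measurable
  rV_measurable0 rV_measurableC rV_measurableU.

Lemma measurable_coord (i : 'I_n) :
  measurable_fun setT (fun x : 'rV[R]_n => x ord0 i).
Proof.
move=> _ Y mY; rewrite setTI; apply: sub_sigma_algebra => /=.
rewrite -bigcup_seq/=; exists i => /=; first by rewrite mem_index_enum.
by exists Y => //; rewrite setTI.
Qed.

Lemma measurable_fun_rV d (T : measurableType d) (f : T -> 'rV[R]_n) :
  (forall i, measurable_fun setT (fun x => f x ord0 i)) ->
  measurable_fun setT f.
Proof.
move=> mf _ A mA; rewrite setTI.
pose G := [set B : set 'rV[R]_n | measurable (f @^-1` B)].
suff sub : rV_measurable `<=` G by exact: (sub A mA).
apply: smallest_sub.
  split => /=.
  - by rewrite /G/= preimage_set0.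
  - by move=> B mB; rewrite /G/= setTD preimage_setC; exact: measurableC.
  - move=> F mF; rewrite /G/= preimage_bigcup.
    by apply: bigcup_measurable => k _; exact: mF.
move=> B; rewrite -bigcup_seq => -[i _ [C mC <-]].
by rewrite /G/= setTI -[X in measurable X]setTI; exact: (mf i).
Qed.

End measurable_rV.

Section lebesgue_step.
Context (R : realType) (n : nat).
Variable mu : {sigma_finite_measure set 'rV[R]_n -> \bar R}.

Definition rV_cons (p : measurableTypeR R * 'rV[R]_n) : 'rV[R]_n.+1 :=
  \row_i oapp (p.2 ord0) p.1 (unlift ord0 i).

Definition rV_uncons (x : 'rV[R]_n.+1) : measurableTypeR R * 'rV[R]_n :=
  (x ord0 ord0, \row_j x ord0 (lift ord0 j)).

Lemma rV_cons0 p : rV_cons p ord0 ord0 = p.1.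
Proof. by rewrite mxE unlift_none. Qed.

Lemma rV_consS p j : rV_cons p ord0 (lift ord0 j) = p.2 ord0 j.
Proof. by rewrite mxE liftK. Qed.

Lemma rV_consK : cancel rV_cons rV_uncons.
Proof.
move=> p; rewrite /rV_uncons rV_cons0.
rewrite [RHS]surjective_pairing; congr pair.
by apply/rowP => j; rewrite mxE rV_consS.
Qed.

Lemma rV_unconsK : cancel rV_uncons rV_cons.
Proof.
move=> x; apply/rowP => i; case: (unliftP ord0 i) => [j|] ->.
  by rewrite rV_consS mxE.
by rewrite rV_cons0.
Qed.

Lemma measurable_rV_cons : measurable_fun setT rV_cons.
Proof.
apply: measurable_fun_rV => i; case: (unliftP ord0 i) => [j|] ->.
  under eq_fun do rewrite rV_consS.
  exact: (measurableT_comp (measurable_coord j) measurable_snd).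
under eq_fun do rewrite rV_cons0.
exact: measurable_fst.
Qed.

Lemma measurable_rV_uncons : measurable_fun setT rV_uncons.
Proof.
apply/measurable_fun_pairP; split; first exact: measurable_coord.
apply: measurable_fun_rV => i; rewrite /rV_uncons/=.
under eq_fun do rewrite mxE.
exact: measurable_coord.
Qed.

Definition lebesgue_consm : set 'rV[R]_n.+1 -> \bar R :=
  pushforward (lebesgue_measure \x mu)%E rV_cons.

Let preim_measurable (A : set 'rV[R]_n.+1) : measurable A -> measurable (rV_cons @^-1` A).
Proof. by move=> mA; rewrite -[X in measurable X]setTI; exact: measurable_rV_cons. Qed.

Let lebesgue_consm0 : lebesgue_consm set0 = 0%E.
Proof. by rewrite /lebesgue_consm /pushforward preimage_set0 measure0. Qed.

Let lebesgue_consm_ge0 A : (0 <= lebesgue_consm A)%E.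
Proof. by apply: (measure_ge0 (lebesgue_measure \x mu)%E). Qed.

Let lebesgue_consm_sigma_additive : semi_sigma_additive lebesgue_consm.
Proof.
move=> F mF tF mUF; rewrite /lebesgue_consm /pushforward preimage_bigcup.
apply: measure_semi_sigma_additive.
- by move=> k; exact: preim_measurable.
- apply/trivIsetP => /= i j _ _ ij; rewrite -preimage_setI.
  by move/trivIsetP : tF => /(_ _ _ _ _ ij) ->//; rewrite preimage_set0.
- by rewrite -preimage_bigcup; exact: preim_measurable.
Qed.

HB.instance Definition _ := isMeasure.Build _ _ _ lebesgue_consm
  lebesgue_consm0 lebesgue_consm_ge0 lebesgue_consm_sigma_additive.

Let lebesgue_consm_sigma_finite : sigma_finite setT lebesgue_consm.
Proof.
have /sigma_finiteP[F [TF ndF Foo]] :=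
  sigma_finiteT (@lebesgue_measure R : {sigma_finite_measure set _ -> \bar R}).
have /sigma_finiteP[G [TG ndG Goo]] := sigma_finiteT mu.
exists (fun k => rV_uncons @^-1` (F k `*` G k)).
  apply/esym; rewrite -subTset => x _.
  have [k _ Fk] : (\bigcup_k F k) (rV_uncons x).1 by rewrite -TF.
  have [l _ Gl] : (\bigcup_l G l) (rV_uncons x).2 by rewrite -TG.
  exists (maxn k l) => //; split.
    by move: Fk; exact/subsetPset/ndF/leq_maxl.
  by move: Gl; exact/subsetPset/ndG/leq_maxr.
move=> k; have [mF Foo'] := Foo k; have [mG Goo'] := Goo k.
split.
  rewrite -[X in measurable X]setTI.
  by apply: measurable_rV_uncons => //; exact: measurableX.
rewrite /lebesgue_consm /pushforward -comp_preimage.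
rewrite (_ : _ \o _ = id) ?preimage_id; last first.
  by apply/funext => p; exact: rV_consK.
by rewrite product_measure1E// lte_mul_pinfty// ge0_fin_numE.
Qed.

HB.instance Definition _ := Measure_isSigmaFinite.Build _ _ _ lebesgue_consm
  lebesgue_consm_sigma_finite.

End lebesgue_step.

Fixpoint lebesgue_rV (R : realType) (n : nat) :
    {sigma_finite_measure set 'rV[R]_n -> \bar R} :=
  match n with
  | 0 => \d_(0 : 'rV[R]_0)
  | m.+1 => lebesgue_consm (lebesgue_rV R m)
  end.

Section euclidean.
Context (R : realType) (n : nat).
Implicit Types x y : 'rV[R]_n.

Definition edot x y : R := \sum_(i < n) x ord0 i * y ord0 i.
Definition enorm x : R := Num.sqrt (edot x x).
Definition unit_vec (i : 'I_n) : 'rV[R]_n := delta_mx ord0 i.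

Definition ediam (A : set 'rV[R]_n) : \bar R :=
  ereal_sup [set (enorm (x - y))%:E | x in A & y in A].

End euclidean.

(* A copy of R^n in which every set is measurable, so that the covers ranged
   over by [mu_ext] below are arbitrary. *)
Definition all_sets (R : realType) (n : nat) : Type := 'rV[R]_n.
HB.instance Definition _ R n := Pointed.on (all_sets R n).
HB.instance Definition _ R n := @isMeasurable.Build default_measure_display
  (all_sets R n) (@discrete_measurable (all_sets R n))
  (@discrete_measurable0 _) (@discrete_measurableC _)
  (@discrete_measurableU _).

(* The s-dimensional Hausdorff measure of R^n, up to the usual dimensional
   normalising factor: only its null sets, the finiteness or vanishing of
   integrals and convergence to 0 matter below. *)
Section hausdorff.
Context (R : realType) (n : nat) (s : nat).
Local Open Scope ereal_scope.

Definition hausdorff_gauge (delta : R) (A : set (all_sets R n)) : \bar R :=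
  if `[< A = set0 >] then 0
  else if ediam A <= delta%:E then ediam A ^+ s else +oo.

Definition hausdorff_pre (delta : R) : set 'rV[R]_n -> \bar R :=
  mu_ext (hausdorff_gauge delta).

Definition hausdorff (A : set 'rV[R]_n) : \bar R :=
  ereal_sup [set hausdorff_pre delta A | delta in [set delta : R | (0 < delta)%R]].

Let gauge0 delta : hausdorff_gauge delta set0 = 0.
Proof. by rewrite /hausdorff_gauge asboolT. Qed.

Let gauge_ge0 delta A : 0 <= hausdorff_gauge delta A.
Proof.
rewrite /hausdorff_gauge; case: asboolP => // /eqP/set0P[x Ax].
case: ifP => // _; apply: expe_ge0.
apply: le_trans (ereal_sup_ubound _); last by exists x => //; exists x.
by rewrite lee_fin sqrtr_ge0.
Qed.

Let hausdorff_pre_ge0 delta A : 0 <= hausdorff_pre delta A.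
Proof. exact: mu_ext_ge0 (gauge_ge0 delta) A. Qed.

Let hausdorff0 : hausdorff set0 = 0.
Proof.
apply/eqP; rewrite eq_le; apply/andP; split.
  apply: ge_ereal_sup => _ [delta _ <-].
  by rewrite /hausdorff_pre mu_ext0.
by apply: le_trans (hausdorff_pre_ge0 1 _) (ereal_sup_ubound _); exists 1%R => //=.
Qed.

Let hausdorff_ge0 A : 0 <= hausdorff A.
Proof.
by apply: le_trans (hausdorff_pre_ge0 1 _) (ereal_sup_ubound _); exists 1%R => //=.
Qed.

Let le_hausdorff : {homo hausdorff : A B / A `<=` B >-> A <= B}.
Proof.
move=> A B AB; apply: ge_ereal_sup => _ [delta d0 <-].
apply: le_trans (ereal_sup_ubound _); last by exists delta.
exact: le_mu_ext.
Qed.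

Let hausdorff_sigma_subadditive : sigma_subadditive hausdorff.
Proof.
move=> F; apply: ge_ereal_sup => _ [delta d0 <-].
apply: le_trans (mu_ext_sigma_subadditive (gauge_ge0 delta) F) _.
apply: lee_nneseries => [k _ _|k _]; first exact: hausdorff_pre_ge0.
by apply: ereal_sup_ubound; exists delta.
Qed.

HB.instance Definition _ := isOuterMeasure.Build R 'rV[R]_n hausdorff
  hausdorff0 hausdorff_ge0 le_hausdorff hausdorff_sigma_subadditive.

End hausdorff.

Definition caratheodory_measure (R : realType) (T : pointedType)
    (mu : {outer_measure set T -> \bar R}) :
    {measure set (caratheodory_type mu) -> \bar R} := mu.

(* The surface measure: the (n-1)-dimensional Hausdorff measure, on its
   Caratheodory sigma-algebra. *)
Definition surface_measure (R : realType) (n : nat) :=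
  caratheodory_measure (@hausdorff R n n.-1).

Section domains.
Context (R : realType) (n : nat).
Implicit Types (Omega : set 'rV[R]_n) (x y : 'rV[R]_n).

Definition boundary Omega : set 'rV[R]_n := closure Omega `\` interior Omega.

Definition lipschitz_map (g : 'rV[R]_n -> R) : Prop :=
  exists L : R, forall x y, `|g x - g y| <= L * enorm (x - y).

(* Near each boundary point, Omega is the part below the graph of a Lipschitz
   function, in orthonormal coordinates whose last axis is the unit vector e;
   y - (y . e) e stands for the n - 1 other coordinates of y. *)
Definition lipschitz_boundary Omega : Prop :=
  forall x, boundary Omega x ->
    exists (e : 'rV[R]_n) (g : 'rV[R]_n -> R) (r : R),
      [/\ enorm e = 1, lipschitz_map g, 0 < r &
        forall y, enorm (y - x) < r ->
          (Omega y <-> edot y e < g (y - edot y e *: e))].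

Definition bounded_lipschitz_domain Omega : Prop :=
  [/\ open Omega, connected Omega, Omega !=set0, bounded_set Omega &
      lipschitz_boundary Omega].

(* nu is the outward unit normal at x when the boundary is tangent at x to the
   hyperplane orthogonal to nu, with Omega on the side of -nu.  By Rademacher's
   theorem it exists at almost every point of a Lipschitz boundary. *)
Definition is_outward_normal Omega x (nu : 'rV[R]_n) : Prop :=
  enorm nu = 1 /\
  forall theta : R, 0 < theta -> exists2 r : R, 0 < r &
    forall y, enorm (y - x) < r ->
      (theta * enorm (y - x) < edot (y - x) nu -> ~ Omega y) /\
      (edot (y - x) nu < - (theta * enorm (y - x)) -> Omega y).

Definition outward_normal Omega x : 'rV[R]_n :=
  xget 0 [set nu | is_outward_normal Omega x nu].

End domains.

Definition square_integrable d (T : measurableType d) (R : realType)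
    (mu : {measure set T -> \bar R}) (D : set T) (u : T -> R) : Prop :=
  measurable_fun D u /\ (\int[mu]_(x in D) (u x ^+ 2)%:E < +oo)%E.

(* Scalar functions are representatives 'rV[R]_n -> R, of which only the values
   on Omega (or on its boundary) matter, up to almost everywhere equality;
   a vector field u has the components u i. *)
Section sobolev.
Context (R : realType) (n : nat) (Omega : set 'rV[R]_n).
Local Notation fct := ('rV[R]_n -> R).
Local Notation field := ('I_n -> 'rV[R]_n -> R).
Local Notation leb := (lebesgue_rV R n).
Local Notation sigma := (surface_measure R n).
Local Notation Gamma := (boundary Omega).

Definition L2 (u : fct) : Prop := square_integrable leb Omega u.

Definition L2v (u : field) : Prop := forall i, L2 (u i).

Definition pderiv (i : 'I_n) (f : fct) : fct :=
  fun x => 'D_(unit_vec R i) f x.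

Definition smooth (f : fct) : Prop :=
  forall s : seq 'I_n,
    continuous (foldr pderiv f s) /\
    forall i x, derivable (foldr pderiv f s) x (unit_vec R i).

Definition test_function (phi : fct) : Prop :=
  smooth phi /\
  exists K : set 'rV[R]_n,
    [/\ compact K, K `<=` Omega & forall x, ~ K x -> phi x = 0].

Definition is_weak_pderiv (i : 'I_n) (u g : fct) : Prop :=
  L2 g /\
  forall phi, test_function phi ->
    \int[leb]_(x in Omega) (u x * pderiv i phi x) =
    - \int[leb]_(x in Omega) (g x * phi x).

Definition H1 (u : fct) : Prop :=
  L2 u /\ forall i, exists g, is_weak_pderiv i u g.

Definition H1v (u : field) : Prop := forall i, H1 (u i).

(* A representative of the weak derivative, which is unique almost everywhere
   on Omega. *)
Definition weak_pderiv (i : 'I_n) (u : fct) : fct :=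
  xget (cst 0) [set g | is_weak_pderiv i u g].

Definition grad (u : fct) : field := fun i => weak_pderiv i u.

Definition div (u : field) : fct := fun x => \sum_i weak_pderiv i (u i) x.

Definition int_mul (f g : fct) : R := \int[leb]_(x in Omega) (f x * g x).

Definition int_dot (f g : field) : R :=
  \int[leb]_(x in Omega) (\sum_i f i x * g i x).

Definition int_grad_grad (u phi : field) : R :=
  \int[leb]_(x in Omega)
    (\sum_i \sum_j weak_pderiv i (u j) x * weak_pderiv i (phi j) x).

Definition L2norm (u : fct) : R := Num.sqrt (int_mul u u).

Definition L2normv (u : field) : R := Num.sqrt (int_dot u u).

Definition H1norm (u : fct) : R :=
  Num.sqrt (int_mul u u + int_dot (grad u) (grad u)).

Definition H1normv (u : field) : R :=
  Num.sqrt (int_dot u u + int_grad_grad u u).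

Definition H1_cvg (w : nat -> fct) (u : fct) : Prop :=
  H1norm (fun x => w j x - u x) @[j --> \oo] --> (0 : R).

Definition H10 (u : fct) : Prop :=
  H1 u /\
  exists w : nat -> fct, (forall j, test_function (w j)) /\ H1_cvg w u.

Definition H10v (u : field) : Prop := forall i, H10 (u i).

(* The graph of the trace operator gamma_0, i.e. of the continuous extension to
   H1 of the restriction to the boundary of functions smooth up to the
   boundary. *)
Definition is_trace (u g : fct) : Prop :=
  [/\ H1 u, square_integrable sigma Gamma g &
    exists w : nat -> fct,
      [/\ forall j, smooth (w j), H1_cvg w u &
        (\int[sigma]_(x in Gamma) ((w j x - g x) ^+ 2)%:E)%E
          @[j --> \oo] --> (0 : \bar R)]].

Definition is_tracev (u g : field) : Prop := forall i, is_trace (u i) (g i).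

(* Sobolev-Slobodeckij definition: the exponent of the order 1/2 seminorm on the
   (n-1)-dimensional boundary is n = (n - 1) + 2 * (1/2). *)
Definition Hhalf (g : fct) : Prop :=
  square_integrable sigma Gamma g /\
  (\int[sigma]_(x in Gamma) \int[sigma]_(y in Gamma)
     ((g x - g y) ^+ 2 / enorm (x - y) ^+ n)%:E < +oo)%E.

Definition Hhalfv (g : field) : Prop := forall i, Hhalf (g i).

Definition flux (g : field) : R :=
  \int[sigma]_(x in Gamma) (\sum_i g i x * outward_normal Omega x ord0 i).

Definition closed_subspace (Q : set fct) : Prop :=
  [/\ Q `<=` H1, Q (cst 0),
    forall (a : R) u v, Q u -> Q v -> Q (fun x => a * u x + v x) &
    forall (w : nat -> fct) u,
      (forall j, Q (w j)) -> H1 u -> H1_cvg w u -> Q u].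

Definition poincare (Q : set fct) : Prop :=
  exists2 c : R, 0 < c & forall q, Q q -> L2norm q <= c * L2normv (grad q).

Definition in_dual (Q : set fct) (f : fct -> R) : Prop :=
  (forall (a : R) u v, Q u -> Q v ->
     f (fun x => a * u x + v x) = a * f u + f v) /\
  exists C : R, forall u, Q u -> `|f u| <= C * H1norm u.

Definition dual_norm (Q : set fct) (f : fct -> R) : R :=
  sup [set f psi | psi in [set psi | Q psi /\ L2normv (grad psi) = 1]].

Definition dual_of_L2 (h : fct) : fct -> R := fun psi => int_mul h psi.

Definition solves_PP (Q : set fct) (F u_b : field) (p_b : fct) (G : fct -> R)
    (u : field) (p : fct) : Prop :=
  [/\ H1v u /\ H1 p,
    forall phi, H10v phi ->
      int_grad_grad u phi + int_dot (grad p) phi = int_dot F phi,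
    forall psi, Q psi -> int_dot (grad p) (grad psi) = G psi,
    is_tracev u u_b &
    Q (fun x => p x - p_b x)].

Definition solves_ES (Q : set fct) (F u_b : field) (p_b : fct) (G : fct -> R)
    (eps : R) (u : field) (p : fct) : Prop :=
  [/\ H1v u /\ H1 p,
    forall phi, H10v phi ->
      int_grad_grad u phi + int_dot (grad p) phi = int_dot F phi,
    forall psi, Q psi ->
      eps * int_dot (grad p) (grad psi) + int_mul (div u) psi = eps * G psi,
    is_tracev u u_b &
    Q (fun x => p x - p_b x)].

End sobolev.

(* Main.v *)
(* The errors w = u_eps - (u_PP + sum eps^-i v_i) and r = p_eps - (p_PP + sum eps^-i q_i) satisfy the
   homogeneous momentum equation and, by telescoping,
     eps <grad r, grad psi> + <div w, psi> = - eps^-k <div v_k, psi>   for psi in Q.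
   Testing with (w, r), Green's formula cancels the mixed terms and leaves
   |grad w|^2 + eps |grad r|^2 = - eps^-k <div v_k, r>, which bounds |grad r|; the momentum equation
   and Poincare's inequality then bound w by |grad r|.

   This needs w in H^1_0, that is: a function d of H^1 with zero trace is a limit of test functions.
   Let w_j be smooth, converging to d in H^1 and to 0 in L^2 of the boundary, and chi a cutoff that is 1
   outside the layer of width delta along the boundary.  The term w_j grad chi is controlled by
   delta^-2 times the integral of w_j^2 over the layer; integrating w_j along the direction e of a
   Lipschitz chart bounds it by a constant times
     delta^-1 (integral of w_j^2 over the boundary) + (integral of |grad w_j|^2 over a thin strip),
   which is small when delta, and then 1/j, are small.  The projection of the strip on the boundary
   along e is compared with the Hausdorff measure by covering: the tube of height h over a set of
   diameter d has Lebesgue measure O(h d^(n-1)). *)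
Require Import Defs.
From mathcomp Require Import all_boot all_order all_algebra.
From mathcomp Require Import all_classical all_reals all_analysis.
From mathcomp Require Import measurable_realfun.
From mathcomp Require Import ring lra.
Import Order.TTheory GRing.Theory Num.Theory.
Import numFieldNormedType.Exports.
Set Implicit Arguments.
Unset Strict Implicit.
Unset Printing Implicit Defensive.
Local Open Scope classical_set_scope.
Local Open Scope ring_scope.

(** * Borel sets and Lebesgue measure of R^n *)

(** The energy identity alone bounds grad w by a multiple of eps^(-k-1/2), which is too weak for
    large eps. The rate eps^(-k-1) for w comes from the momentum equation tested with w, which gives
    |grad w| <= K |grad r| with K independent of eps. A second obstacle is that [weak_pderiv]
    chooses a representative: the choice for a u + v need not be the combination of the choices for
    u and v. Identities between weak derivatives are therefore stated as equalities of pairings with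
    L2 functions, and they rest on the fundamental lemma of the calculus of variations. In the
    cutoff argument the gradient term of the layer estimate carries delta^2, which just cancels the
    delta^-2 of the cutoff. It is small only because the gradient of the fixed limit d is integrable
    and the strips shrink to the empty set. The boundary term still has one factor 1/delta left, so
    the approximant must be chosen after delta. *)

Definition pushforward_measure d d' (T1 : measurableType d)
    (T2 : measurableType d') (R : realFieldType) (m : {measure set T1 -> \bar R})
    (f : T1 -> T2) (mf : measurable_fun setT f) : {measure set T2 -> \bar R} :=
  measure_function_pushforward__canonical__measure_function_Measure m mf.

Section RVborel.
Variables (R : realType) (n : nat).

Lemma normr_rV_le (x : 'rV[R]_n) (i : 'I_n) : `|x ord0 i| <= `|x|.
Proof.
rewrite [leRHS]/Num.norm/= mx_normrE.
exact: (@le_bigmax _ _ _ _ (fun ij : 'I_1 * 'I_n => `|x ij.1 ij.2|) (ord0, i)).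
Qed.

Lemma normr_rV_bound (x : 'rV[R]_n) (M : R) : 0 <= M ->
  (forall i, `|x ord0 i| <= M) -> `|x| <= M.
Proof.
move=> M0 xM; rewrite [leLHS]/Num.norm/= mx_normrE.
by apply/bigmax_leP; split => // -[i j] _ /=; rewrite (ord1 i).
Qed.

(** The sigma-algebra is generated by the coordinates only, so an open set is written as a countable
    union of cubes with rational centre and radius 1/(m+1). *)
Lemma open_measurable_rV (A : set 'rV[R]_n) : open A -> measurable A.
Proof.
move=> oA.
pose B (qm : 'rV[rat]_n * nat) : set 'rV[R]_n :=
  [set x | forall i, `|ratr (qm.1 ord0 i) - x ord0 i| < qm.2.+1%:R^-1].
pose D : set ('rV[rat]_n * nat) := [set qm | B qm `<=` A].
have mB qm : measurable (B qm).
  have -> : B qm = \big[setI/setT]_(i < n)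
      (fun x : 'rV[R]_n => x ord0 i) @^-1` (ball (ratr (qm.1 ord0 i) : R) qm.2.+1%:R^-1).
    rewrite -bigcap_seq; apply/seteqP; split => [x Bx i _|x Bx i].
      exact: Bx.
    by apply: Bx => //=; rewrite mem_index_enum.
  apply: bigsetI_measurable => i _; rewrite -[X in measurable X]setTI.
  apply: (measurable_coord i measurableT); apply: open_measurable; exact: ball_open.
have -> : A = \bigcup_(qm in D) B qm.
  apply/seteqP; split => [x Ax|x [qm Dqm Bx]]; last exact: Dqm.
  have : nbhs x A by exact: open_nbhs_nbhs.
  rewrite -nbhs_ballE => -[e /= e0 eA].
  (* Two points of one such cube are at distance less than 2/(m+1), hence a radius below e/2. *)
  have [m hm] : exists m : nat, m.+1%:R^-1 < e / 2.
    near \oo => m; exists m; near: m.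
    by apply: near_infty_natSinv_lt (PosNum _); rewrite divr_gt0.
  have /choice[q hq] : forall i : 'I_n, exists q : rat, `|ratr q - x ord0 i| < m.+1%:R^-1.
    move=> i; have m0 : (0 : R) < m.+1%:R^-1 by rewrite invr_gt0.
    have [] := @rat_in_itvoo R (x ord0 i - m.+1%:R^-1) (x ord0 i + m.+1%:R^-1).
      by rewrite ltrBlDr -addrA ltrDl addr_gt0.
    move=> q; rewrite in_itv/= => qx; exists q.
    by rewrite ltr_distl.
  exists (\row_i q i, m).
    move=> y By; apply: eA; rewrite -ball_normE /ball_/=.
    rewrite (@le_lt_trans _ _ (m.+1%:R^-1 + m.+1%:R^-1))//; last by rewrite [ltRHS]splitr ltrD.
    apply: normr_rV_bound => [|i].
      by rewrite addr_ge0// invr_ge0.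
    rewrite !mxE (le_trans (ler_distD (ratr (q i)) _ _))// lerD//.
      by rewrite distrC ltW.
    by have := By i; rewrite /= mxE => /ltW.
  by move=> i /=; rewrite mxE.
rewrite bigcup_mkcond; apply: countable_bigcupT_measurable => //.
by move=> qm; case: ifP.
Unshelve. all: by end_near. Qed.

Lemma continuous_measurable_rV (f : 'rV[R]_n -> R) :
  continuous f -> measurable_fun setT f.
Proof.
move=> cf; apply: (measurability _ (measurable_realfun.RGenOInfty.measurableE R)).
move=> _ [_ [a ->] <-]; rewrite setTI.
apply: open_measurable_rV; apply: open_comp => [x _|]; first exact: cf.
exact: interval_open.
Qed.

End RVborel.

(** * Translation invariance of Lebesgue measure, and the measure of cubes *)

Section translation.
Variable R : realType.

Lemma measurable_addr (v : R) :
  measurable_fun setT (fun x : measurableTypeR R => x + v : measurableTypeR R).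
Proof. by apply: measurable_funD. Qed.

Lemma lebesgue_measure_translate (v : R) (A : set R) : measurable A ->
  lebesgue_measure [set x | A (x + v)] = lebesgue_measure A.
Proof.
move=> mA.
apply/esym; pose mu := pushforward_measure  (@lebesgue_measure R) (measurable_addr v).
rewrite -[RHS]/(mu A); refine (lebesgue_measure_unique (mu := mu) _ mA) => _ [[a b] _ <-].
rewrite [RHS](_ : _ = lebesgue_measure (`]a - v, b - v]%classic)).
  by rewrite !lebesgue_measure_itv/= !lte_fin ltrD2r -!EFinB; case: ifP => // _; congr EFin; ring.
congr lebesgue_measure; apply/seteqP; split => x /=; rewrite !in_itv/=; lra.
Qed.

Lemma measurable_addr_rV n (v : 'rV[R]_n) :
  measurable_fun setT (fun x : 'rV[R]_n => x + v).
Proof.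
apply: measurable_fun_rV => i; under eq_fun do rewrite mxE.
by apply: measurable_funD => //; exact: measurable_coord.
Qed.

(** Induction on the dimension: through [rV_cons] the measure is a product, and its translate has
    the same values on rectangles, so uniqueness of product measures applies. *)
Lemma lebesgue_rV_translate n (v : 'rV[R]_n) (A : set 'rV[R]_n) : measurable A ->
  lebesgue_rV R n [set x | A (x + v)] = lebesgue_rV R n A.
Proof.
elim: n v A => [|n IH] v A mA.
  by congr (lebesgue_rV R 0 _); apply/seteqP; split => x /=; rewrite [x + v]thinmx0 [x]thinmx0.
rewrite /= /lebesgue_consm.
pose sh (p : measurableTypeR R * 'rV[R]_n) : measurableTypeR R * 'rV[R]_n :=
  (p.1 + (rV_uncons v).1, p.2 + (rV_uncons v).2).
have msh : measurable_fun setT sh.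
  apply/measurable_fun_pairP; split.
    exact: (measurableT_comp (measurable_addr _) measurable_fst).
  exact: (measurableT_comp (measurable_addr_rV _) measurable_snd).
rewrite /pushforward.
have -> : (@rV_cons R n) @^-1` [set x | A (x + v)] = sh @^-1` ((@rV_cons R n) @^-1` A).
  apply/seteqP; split => p /=; congr (A _);
    (apply/rowP => i; rewrite !mxE; case: (unliftP ord0 i) => [j|] -> /=; rewrite ?mxE ?mxE//=).
pose mu := pushforward_measure (lebesgue_measure \x lebesgue_rV R n)%E msh.
rewrite -[LHS]/(mu (rV_cons (n:=n) @^-1` A)); apply/esym.
refine (@product_measure_unique _ _ _ _ _ _ _ mu _ _ _) => [B C mB mC|].
  rewrite /mu/= /pushforward.
  rewrite (_ : sh @^-1` _ = [set x | B (x + (rV_uncons v).1)] `*` [set x | C (x + (rV_uncons v).2)])//.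
  rewrite product_measure1E//.
  - by congr (_ * _)%E; [exact: lebesgue_measure_translate|exact: IH].
  - by rewrite -[X in measurable X]setTI; exact: measurable_addr.
  - by rewrite -[X in measurable X]setTI; exact: measurable_addr_rV.
by rewrite -[X in measurable X]setTI; exact: measurable_rV_cons.
Qed.

Lemma ge0_integral_translate n (v : 'rV[R]_n) (f : 'rV[R]_n -> \bar R) :
  measurable_fun setT f -> (forall x, 0 <= f x)%E ->
  (\int[lebesgue_rV R n]_x f (x + v)%R = \int[lebesgue_rV R n]_x f x)%E.
Proof.
move=> mf f0.
rewrite [RHS](eq_measure_integral (pushforward_measure (lebesgue_rV R n) (measurable_addr_rV v))).
  by rewrite ge0_integral_pushforward//; exact: measurable_addr_rV.
by move=> A mA _; apply/esym; exact: lebesgue_rV_translate.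
Qed.

Lemma integral_translate n (v : 'rV[R]_n) (f : 'rV[R]_n -> \bar R) :
  measurable_fun setT f ->
  (\int[lebesgue_rV R n]_x f (x + v)%R = \int[lebesgue_rV R n]_x f x)%E.
Proof.
move=> mf; rewrite integralE [RHS]integralE; congr (_ - _)%E.
  transitivity (\int[lebesgue_rV R n]_x (f^\+ (x + v)%R))%E.
    by apply: eq_integral => x _; rewrite !funeposE.
  by apply: ge0_integral_translate; [exact: measurable_funepos|exact: funepos_ge0].
transitivity (\int[lebesgue_rV R n]_x (f^\- (x + v)%R))%E.
    by apply: eq_integral => x _; rewrite !funenegE.
  by apply: ge0_integral_translate; [exact: measurable_funeneg|exact: funeneg_ge0].
Qed.

Definition cube n (a : 'rV[R]_n) (s : R) : set 'rV[R]_n :=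
  [set x | forall i, a ord0 i <= x ord0 i <= a ord0 i + s].

Lemma measurable_cube n (a : 'rV[R]_n) s : measurable (cube a s).
Proof.
have -> : cube a s = \big[setI/setT]_(i < n)
    (fun x : 'rV[R]_n => x ord0 i) @^-1` `[a ord0 i, a ord0 i + s].
  rewrite -bigcap_seq; apply/seteqP; split => [x Bx i _ /=|x Bx i].
    by rewrite in_itv/=; exact: Bx.
  by have := Bx i; rewrite /= in_itv/=; apply; rewrite mem_index_enum.
apply: bigsetI_measurable => i _; rewrite -[X in measurable X]setTI.
by apply: measurable_coord.
Qed.

Lemma lebesgue_rV_cube n (a : 'rV[R]_n) s : 0 <= s ->
  lebesgue_rV R n (cube a s) = (s ^+ n)%:E.
Proof.
move=> s0; elim: n a => [|n IH] a.
  by rewrite /= diracE expr0 mem_set// => -[].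
rewrite /= /lebesgue_consm /pushforward.
rewrite (_ : _ @^-1` _ = `[(rV_uncons a).1, (rV_uncons a).1 + s]%classic `*` cube (rV_uncons a).2 s).
  rewrite product_measure1E//; last exact: measurable_cube.
  rewrite [X in (X * _)%E](lebesgue_measure_itv `[_, _]) /= IH lte_fin -EFinB exprS.
  rewrite addrAC subrr add0r; case: ltP => [_|]; first by rewrite EFinM.
  by rewrite gerDl => s1; have -> : s = 0 by apply/le_anti/andP.
apply/seteqP; split => [[x y] /= h|[x y] /= [h1 h2] i].
  split; first by have := h ord0; rewrite rV_cons0 in_itv.
  by move=> j; have := h (lift ord0 j); rewrite rV_consS mxE.
case: (unliftP ord0 i) => [j|] ->; first by have := h2 j; rewrite rV_consS mxE.
by rewrite rV_cons0; rewrite in_itv in h1.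
Qed.

Lemma bounded_fin_measure n (A : set 'rV[R]_n) : measurable A -> bounded_set A ->
  (lebesgue_rV R n A < +oo)%E.
Proof.
move=> mA [M [Mr hM]]; have := hM (`|M| + 1) _; set M' := `|M| + 1.
have MM' : M < M' by rewrite /M' (le_lt_trans (ler_norm _))// ltrDl.
move=> /(_ MM') AM'.
have sub : A `<=` cube (\row_i (- M')) (M' + M').
  move=> x Ax i; rewrite mxE addrA addNr add0r -ler_norml.
  by rewrite (le_trans (normr_rV_le _ _))//; exact: AM'.
apply: (@le_lt_trans _ _ (lebesgue_rV R n (cube (\row_i (- M')) (M' + M')))).
  by apply: le_measure; rewrite ?inE//; exact: measurable_cube.
by rewrite lebesgue_rV_cube ?ltry// addr_ge0// addr_ge0.
Qed.

End translation.

(** * Smooth functions and cutoffs *)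

Section directional.
Variables (R : realType) (V : normedModType R).
Implicit Types f g : V -> R.

Lemma is_derive_cvg f x v d :
  (fun h : R => h^-1 * (f (h *: v + x) - f x)) @ 0^' --> d -> is_derive x v f d.
Proof.
move=> H; apply: DeriveDef; first by apply/cvg_ex; exists d; exact: H.
exact: (cvg_lim _ H).
Qed.

Lemma is_derive_fadd f g x v df dg : is_derive x v f df -> is_derive x v g dg ->
  is_derive x v (fun y => f y + g y) (df + dg).
Proof. exact: (@is_deriveD _ _ _ f g). Qed.

Lemma is_derive_fmul f g x v df dg : is_derive x v f df -> is_derive x v g dg ->
  is_derive x v (fun y => f y * g y) (df * g x + f x * dg).
Proof.
move=> hf hg; refine (is_derive_eq (@is_deriveM _ _ f g x v df dg hf hg) _).
by rewrite addrC; congr (_ + _); rewrite /GRing.scale/= mulrC.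
Qed.

Lemma is_derive_finv f x v df : f x != 0 -> is_derive x v f df ->
  is_derive x v (fun y => (f y)^-1) (- (df / f x ^+ 2)).
Proof.
move=> fx [h1 h2]; apply: DeriveDef; first exact: derivableV.
by rewrite deriveV// h2 /GRing.scale/= mulNr mulrC.
Qed.

(** Turns a directional derivative into the derivative of a function of one real variable, for which
    the chain rule and the mean value theorem are available. *)
Lemma is_derive_line f x v d :
  is_derive x v f d <-> is_derive (0 : R) 1 (fun h : R => f (h *: v + x)) d.
Proof.
have E : 'D_1 (fun h : R => f (h *: v + x)) (0 : R) = 'D_v f x.
  rewrite /derive; congr (lim (_ @ 0^')); apply/funext => h /=.
  by rewrite addr0 scale0r add0r [_%:A]mulr1.
have D := @derivable1P _ _ _ f x v.
by split=> -[h1 h2]; (apply: DeriveDef; [exact/D|by rewrite ?E// -E]).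
Qed.

Lemma is_derive_comp1 (h : R -> R) g x v dh dg :
  is_derive (g x) 1 h dh -> is_derive x v g dg ->
  is_derive x v (fun y => h (g y)) (dh * dg).
Proof.
move=> hh /is_derive_line hg; apply/is_derive_line.
have := @is_derive1_comp _ h (fun t : R => g (t *: v + x)) 0 dh dg.
by apply => //; rewrite scale0r add0r.
Qed.

End directional.

Lemma is_derive_line_at (R : realType) (V : normedModType R) (f : V -> R) x v (t : R) d : is_derive (t *: v + x) v f d ->
  is_derive t 1 (fun h : R => f (h *: v + x)) d.
Proof.
move=> /is_derive_line H; apply/(@is_derive_line _ _ (fun h : R => f (h *: v + x)) t 1 d).
rewrite (_ : (fun _ => _) = (fun h : R => f (h *: v + (t *: v + x)))) //.
by apply/funext => h; rewrite [h%:A]mulr1 scalerDl addrA.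
Qed.

Section flat.
Variable R : realType.
Implicit Type t : R.

(* The functions t^-k exp(-1/t), extended by 0 to t <= 0, are closed under
   differentiation up to linear combinations. *)
Definition flat (k : nat) t : R := if 0 < t then t^-1 ^+ k * expR (- t^-1) else 0.

Lemma flat_ge0 k t : 0 <= flat k t.
Proof.
by rewrite /flat; case: ltP => // t0; rewrite mulr_ge0 ?expR_ge0// exprn_ge0// invr_ge0 ltW.
Qed.

(** With s = 1/t, the term s^(k+2)/(k+2)! of the exponential series gives the bound. It makes
    [flat k] quadratically small at 0, so that its derivative there is 0. *)
Lemma flat_le k t : flat k t <= (k.+2`!)%:R * t ^+ 2.
Proof.
rewrite /flat; case: ltP => t0; last by rewrite mulr_ge0// sqr_ge0.
rewrite expRN ler_pdivrMr ?expR_gt0//.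
have s0 : 0 <= t^-1 by rewrite invr_ge0 ltW.
have := expR_ge1Dxn k.+1 s0.
move=> /(le_trans _) -/(_ (t^-1 ^+ k.+2 / k.+2`!%:R)); rewrite lerDr ler01 => /(_ isT) H.
have f0 : (0 : R) < k.+2`!%:R by rewrite ltr0n fact_gt0.
rewrite -(ler_pM2l (mulr_gt0 f0 (exprn_gt0 2 t0))) in H.
apply: le_trans H.
rewrite le_eqVlt; apply/orP; left; apply/eqP.
rewrite -addn2 exprD addn2; field.
by rewrite !gt_eqF.
Qed.

Lemma is_derive_flat k t : is_derive t 1 (flat k) (flat k.+2 t - k%:R * flat k.+1 t).
Proof.
have [t0|t0|->] := ltgtP t 0.
- rewrite {2 3}/flat !ltNge (ltW t0)/= mulr0 subr0.
  have C : is_derive t (1 : R) (cst (0 : R)) 0 by exact: is_derive_cst.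
  apply: near_eq_is_derive C.
  near=> s; rewrite /flat ltNge (_ : s <= 0)//; apply/ltW; near: s.
  exact: lt_nbhsl.
- apply: (@near_eq_is_derive _ _ _ (fun t => t^-1 ^+ k * expR (- t^-1))).
    near=> s; rewrite /flat (_ : 0 < s)//; near: s.
    exact: lt_nbhsr.
  rewrite /flat t0.
  have tn0 : t != 0 by rewrite gt_eqF.
  have dV : is_derive t 1 (fun t : R => t^-1) (- (1 / t ^+ 2)).
    by apply: is_derive_finv => //; exact: is_derive_id.
  have dE : is_derive t 1 (fun t : R => expR (- t^-1)) (expR (- t^-1) * (1 / t ^+ 2)).
    have dN : is_derive t 1 (fun t : R => - t^-1) (1 / t ^+ 2).
      by rewrite -[X in is_derive _ _ _ X]opprK; exact: (@is_deriveN _ _ _ (fun t : R => t^-1)).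
    exact: (is_derive_comp1 (is_derive_expR _) dN).
  have dX : is_derive t 1 (fun t : R => t^-1 ^+ k) (- (k%:R * t^-1 ^+ k.+1)).
    elim: k => [|k IH].
      have C : is_derive t (1 : R) (cst (1 : R)) 0 by exact: is_derive_cst.
      by rewrite mul0r oppr0; exact: C.
    under [X in is_derive _ _ X]eq_fun do rewrite exprS.
    refine (is_derive_eq (is_derive_fmul dV IH) _).
    rewrite mul1r -exprVn -natr1 !exprS; ring.
  refine (is_derive_eq (is_derive_fmul dX dE) _).
  rewrite mul1r -exprVn !exprS expr0; ring.
- rewrite /flat ltxx mulr0 subr0; apply: is_derive_cvg.
  rewrite ltxx; apply/cvgrPdist_le => e e0; near=> h.
  rewrite sub0r normrN [h%:A]mulr1 addr0 subr0 normrM.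
  have hn0 : h != 0 by near: h; exact: nbhs_dnbhs_neq.
  rewrite normfV ler_pdivrMl ?normr_gt0//.
  rewrite -/(flat k h) ger0_norm ?flat_ge0// (le_trans (flat_le k h))//.
  rewrite -real_normK ?num_real// expr2 mulrCA ler_pM2l ?normr_gt0//.
  have f0 : (0 : R) < k.+2`!%:R by rewrite ltr0n fact_gt0.
  rewrite -ler_pdivlMl//; near: h; apply: nbhs_dnbhs.
  by apply: (@nbhs0_le _ R^o); rewrite mulr_gt0// invr_gt0.
Unshelve. all: by end_near. Qed.

Lemma flat_continuous k : continuous (flat k).
Proof.
move=> t; apply: differentiable_continuous; apply/derivable1_diffP.
exact: (@ex_derive _ _ _ _ _ _ _ (is_derive_flat k t)).
Qed.

End flat.

Section smooth_calculus.
Variables (R : realType) (n : nat).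
Local Notation fct := ('rV[R]_n -> R).
Local Notation e_ := (unit_vec R).
Implicit Types f g : fct.

Lemma smooth_continuous f : smooth f -> continuous f.
Proof. by move=> /(_ [::])[]. Qed.

Lemma smooth_is_derive f i x : smooth f -> is_derive x (e_ i) f (pderiv i f x).
Proof. by move=> /(_ [::])[_ /(_ i x) h]; exact: derivableP. Qed.

Lemma smooth_pderiv i f : smooth f -> smooth (pderiv i f).
Proof. by move=> sf s; have := sf (rcons s i); rewrite foldr_rcons. Qed.

Lemma unit_vecE (i j : 'I_n) : e_ i ord0 j = (i == j)%:R.
Proof. by rewrite mxE eqxx eq_sym. Qed.

Lemma is_derive_coord (i : 'I_n) (x v : 'rV[R]_n) :
  is_derive x v (fun y => y ord0 i) (v ord0 i).
Proof.
apply: is_derive_cvg; have : (fun=> v ord0 i) @ (0 : R)^' --> v ord0 i by exact: cvg_cst.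
apply: cvg_trans; apply: near_eq_cvg; near=> h; rewrite !mxE addrK mulrA mulVf ?mul1r//.
near: h; exact: nbhs_dnbhs_neq.
Unshelve. all: by end_near. Qed.

(** [smooth] asks for all iterated partial derivatives, so it is proved at once for a class that
    differentiation preserves. [elem_flat] ranges over every [k] because differentiating [flat k]
    produces [flat k.+1] and [flat k.+2]; through [elem_smooth] the closure properties of [smooth]
    follow from those of the class. *)
Inductive elementary : fct -> Prop :=
| elem_smooth f of smooth f : elementary f
| elem_cst c : elementary (fun=> c)
| elem_coord i : elementary (fun x => x ord0 i)
| elem_flat k f of elementary f : elementary (fun x => flat k (f x))
| elem_add f g of elementary f & elementary g : elementary (fun x => f x + g x)
| elem_mul f g of elementary f & elementary g : elementary (fun x => f x * g x)
| elem_inv f of elementary f & (forall x, f x != 0) : elementary (fun x => (f x)^-1).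

Lemma elementary_continuous f : elementary f -> continuous f.
Proof.
elim=> {f} [f /smooth_continuous//|c|i|k f _ cf|f g _ cf _ cg|f g _ cf _ cg|f _ cf f0] x.
- exact: (@cvg_cst _ _ _ (nbhs x)).
- exact: coord_continuous.
- by apply: (@continuous_comp _ _ _ f (flat k)); [exact: cf|exact: flat_continuous].
- by apply: (@continuousD _ _ _ f g); [exact: cf|exact: cg].
- by apply: (@continuousM _ _ f g); [exact: cf|exact: cg].
- by apply: (@continuousV _ _ f) => //; exact: cf.
Qed.

Lemma elementary_pderiv f i : elementary f ->
  exists2 g, elementary g & forall x, is_derive x (e_ i) f (g x).
Proof.
elim=> {f} [f sf|c|j|k f ef [df edf hf]|f g ef [df edf hf] eg [dg edg hg]|
  f g ef [df edf hf] eg [dg edg hg]|f ef [df edf hf] f0].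
- exists (pderiv i f); first exact/elem_smooth/smooth_pderiv.
  by move=> x; exact: smooth_is_derive.
- by exists (fun=> 0) => [|x]; [exact: elem_cst|exact: is_derive_cst].
- exists (fun=> e_ i ord0 j); first exact: elem_cst.
  by move=> x; exact: is_derive_coord.
- exists (fun x => (flat k.+2 (f x) + (- k%:R) * flat k.+1 (f x)) * df x).
    apply: elem_mul => //; apply: elem_add; first exact: elem_flat.
    by apply: elem_mul; [exact: elem_cst|exact: elem_flat].
  move=> x; rewrite mulNr; exact: (is_derive_comp1 (is_derive_flat k (f x)) (hf x)).
- exists (fun x => df x + dg x); first exact: elem_add.
  by move=> x; exact: is_derive_fadd.
- exists (fun x => df x * g x + f x * dg x).
    by apply: elem_add; exact: elem_mul.
  by move=> x; exact: is_derive_fmul.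
- exists (fun x => (-1) * (df x * ((f x)^-1 * (f x)^-1))).
    by apply: elem_mul; [exact: elem_cst|do ?[apply: elem_mul => //|exact: elem_inv]].
  by move=> x; rewrite mulN1r -invfM -expr2; exact: is_derive_finv.
Qed.

Lemma pderivE f i (g : fct) : (forall x, is_derive x (e_ i) f (g x)) -> pderiv i f = g.
Proof. by move=> h; apply/funext => x; exact: (@derive_val _ _ _ _ _ _ _ (h x)). Qed.

Lemma elementary_is_smooth f : elementary f -> smooth f.
Proof.
move=> ef s; have {}ef : elementary (foldr (@pderiv R n) f s).
  elim: s => //= i s /elementary_pderiv -/(_ i)[g eg hg].
  by rewrite (pderivE hg).
split; first exact: elementary_continuous.
by move=> i x; have [g _ hg] := elementary_pderiv i ef; exact: (@ex_derive _ _ _ _ _ _ _ (hg x)).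
Qed.

Lemma smooth_cst (c : R) : smooth ((fun=> c) : fct).
Proof. exact/elementary_is_smooth/elem_cst. Qed.

Lemma smoothD f g : smooth f -> smooth g -> smooth (fun x => f x + g x).
Proof. by move=> sf sg; apply: elementary_is_smooth; apply: elem_add; exact: elem_smooth. Qed.

Lemma smoothM f g : smooth f -> smooth g -> smooth (fun x => f x * g x).
Proof. by move=> sf sg; apply: elementary_is_smooth; apply: elem_mul; exact: elem_smooth. Qed.

Lemma smooth_coord i : smooth (fun x : 'rV[R]_n => x ord0 i).
Proof. exact/elementary_is_smooth/elem_coord. Qed.

Lemma smooth_sum (I : Type) (r : seq I) (P : pred I) (F : I -> fct) :
  (forall i, smooth (F i)) -> smooth (fun x => \sum_(i <- r | P i) F i x).
Proof.
move=> sF; elim: r => [|i r IH].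
  by under eq_fun do rewrite big_nil; exact: smooth_cst.
under eq_fun do rewrite big_cons; case: (P i); [exact: (smoothD (sF i) IH)|exact: IH].
Qed.

Lemma smooth_prod (I : Type) (r : seq I) (P : pred I) (F : I -> fct) :
  (forall i, smooth (F i)) -> smooth (fun x => \prod_(i <- r | P i) F i x).
Proof.
move=> sF; elim: r => [|i r IH].
  by under eq_fun do rewrite big_nil; exact: smooth_cst.
under eq_fun do rewrite big_cons; case: (P i); [exact: (smoothM (sF i) IH)|exact: IH].
Qed.

Lemma pderivD i f g : smooth f -> smooth g ->
  pderiv i (fun x => f x + g x) = (fun x => pderiv i f x + pderiv i g x).
Proof. by move=> sf sg; apply: pderivE => x; apply: is_derive_fadd; exact: smooth_is_derive. Qed.

Lemma pderivM i f g : smooth f -> smooth g ->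
  pderiv i (fun x => f x * g x) = (fun x => pderiv i f x * g x + f x * pderiv i g x).
Proof. by move=> sf sg; apply: pderivE => x; apply: is_derive_fmul; exact: smooth_is_derive. Qed.

Lemma pderiv_cst i c : pderiv i (fun=> c : R) = (fun=> 0) :> fct.
Proof. by apply: pderivE => x; exact: is_derive_cst. Qed.

Lemma pderiv_coord i j : pderiv i (fun x : 'rV[R]_n => x ord0 j) = (fun=> (i == j)%:R).
Proof. by apply: pderivE => x; rewrite -unit_vecE; exact: is_derive_coord. Qed.

End smooth_calculus.

(** * Derivatives along arbitrary directions *)

Section line_calculus.
Variables (R : realType) (V : normedModType R).
Implicit Types f : V -> R.

Lemma is_derive_dirZ f x v d (a : R) : is_derive x v f d -> is_derive x (a *: v) f (a * d).
Proof.
move=> /is_derive_line H; apply/is_derive_line.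
have C : is_derive (0 : R) (1 : R) (fun t : R => t * a) (1 * a + 0 * 0).
  exact: (is_derive_fmul (@is_derive_id _ _ (0 : R) (1 : R)) (@is_derive_cst _ _ _ a (0 : R) (1 : R))).
rewrite (_ : (fun _ => _) = (fun t : R => (fun h : R => f (h *: v + x)) (t * a))); last first.
  by apply/funext => t; rewrite scalerA.
rewrite mul1r mul0r addr0 in C; rewrite mulrC.
by apply: (@is_derive_comp1 _ _ (fun h : R => f (h *: v + x)) (fun t : R => t * a) 0 1) => //; rewrite mul0r.
Qed.

Lemma line_MVT f v y (df : V -> R) : (forall x, is_derive x v f (df x)) ->
  exists2 c : R, 0 <= c <= 1 & f (v + y) - f y = df (c *: v + y).
Proof.
move=> hf; have D (t : R) : is_derive t (1 : R) (fun h : R => f (h *: v + y)) (df (t *: v + y)).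
  exact: is_derive_line_at.
have := @MVT_segment R (fun h : R => f (h *: v + y)) (fun t => df (t *: v + y)) 0 1 ler01 (fun t _ => D t).
case.
  apply: continuous_subspaceT => t; apply: differentiable_continuous; apply/derivable1_diffP.
  exact: (@ex_derive _ _ _ _ _ _ _ (D t)).
by move=> c; rewrite in_itv/= => c01; rewrite scale1r scale0r add0r subr0 mulr1; exists c.
Qed.

(** The increment along h (v + w) is split at h w + x. By the mean value theorem the v-part is h
    times [df] at an intermediate point, and continuity of [df] at [x] gives the limit. *)
Lemma is_derive_dirD f x v w d (df : V -> R) : (forall x, is_derive x v f (df x)) ->
  {for x, continuous df} ->
  is_derive x w f d -> is_derive x (v + w) f (df x + d).
Proof.
move=> hf cf [h1 h2]; apply: is_derive_cvg.
rewrite (_ : (fun _ => _) = (fun h : R => h^-1 * (f (h *: v + (h *: w + x)) - f (h *: w + x))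
   + h^-1 * (f (h *: w + x) - f x))); last first.
  by apply/funext => h; rewrite scalerDr addrA -mulrDr subrKA.
apply: cvgD; last by rewrite -h2; exact: h1.
apply/cvgrPdist_le => e e0.
have /cvgrPdist_le/(_ e e0)/nbhs_ballP[r /= r0 hr] := cf.
near=> h.
have hn0 : h != 0 by near: h; exact: nbhs_dnbhs_neq.
have [c /andP[c0 c1] ->] := @line_MVT f (h *: v) (h *: w + x) (fun x => h * df x)
  (fun x => is_derive_dirZ h (hf x)).
rewrite mulrA mulVf// mul1r; apply: hr; rewrite -ball_normE /ball_/=.
rewrite [c *: _ + _]addrA opprD addrCA subrr addr0 normrN.
rewrite scalerA mulrC -scalerA -scalerDr normrZ.
rewrite (@le_lt_trans _ _ (`|h| * (`|v| + `|w|)))//.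
  rewrite ler_pM// (le_trans (ler_normD _ _))// lerD2r normrZ ger0_norm// ler_piMl//.
rewrite (@le_lt_trans _ _ (`|h| * (`|v| + `|w| + 1)))//.
  by rewrite ler_pM// ?addr_ge0// lerDl.
rewrite -ltr_pdivlMr; last by rewrite ltr_wpDl// addr_ge0.
near: h; apply: nbhs_dnbhs; apply: (@nbhs0_lt _ R^o).
by rewrite divr_gt0// ltr_wpDl// addr_ge0.
Unshelve. all: by end_near. Qed.

End line_calculus.

(** [smooth] speaks of coordinate directions only; the others are reached by adding one coordinate
    component at a time. *)
Lemma smooth_is_derive_dir (R : realType) n (f : 'rV[R]_n -> R) x v : smooth f ->
  is_derive x v f (\sum_i v ord0 i * pderiv i f x).
Proof.
move=> sf; rewrite [X in is_derive _ X](row_sum_delta v).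
elim: (index_enum _) => [|i r IH]; first by rewrite !big_nil; exact: is_derive0.
rewrite !big_cons.
apply: (@is_derive_dirD _ _ f x _ _ _ (fun x => v ord0 i * pderiv i f x)) IH.
  by move=> y; apply: is_derive_dirZ; exact: smooth_is_derive.
apply: (@continuousM _ _ (fun=> v ord0 i)); first exact: cst_continuous.
by apply: smooth_continuous; exact: smooth_pderiv.
Qed.

(** * A smooth step, and a bump whose integer translates sum to 1 *)

Section step.
Variable R : realType.
Implicit Type t : R.

Lemma flat_gt0 k t : 0 < t -> 0 < flat k t.
Proof. by move=> t0; rewrite /flat t0 mulr_gt0 ?expR_gt0// exprn_gt0// invr_gt0. Qed.

Lemma flat_le0 k t : t <= 0 -> flat k t = 0.
Proof. by rewrite /flat leNgt => /negbTE ->. Qed.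

Definition step_den t : R := flat 0 t + flat 0 (1 - t).

Definition step t : R := flat 0 t * (step_den t)^-1.

Lemma step_den_gt0 t : 0 < step_den t.
Proof.
have [t0|t0] := ltP 0 t; first by rewrite ltr_wpDr ?flat_ge0// flat_gt0.
by rewrite ltr_wpDl ?flat_ge0// flat_gt0// subr_gt0 (le_lt_trans t0).
Qed.

Lemma step_le0 t : t <= 0 -> step t = 0.
Proof. by move=> t0; rewrite /step flat_le0// mul0r. Qed.

Lemma step_ge1 t : 1 <= t -> step t = 1.
Proof.
move=> t1; rewrite /step /step_den [X in _ + X]flat_le0 ?subr_le0// addr0 mulfV//.
by rewrite gt_eqF// flat_gt0// (lt_le_trans _ t1).
Qed.

Lemma step_ge0 t : 0 <= step t.
Proof. by rewrite mulr_ge0 ?flat_ge0// invr_ge0 ltW// step_den_gt0. Qed.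

Lemma step_le1 t : step t <= 1.
Proof. by rewrite ler_pdivrMr ?step_den_gt0// mul1r lerDl flat_ge0. Qed.

Definition dstep t : R :=
  flat 2 t * (step_den t)^-1 - flat 0 t * ((flat 2 t - flat 2 (1 - t)) / step_den t ^+ 2).

Lemma is_derive_step t : is_derive t 1 step (dstep t).
Proof.
have F t' : is_derive t' (1 : R) (@flat R 0) (flat 2 t').
  by have := is_derive_flat 0 t'; rewrite mul0r subr0.
have N : is_derive t (1 : R) (fun t : R => 1 + - t) (0 + - 1).
  by apply: is_derive_fadd.
have D : is_derive t (1 : R) step_den (flat 2 t - flat 2 (1 - t)).
  rewrite -[X in _ - X]mulr1 -mulrN -[X in _ * X]add0r.
  by apply: is_derive_fadd => //; exact: (is_derive_comp1 (F _) N).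
rewrite /dstep -mulrN; apply: is_derive_fmul => //; apply: is_derive_finv => //.
by rewrite gt_eqF// step_den_gt0.
Qed.

Lemma dstep_out t : ~~ (0 < t < 1) -> dstep t = 0.
Proof.
rewrite negb_and -!leNgt => /orP[t0|t1].
  by rewrite /dstep !(flat_le0 _ t0) !mul0r subrr.
rewrite /dstep /step_den !(@flat_le0 _ (1 - t)) ?subr_le0// subr0 addr0.
have : flat 0 t != 0 by rewrite gt_eqF// flat_gt0// (lt_le_trans _ t1).
by move=> f0; field.
Qed.

Lemma dstep_continuous : continuous dstep.
Proof.
have cn : continuous (fun t : R => 1 - t).
  by move=> t; apply: cvgB; [exact: cvg_cst|exact: cvg_id].
have cf k : continuous (fun t : R => flat k (1 - t)).
  by move=> t; apply: (@continuous_comp _ _ _ (fun t => 1 - t) (flat k)); [exact: cn|exact: flat_continuous].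
have cd : continuous step_den.
  by move=> t; apply: (@continuousD _ _ _ (flat 0)); [exact: flat_continuous|exact: cf].
have ci : continuous (fun t => (step_den t)^-1).
  by move=> t; apply: continuousV; [rewrite gt_eqF// step_den_gt0|exact: cd].
move=> t; apply: (@continuousB _ _ _ (fun t => flat 2 t * (step_den t)^-1)).
  by apply: (@continuousM _ _ (flat 2)); [exact: flat_continuous|exact: ci].
apply: (@continuousM _ _ (flat 0)); first exact: flat_continuous.
apply: (@continuousM _ _ (fun t => flat 2 t - flat 2 (1 - t))).
  by apply: (@continuousB _ _ _ (flat 2)); [exact: flat_continuous|exact: cf].
have -> : (fun t => step_den t ^- 2) = (fun t => (step_den t)^-1 * (step_den t)^-1).
  by apply/funext => u; rewrite expr2 invfM.
by apply: (@continuousM _ _ (fun t => (step_den t)^-1)); exact: ci.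
Qed.

Lemma dstep_bounded : exists2 M : R, 0 < M & forall t, `|dstep t| <= M.
Proof.
have [|c _ hc] := @EVT_max R (fun t => `|dstep t|) 0 1 ler01.
  apply: continuous_subspaceT => t; apply: (@continuous_comp _ _ _ dstep (fun x => `|x|)).
    exact: dstep_continuous.
  exact: norm_continuous.
exists (`|dstep c| + 1) => [|t]; first by rewrite ltr_wpDl.
have [t01|/dstep_out ->] := boolP (0 < t < 1); last by rewrite normr0 addr_ge0.
rewrite (le_trans (hc t _)) ?lerDl//.
by rewrite in_itv/= !ltW//; case/andP: t01.
Qed.

Lemma elementaryN n (f : 'rV[R]_n -> R) : elementary f -> elementary (fun x => - f x).
Proof.
move=> ef; under eq_fun do rewrite -mulN1r.
by apply: elem_mul => //; exact: elem_cst.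
Qed.

Lemma step_elementary n (f : 'rV[R]_n -> R) : elementary f -> elementary (fun x => step (f x)).
Proof.
move=> ef; apply: elem_mul; first exact: elem_flat.
apply: elem_inv => [|x]; last by rewrite gt_eqF// step_den_gt0.
apply: elem_add; apply: elem_flat => //.
apply: elem_add; first exact: elem_cst.
exact: elementaryN.
Qed.

(** A bump supported in [0, 2]. Its integer translates telescope to a difference of two steps, so
    they form a partition of unity. *)
Definition hat t : R := step t - step (t - 1).

Definition dhat t : R := dstep t - dstep (t - 1).

Lemma hat_out t : ~~ (0 < t < 2) -> hat t = 0.
Proof.
rewrite negb_and -!leNgt => /orP[t0|t2]; rewrite /hat.
  by rewrite !step_le0 ?subrr// lerBlDr add0r (le_trans t0).
by rewrite !step_ge1 ?subrr// ?lerBrDr// (le_trans _ t2)// ler1n.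
Qed.

Lemma dhat_out t : ~~ (0 < t < 2) -> dhat t = 0.
Proof.
rewrite negb_and -!leNgt => /orP[t0|t2]; rewrite /dhat !dstep_out ?subrr//.
- by rewrite negb_and -!leNgt lerBlDr add0r (le_trans t0).
- by rewrite negb_and -!leNgt t0.
- by rewrite negb_and -!leNgt !lerBrDr t2 orbT.
- by rewrite negb_and -!leNgt (le_trans _ t2) ?orbT// ler1n.
Qed.

Lemma is_derive_hat t : is_derive t 1 hat (dhat t).
Proof.
have N : is_derive t (1 : R) (fun t : R => t + - 1) (1 + 0).
  by apply: is_derive_fadd.
have := @is_derive_comp1 _ _ step (fun t => t + - 1) t 1 _ _ (is_derive_step (t - 1)) N; rewrite addr0 mulr1 => D.
have D2 := is_derive_step t.
by apply: is_derive_fadd; exact: (@is_deriveN _ _ _ (fun t => step (t - 1))).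
Qed.

Lemma hat_le1 t : `|hat t| <= 1.
Proof.
rewrite ler_norml /hat; have := step_ge0 t; have := step_le1 t.
have := step_ge0 (t - 1); have := step_le1 (t - 1); lra.
Qed.

Lemma sum_hat (N : nat) t : 1 <= t <= N%:R -> \sum_(l < N) hat (t - l%:R) = 1.
Proof.
move=> /andP[t1 tN].
have -> : \sum_(l < N) hat (t - l%:R) = step t - step (t - N%:R).
  elim: N {tN} => [|N IH]; first by rewrite big_ord0 subr0 subrr.
  by rewrite big_ord_recr/= IH /hat -natr1 opprD !addrA subrK.
by rewrite step_ge1// step_le0 ?subr0// subr_le0.
Qed.

Lemma sum_shift_le (f : R -> R) (M : R) (N : nat) t : (forall t, ~~ (0 < t < 2) -> f t = 0) ->
  (forall t, `|f t| <= M) -> \sum_(l < N) `|f (t - l%:R)| <= 2 * M.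
Proof.
move=> f0 fM; have M0 : 0 <= M by apply: le_trans (fM 0).
(* The induction needs the count at the left end: no translate is active for t <= 0 and at most one
   for t <= 1, hence at most two in general, whatever [N] is. *)
suff : (t <= 0 -> \sum_(l < N) `|f (t - l%:R)| <= 0) /\
       (t <= 1 -> \sum_(l < N) `|f (t - l%:R)| <= M) /\
  \sum_(l < N) `|f (t - l%:R)| <= 2 * M by case=> _ [].
elim: N t => [|N IH] t; first by rewrite !big_ord0 mulr_ge0//.
have -> : \sum_(l < N.+1) `|f (t - l%:R)| = `|f t| + \sum_(l < N) `|f (t - 1 - l%:R)|.
  rewrite big_ord_recl/= subr0; congr (_ + _); apply: eq_bigr => l _.
  by rewrite /bump/= -natr1 [l%:R + 1]addrC opprD addrA.
have [IH0 [IH1 IH2]] := IH (t - 1).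
have ft0 : t <= 0 -> f t = 0 by move=> t0; apply: f0; rewrite negb_and -leNgt t0.
split; [|split].
- move=> t0; rewrite ft0// normr0 add0r; apply: IH0; lra.
- move=> t1; rewrite -[leRHS]addr0 lerD//; apply: IH0; lra.
- have [t2|t2] := leP t 2.
    rewrite mulr_natl mulr2n lerD//; apply: IH1; lra.
  by rewrite f0 ?normr0 ?add0r// negb_and -!leNgt (ltW t2) orbT.
Qed.

End step.

Lemma is_derive_fsum (R : realType) (V : normedModType R) (I : Type) (r : seq I)
    (P : pred I) (f : I -> V -> R) (df : I -> R) x v :
  (forall i, is_derive x v (f i) (df i)) ->
  is_derive x v (fun y => \sum_(i <- r | P i) f i y) (\sum_(i <- r | P i) df i).
Proof.
move=> hf; elim: r => [|i r IH].
  have C : is_derive x v (cst (0 : R)) 0 by exact: is_derive_cst.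
  by rewrite big_nil; under [X in is_derive _ _ X]eq_fun do rewrite big_nil; exact: C.
rewrite big_cons; under [X in is_derive _ _ X]eq_fun do rewrite big_cons.
by case: (P i); [exact: (is_derive_fadd (hf i) IH)|exact: IH].
Qed.

Lemma compact_cube (R : realType) n (a : 'rV[R]_n) s : compact (cube a s).
Proof.
have -> : cube a s = [set v | forall i, `[a ord0 i, a ord0 i + s]%classic (v ord0 i)].
  by apply/seteqP; split => x h i; have := h i; rewrite /= in_itv.
apply: (@rV_compact _ _ (fun i => `[a ord0 i, a ord0 i + s]%classic)) => i.
exact: segment_compact.
Qed.

(** * Cutoff functions from a partition of unity on a grid of mesh [delta] *)

Section cutoff.
Variables (R : realType) (n : nat) (Omega : set 'rV[R]_n).

Section grid.
Variables (M delta : R) (N : nat).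
Hypothesis d0 : 0 < delta.
Local Notation s x j := ((x ord0 j + M) / delta + 1).

(** The index [k] labels a cell of the grid. The shifts in the rescaled coordinate send [-M, M] to
    [1, 2 M / delta + 1], a range on which enough hats sum to 1. *)
Definition grid_fun (k : {ffun 'I_n -> 'I_N}) (x : 'rV[R]_n) : R :=
  \prod_j hat (s x j - (k j)%:R).

Definition grid_dfun (k : {ffun 'I_n -> 'I_N}) (i : 'I_n) (x : 'rV[R]_n) : R :=
  delta^-1 * \prod_j (if j == i then @dhat R else @hat R) (s x j - (k j)%:R).

Definition grid_cube (k : {ffun 'I_n -> 'I_N}) : set 'rV[R]_n :=
  cube (\row_j (((k j)%:R - 1) * delta - M)) (2 * delta).

Lemma grid_cubeP k x : grid_cube k x <-> forall j, 0 <= s x j - (k j)%:R <= 2.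
Proof.
have E j : (((k j)%:R - 1) * delta - M <= x ord0 j <= ((k j)%:R - 1) * delta - M + 2 * delta)
    = (0 <= s x j - (k j)%:R <= 2).
  rewrite subr_ge0 -[in RHS]lerBlDr ler_pdivlMr// lerBlDr; congr (_ && _).
  rewrite lerBlDr -lerBrDr ler_pdivrMr// -lerBrDr.
  by congr (_ <= _); ring.
by split => h j; [rewrite -E|rewrite mxE E]; have := h j; rewrite ?mxE.
Qed.

Lemma grid_fun_out k x : ~ grid_cube k x -> grid_fun k x = 0.
Proof.
move=> h; have [j hj] : exists j, ~~ (0 <= s x j - (k j)%:R <= 2).
  apply: contrapT => H; apply: h; apply/grid_cubeP => j; apply: contrapT => /negP hj.
  by apply: H; exists j.
rewrite /grid_fun (bigD1 j)//= hat_out ?mul0r//; apply: contra hj => /andP[h1 h2].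
by rewrite !ltW.
Qed.

Lemma grid_fun_smooth k : smooth (grid_fun k).
Proof.
apply: smooth_prod => j; apply: elementary_is_smooth.
have H c : elementary (fun x : 'rV[R]_n => step ((x ord0 j + M) / delta + 1 - (k j)%:R + c)).
  apply: step_elementary; do 3 (apply: elem_add; last exact: elem_cst).
  apply: elem_mul; last exact: elem_cst.
  by apply: elem_add; [exact: elem_coord|exact: elem_cst].
rewrite /hat; apply: elem_add.
  by have := H 0; under [X in elementary X]eq_fun do rewrite addr0.
by apply: elementaryN; exact: H.
Qed.

Lemma is_derive_grid_fun k i x : is_derive x (unit_vec R i) (grid_fun k) (grid_dfun k i x).
Proof.
apply/is_derive_line.
rewrite (_ : (fun _ => _) = (fun h : R => hat (h * delta^-1 + (s x i - (k i)%:R)) *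
  \prod_(j | j != i) hat (s x j - (k j)%:R))); last first.
  apply/funext => h; rewrite /grid_fun (bigD1 i)//=; congr (hat _ * _).
    by rewrite !mxE !eqxx mulr1 -[h + _ + _]addrA mulrDl !addrA.
  by apply: eq_bigr => j ji; rewrite !mxE (negbTE ji) andbF mulr0 add0r.
have -> : grid_dfun k i x = delta^-1 * (dhat (s x i - (k i)%:R) * \prod_(j | j != i) hat (s x j - (k j)%:R)).
  by rewrite /grid_dfun (bigD1 i)//= eqxx; do 2 congr (_ * _); apply: eq_bigr => j /negbTE ->.
have L : is_derive (0 : R) (1 : R) (fun h : R => h * delta^-1 + (s x i - (k i)%:R)) (1 * delta^-1 + 0 * 0 + 0).
  by apply: is_derive_fadd; exact: is_derive_fmul.
have D := @is_derive_comp1 _ _ (@hat R) (fun h : R => h * delta^-1 + (s x i - (k i)%:R)) 0 1 _ _ (is_derive_hat _) L.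
refine (is_derive_eq (is_derive_fmul D (@is_derive_cst _ _ _ (\prod_(j | j != i) hat (s x j - (k j)%:R)) (0 : R) (1 : R))) _).
by rewrite /= !mul0r !add0r; ring.
Qed.

(** Distributivity turns the sum over all cells of a product into a product of one-dimensional sums,
    in each of which at most two translates overlap; hence a bound free of [N] and [delta]. *)
Lemma grid_sum_le (F : 'I_n -> R -> R) (C : R) (x : 'rV[R]_n) :
  (forall i t, ~~ (0 < t < 2) -> F i t = 0) -> (forall i t, `|F i t| <= C) ->
  \sum_(k : {ffun 'I_n -> 'I_N}) `|\prod_j F j (s x j - (k j)%:R)| <= (2 * C) ^+ n.
Proof.
move=> F0 FC; under eq_bigr do rewrite normr_prod.
rewrite -(bigA_distr_bigA (fun j (l : 'I_N) => `|F j (s x j - l%:R)|)).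
rewrite -[leRHS]mulr1 -[n in leRHS]card_ord -prodr_const mulr1.
apply: ler_prod => j _; apply/andP; split; first exact: sumr_ge0.
exact: (@sum_shift_le R (F j) C N (s x j) (F0 j) (FC j)).
Qed.

End grid.

(** The cutoff adds the grid functions of the cells contained in [Omega]. A cell has side 2 delta,
    so around a point whose 2 delta-neighbourhood lies in [Omega] every active cell counts and the
    sum is 1. The scale enters only through the factor 1/delta that comes from differentiating one
    hat. *)
Lemma cutoff : bounded_set Omega -> exists2 C : R, 0 < C &
  forall delta, 0 < delta -> exists chi : 'rV[R]_n -> R,
  [/\ test_function Omega chi, forall x, `|chi x| <= C,
    forall i x, `|pderiv i chi x| <= C / delta &
    forall x, Omega x -> (forall y, `|y - x| <= 2 * delta -> Omega y) -> chi x = 1].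
Proof.
move=> [M0 [_ hM0]]; set M := `|M0| + 1.
have OM x : Omega x -> `|x| <= M.
  by move: x; apply: hM0; rewrite (le_lt_trans (ler_norm _))// ltrDl.
have Mge0 : 0 <= M by rewrite addr_ge0.
have [D0 D0gt hD0] := @dstep_bounded R.
set D := 2 * D0 + 1.
have D1 : 1 <= D by rewrite lerDr mulr_ge0// ltW.
have hdhat t : `|dhat t| <= D.
  rewrite (le_trans (ler_normB _ _))// (@le_trans _ _ (D0 + D0))//; first by rewrite lerD.
  by rewrite /D mulr_natl mulr2n lerDl.
have hhat t : `|hat t| <= D by rewrite (le_trans (hat_le1 t)).
exists ((2 * D) ^+ n) => [|delta d0]; first by rewrite exprn_gt0// mulr_gt0// (lt_le_trans _ D1).
(* Enough cells for all of [-M, M]: [sum_hat] needs the rescaled coordinate in [1, N]. *)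
set N := Num.bound (2 * M / delta + 1).
have hN : 2 * M / delta + 1 <= N%:R.
  by apply/ltW/archi_boundP; rewrite addr_ge0// divr_ge0 ?mulr_ge0// ltW.
pose good (k : {ffun 'I_n -> 'I_N}) := `[< grid_cube M delta k `<=` Omega >].
pose chi x := \sum_(k | good k) grid_fun M delta k x.
have schi : smooth chi by apply: smooth_sum => k; exact: grid_fun_smooth.
exists chi; split.
- split => //; exists (\bigcup_(k in [set k | (k \in index_enum _) && good k]) grid_cube M delta k); split.
  + by rewrite bigcup_seq_cond; apply: bigsetU_compact => k _; exact: compact_cube.
  + by move=> x [k /andP[_ /asboolP]]; exact.
  + move=> x hx; rewrite /chi big1// => k gk; apply: grid_fun_out => //.
    by move=> kx; apply: hx; exists k => //=; rewrite mem_index_enum.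
- move=> x; rewrite (le_trans (ler_norm_sum _ _ _))//.
  rewrite (le_trans _ (@grid_sum_le M delta N (fun _ => @hat R) D x _ _))//.
    by rewrite [leLHS]big_mkcond/=; apply: ler_sum => k _; case: ifP.
  by move=> _ t; exact: hat_out.
- move=> i x.
  have -> : pderiv i chi x = \sum_(k | good k) grid_dfun M delta k i x.
    have Hd y : is_derive y (unit_vec R i) chi (\sum_(k | good k) grid_dfun M delta k i y).
      by apply: is_derive_fsum => k; exact: is_derive_grid_fun.
    by rewrite (pderivE Hd).
  rewrite (le_trans (ler_norm_sum _ _ _))//.
  rewrite (@le_trans _ _ (\sum_(k : {ffun 'I_n -> 'I_N}) `|grid_dfun M delta k i x|))//.
    by rewrite [leLHS]big_mkcond/=; apply: ler_sum => k _; case: ifP.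
  under eq_bigr do rewrite normrM.
  rewrite -mulr_sumr mulrC normfV gtr0_norm// ler_pM2r ?invr_gt0//.
  apply: (@grid_sum_le M delta N (fun j => if j == i then @dhat R else @hat R)) => j t.
    by case: ifP => _; [exact: dhat_out|exact: hat_out].
  by case: ifP.
- move=> x Ox hx; transitivity (\sum_k grid_fun M delta (N := N) k x).
    rewrite [RHS](bigID good)/= [X in _ + X]big1 ?addr0// => k /asboolP bk.
    apply: grid_fun_out => // kx; apply: bk => y ky; apply: hx.
    apply: normr_rV_bound => [|j]; first by rewrite mulr_ge0// ltW.
    have := kx j; have := ky j; rewrite !mxE ler_norml => /andP[h1 h2] /andP[h3 h4].
    by apply/andP; split; lra.
  rewrite /grid_fun -(bigA_distr_bigA (fun j (l : 'I_N) => hat ((x ord0 j + M) / delta + 1 - l%:R))).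
  apply: big1 => j _; apply: sum_hat.
  have := le_trans (normr_rV_le x j) (OM x Ox); rewrite ler_norml => /andP[h1 h2].
  rewrite lerDr divr_ge0 ?(ltW d0)//=; last lra.
  rewrite (le_trans _ hN)// lerD2r ler_pM2r ?invr_gt0//; lra.
Qed.

End cutoff.

(** * The L2 pairing and the fundamental lemma *)

Section L2_space.
Variables (R : realType) (n : nat) (Omega : set 'rV[R]_n).
Hypothesis mO : measurable Omega.
Local Notation leb := (lebesgue_rV R n).
Local Notation fct := ('rV[R]_n -> R).
Local Notation I := (int_mul Omega).
Local Notation L2 := (L2 Omega).
Local Notation N := (L2norm Omega).
Implicit Types f g h : fct.

Lemma L2_integrable f g : L2 f -> L2 g -> leb.-integrable Omega (EFin \o (fun x => f x * g x)).
Proof.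
move=> [mf If] [mg Ig].
have mM : measurable_fun Omega (fun x => f x * g x) by exact: measurable_funM.
apply/integrableP; split; first exact/measurable_EFinP.
have m2 : measurable_fun Omega (fun x => (f x ^+ 2)%:E) by exact/measurable_EFinP/measurable_funX.
have m3 : measurable_fun Omega (fun x => (g x ^+ 2)%:E) by exact/measurable_EFinP/measurable_funX.
apply: (@le_lt_trans _ _ (\int[leb]_(x in Omega) ((f x ^+ 2)%:E + (g x ^+ 2)%:E))%E).
  apply: ge0_le_integral => //.
  - by do 2 apply: measurableT_comp => //; exact/measurable_EFinP.
  - exact: emeasurable_funD.
  - move=> x _ /=; rewrite lee_fin ler_norml.
    by have := sqr_ge0 (f x + g x); have := sqr_ge0 (f x - g x);
       have := sqr_ge0 (f x); have := sqr_ge0 (g x); move=> *; apply/andP; split; nra.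
by rewrite ge0_integralD//; try (by move=> x _; rewrite lee_fin sqr_ge0); rewrite lte_add_pinfty.
Qed.

Lemma L2_lin (a : R) f g : L2 f -> L2 g -> L2 (fun x => a * f x + g x).
Proof.
move=> Lf Lg; split.
  by apply: measurable_funD; [apply: measurable_funM => //; exact: Lf.1|exact: Lg.1].
have H : leb.-integrable Omega (fun x => (a ^+ 2)%:E * (f x * f x)%:E + ((a *+ 2)%:E * (f x * g x)%:E + (g x * g x)%:E))%E.
  have H1 : leb.-integrable Omega (fun x => (a ^+ 2)%:E * (f x * f x)%:E)%E.
    by apply: integrableZl => //; exact: L2_integrable.
  have H2 : leb.-integrable Omega (fun x => (a *+ 2)%:E * (f x * g x)%:E)%E.
    by apply: integrableZl => //; exact: L2_integrable.
  have H3 : leb.-integrable Omega (fun x => (g x * g x)%:E) by exact: L2_integrable.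
  exact: (integrableD mO H1 (integrableD mO H2 H3)).
have [mH] := integrableP _ _ _ H; apply: le_lt_trans.
rewrite le_eqVlt; apply/orP; left; apply/eqP; apply: eq_integral => x _.
rewrite -EFinM -!EFinD/= ger0_norm; first by congr EFin; rewrite !expr2; ring.
rewrite (_ : _ + _ = (a * f x + g x) ^+ 2) ?sqr_ge0//; rewrite !expr2; ring.
Qed.

Lemma L2_cst0 : L2 (fun=> 0).
Proof.
split; first exact: measurable_cst.
by under eq_integral do rewrite expr2 mulr0; rewrite integral0.
Qed.

Lemma L2_scale (a : R) f : L2 f -> L2 (fun x => a * f x).
Proof. by move=> Lf; have := L2_lin a Lf L2_cst0; under eq_fun do rewrite addr0. Qed.

Lemma L2D f g : L2 f -> L2 g -> L2 (fun x => f x + g x).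
Proof. by move=> Lf Lg; have := L2_lin 1 Lf Lg; under eq_fun do rewrite mul1r. Qed.

Lemma L2B f g : L2 f -> L2 g -> L2 (fun x => f x - g x).
Proof.
by move=> Lf Lg; have := L2_lin (-1) Lg Lf; under eq_fun do rewrite mulN1r addrC.
Qed.

Lemma L2_sum (J : Type) (r : seq J) (P : pred J) (F : J -> fct) :
  (forall i, L2 (F i)) -> L2 (fun x => \sum_(i <- r | P i) F i x).
Proof.
move=> sF; elim: r => [|i r IH].
  by under eq_fun do rewrite big_nil; exact: L2_cst0.
by under eq_fun do rewrite big_cons; case: (P i); [exact: (L2D (sF i) IH)|exact: IH].
Qed.

Lemma L2_bounded f : (leb Omega < +oo)%E -> measurable_fun Omega f ->
  (exists C : R, forall x, Omega x -> `|f x| <= C) -> L2 f.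
Proof.
move=> fO mf [C fC]; split => //.
have C0 x : Omega x -> 0 <= C by move=> Ox; apply: le_trans (fC x Ox).
apply: (@le_lt_trans _ _ (\int[leb]_(x in Omega) ((C ^+ 2)%:E))%E).
  apply: ge0_le_integral => //.
  - by move=> x _; rewrite lee_fin sqr_ge0.
  - exact/measurable_EFinP/measurable_funX.
  - move=> x Ox; rewrite lee_fin -real_normK ?num_real// lerXn2r ?nnegrE ?fC//.
    exact: C0 Ox.
by rewrite integral_cst//= lte_mul_pinfty// lee_fin sqr_ge0.
Qed.

Lemma int_mulC f g : I f g = I g f.
Proof. by rewrite /int_mul; under eq_Rintegral do rewrite mulrC. Qed.

Lemma int_mulDl (a : R) f g h : L2 f -> L2 g -> L2 h ->
  I (fun x => a * f x + g x) h = a * I f h + I g h.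
Proof.
move=> Lf Lg Lh; rewrite /int_mul.
under eq_Rintegral do rewrite mulrDl -mulrA.
rewrite RintegralD//; first (by rewrite RintegralZl//; exact: L2_integrable); last exact: L2_integrable.
have := L2_integrable (L2_scale a Lf) Lh; apply: eq_integrable => // x _ /=.
by rewrite mulrA.
Qed.

Lemma int_mulDr (a : R) f g h : L2 f -> L2 g -> L2 h ->
  I h (fun x => a * f x + g x) = a * I h f + I h g.
Proof. by move=> *; rewrite int_mulC int_mulDl// int_mulC [I g h]int_mulC. Qed.

Lemma int_mulBl f g h : L2 f -> L2 g -> L2 h -> I (fun x => f x - g x) h = I f h - I g h.
Proof.
move=> Lf Lg Lh; have := int_mulDl (-1) Lg Lf Lh; rewrite mulN1r addrC => <-.
by congr (I _ h); apply/funext => x; rewrite mulN1r addrC.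
Qed.

Lemma int_mul_suml (J : Type) (r : seq J) (P : pred J) (F : J -> fct) h :
  (forall i, L2 (F i)) -> L2 h ->
  I (fun x => \sum_(i <- r | P i) F i x) h = \sum_(i <- r | P i) I (F i) h.
Proof.
move=> LF Lh; elim: r => [|i r IH].
  rewrite big_nil /int_mul; under eq_Rintegral do rewrite big_nil mul0r.
  by rewrite Rintegral_cst// mul0r.
under [X in I X h]eq_fun do rewrite big_cons; rewrite big_cons; case: (P i) => //.
rewrite -IH -[I (F i) h]mul1r -int_mulDl//; last exact: L2_sum.
by congr (I _ h); apply/funext => x; rewrite mul1r.
Qed.

Lemma int_mul_ge0 f : 0 <= I f f.
Proof. by apply: Rintegral_ge0 => x _; rewrite -expr2 sqr_ge0. Qed.

Lemma L2norm_ge0 f : 0 <= N f. Proof. exact: sqrtr_ge0. Qed.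

Lemma L2norm_sqr f : N f ^+ 2 = I f f.
Proof. by rewrite sqr_sqrtr// int_mul_ge0. Qed.

Lemma int_mul_sqrD (a : R) f g : L2 f -> L2 g ->
  I (fun x => a * f x + g x) (fun x => a * f x + g x) =
  a ^+ 2 * I f f + 2 * a * I f g + I g g.
Proof.
move=> Lf Lg; have L := L2_lin a Lf Lg.
by rewrite int_mulDl// !int_mulDr// [I g f]int_mulC expr2; ring.
Qed.

Lemma int_mul_CauchySchwarz f g : L2 f -> L2 g -> `|I f g| <= N f * N g.
Proof.
move=> Lf Lg; rewrite -ler_sqr ?nnegrE ?mulr_ge0 ?L2norm_ge0// exprMn !L2norm_sqr real_normK ?num_real//.
have H a : 0 <= a ^+ 2 * I f f + 2 * a * I f g + I g g by rewrite -int_mul_sqrD// int_mul_ge0.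
have := int_mul_ge0 f; rewrite le_eqVlt => /predU1P[f0|f0].
  rewrite -f0 mul0r; suff -> : I f g = 0 by rewrite expr0n.
  (* When I f f = 0 the nonnegative polynomial is affine in [a]; at this value of [a] it would equal
     -1. *)
  apply/eqP; apply: contrapT => /negP fg0; have := H (- (I g g + 1) / (2 * I f g)).
  rewrite -f0 mulr0 add0r (_ : 2 * _ * _ = - (I g g + 1)); last by field.
  lra.
have := H (- I f g / I f f); rewrite (_ : _ + _ = I g g - I f g ^+ 2 / I f f); last first.
  by field; rewrite gt_eqF.
by rewrite subr_ge0 ler_pdivrMr// mulrC.
Qed.

Lemma L2norm_lin (a : R) f g : L2 f -> L2 g ->
  N (fun x => a * f x + g x) <= `|a| * N f + N g.
Proof.
move=> Lf Lg; rewrite -ler_sqr ?nnegrE ?addr_ge0 ?mulr_ge0 ?L2norm_ge0//.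
rewrite L2norm_sqr int_mul_sqrD// sqrrD exprMn real_normK ?num_real// !L2norm_sqr.
rewrite lerD2r lerD2l -[leRHS]mulr_natl -!mulrA ler_pM2l// (le_trans (ler_norm _))// normrM.
by rewrite ler_wpM2l// int_mul_CauchySchwarz.
Qed.

(** The substitute for equality almost everywhere: by Cauchy-Schwarz, functions at L2 distance 0
    have the same pairings. *)
Lemma L2norm0_int_mul f g h : L2 f -> L2 g -> L2 h ->
  I (fun x => f x - g x) (fun x => f x - g x) = 0 -> I f h = I g h.
Proof.
move=> Lf Lg Lh h0; apply/eqP; rewrite -subr_eq0 -int_mulBl// -normr_le0.
by rewrite (le_trans (int_mul_CauchySchwarz (L2B Lf Lg) Lh))// /N h0 sqrtr0 mul0r.
Qed.

Lemma int_mul_dominated (h : fct) (phi_ : nat -> fct) (phi : fct) (C : R) :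
  (leb Omega < +oo)%E -> L2 h ->
  (forall m, measurable_fun Omega (phi_ m)) -> measurable_fun Omega phi ->
  (forall m x, Omega x -> `|phi_ m x| <= C) ->
  (forall x, Omega x -> phi_ m x @[m --> \oo] --> phi x) ->
  I h (phi_ m) @[m --> \oo] --> I h phi.
Proof.
move=> fO Lh mphi_ mphi hC hcvg.
have L1 : L2 (fun=> 1) by apply: L2_bounded => //; exists 1 => x _; rewrite normr1.
have ih : leb.-integrable Omega (fun x => C%:E * `|(h x * 1)%:E|)%E.
  by apply: integrableZl => //; apply: integrable_abse; exact: L2_integrable.
have mh := Lh.1.
have [] := @dominated_convergence _ _ R leb Omega mO
  (fun m x => (h x * phi_ m x)%:E) (fun x => (h x * phi x)%:E) (fun x => C%:E * `|(h x * 1)%:E|)%E.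
- by move=> m; apply/measurable_EFinP; exact: measurable_funM.
- by apply/measurable_EFinP; exact: measurable_funM.
- apply: aeW => x Ox; apply: cvg_EFin; first by near=> m.
  by apply: cvgM; [exact: cvg_cst|exact: hcvg].
- exact: ih.
- by apply: aeW => x m Ox; rewrite mulr1 !abse_EFin -EFinM lee_fin normrM mulrC ler_wpM2r// hC.
move=> intl _ cv; rewrite /int_mul /Rintegral.
by apply: fine_cvg; rewrite fineK//; exact: integrable_fin_num.
Unshelve. all: by end_near. Qed.

End L2_space.

Lemma cvg_eq_cst (R : realType) (u : nat -> R) (c l : R) :
  (forall m, u m = c) -> u m @[m --> \oo] --> l -> l = c.
Proof.
move=> uc; rewrite (_ : u = fun=> c); last exact/funext.
move=> h; apply: (cvg_unique _ h); first exact: Rhausdorff.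
exact: cvg_cst.
Qed.

Lemma cvg_ext (R : realType) (u v : nat -> R) (l : R) : (forall m, u m = v m) ->
  v m @[m --> \oo] --> l -> u m @[m --> \oo] --> l.
Proof. by move=> uv; rewrite (_ : u = v)//; exact/funext. Qed.

Lemma cvg_lin0 (R : realType) (u v : nat -> R) (c d : R) : u @ \oo --> (0 : R) ->
  v @ \oo --> (0 : R) -> c * u m + d * v m @[m --> \oo] --> (0 : R).
Proof.
move=> hu hv; have -> : (0 : R) = c * 0 + d * 0 by rewrite !mulr0 addr0.
by apply: cvgD; apply: cvgM => //; exact: cvg_cst.
Qed.

Section orthants.
Variables (R : realType) (n : nat).
Local Notation leb := (lebesgue_rV R n).

Definition orthant (b : 'rV[R]_n) : set 'rV[R]_n := [set x | forall i, x ord0 i < b ord0 i].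

(** A half-space x_i < c is the countable union over m of the orthants with bound c in direction i
    and m in the others, so the orthants generate the Borel sets. *)
Lemma measurable_orthants (A : set 'rV[R]_n) : measurable A -> <<s range orthant >> A.
Proof.
move=> mA; pose T := g_sigma_algebraType (range orthant).
have mid : measurable_fun setT (fun x : T => x : 'rV[R]_n).
  apply: measurable_fun_rV => i; apply: (measurability _ (RGenInftyO.measurableE R)).
  move=> _ [_ [c ->] <-]; rewrite setTI.
  rewrite (_ : _ @^-1` _ = \bigcup_m orthant (\row_j if j == i then c else m%:R)).
    apply: bigcupT_measurable => m; apply: sub_sigma_algebra.
    by exists (\row_j if j == i then c else m%:R).
  apply/seteqP; split => [x /=|x [m _ /(_ i)]]; last by rewrite /= in_itv/= mxE eqxx.
  rewrite in_itv/= => xc; exists (Num.bound `|x : 'rV[R]_n|) => // j.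
  rewrite mxE; case: eqP => [->//|_].
  rewrite (le_lt_trans (ler_norm _))// (le_lt_trans (normr_rV_le x j))//.
  exact: archi_boundP.
by have := mid measurableT A mA; rewrite setTI.
Qed.

(* pi-lambda theorem for the pi-system of orthants. *)
Lemma orthants_ae0 (f : 'rV[R]_n -> R) : leb.-integrable setT (EFin \o f) ->
  \int[leb]_x f x = 0 -> (forall b, \int[leb]_(x in orthant b) f x = 0) ->
  ae_eq leb setT (EFin \o f) (cst 0%E).
Proof.
move=> fint f0 fb.
have Sint (A : set 'rV[R]_n) : measurable A -> leb.-integrable A (EFin \o f).
  by move=> mA; apply: integrableS fint.
pose H := [set A : set 'rV[R]_n | measurable A /\ \int[leb]_(x in A) f x = 0].
have dH : dynkin H.
  split.
  - by split.
  - move=> A [mA A0]; split; first exact: measurableC.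
    have := @Rintegral_setU _ _ _ leb A (~` A) f mA (measurableC mA).
    rewrite setUCr f0 A0 add0r => <-//.
    by apply/disj_setPS => x [].
  - move=> F tF HF; split; first by apply: bigcupT_measurable => k; exact: (HF k).1.
    rewrite /Rintegral integral_bigcup//.
    + rewrite eseries0// => k _ _; have [mk k0] := HF k.
      rewrite -[LHS]fineK; last exact: integrable_fin_num (Sint _ mk).
      by rewrite -[fine _]/(\int[leb]_(x in F k) f x) k0.
    + by move=> k; exact: (HF k).1.
    + by apply: Sint; apply: bigcupT_measurable => k; exact: (HF k).1.
have Hall A : measurable A -> H A.
  move=> /measurable_orthants; apply: lambda_system_subset => //.
  - move=> _ _ [b _ <-] [c _ <-]; exists (\row_i Num.min (b ord0 i) (c ord0 i)) => //.
    apply/seteqP; split => [x h|x [h1 h2] i]; last by rewrite mxE lt_min h1 h2.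
    by split => i; have := h i; rewrite mxE lt_min => /andP[].
  - exact/dynkin_lambda_system.
  - move=> _ [b _ <-]; split => //.
    have -> : orthant b = \big[setI/setT]_(i < n)
        (fun x : 'rV[R]_n => x ord0 i) @^-1` `]-oo, b ord0 i[.
      rewrite -bigcap_seq; apply/seteqP; split => [x Bx i _ /=|x Bx i].
        by rewrite in_itv/=; exact: Bx.
      by have := Bx i; rewrite /= in_itv/=; apply; rewrite mem_index_enum.
    apply: bigsetI_measurable => i _; rewrite -[X in measurable X]setTI.
    by apply: measurable_coord.
apply: integral_ae_eq => // E _ mE; rewrite integral0.
rewrite -[LHS]fineK; last exact: integrable_fin_num (Sint _ mE).
by rewrite -[fine _]/(\int[leb]_(x in E) f x) (Hall E mE).2.
Qed.

End orthants.

(** * The fundamental lemma of the calculus of variations, and integrals of derivatives of test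
    functions *)

Section fundamental_lemma.
Variables (R : realType) (n : nat) (Omega : set 'rV[R]_n).
Hypotheses (oO : open Omega) (bO : bounded_set Omega).
Local Notation leb := (lebesgue_rV R n).
Local Notation fct := ('rV[R]_n -> R).
Local Notation I := (int_mul Omega).
Local Notation L2 := (L2 Omega).

Let mO : measurable Omega. Proof. exact: open_measurable_rV. Qed.
Let fO : (leb Omega < +oo)%E. Proof. exact: bounded_fin_measure. Qed.

Lemma smooth_measurable (f : fct) (D : set 'rV[R]_n) : smooth f -> measurable_fun D f.
Proof.
move=> sf; apply: (@measurable_funS _ _ _ _ setT) => //.
by apply: continuous_measurable_rV; exact: smooth_continuous.
Qed.

Lemma test_functionM (phi f : fct) : test_function Omega phi -> smooth f ->
  test_function Omega (fun x => f x * phi x).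
Proof.
move=> [sphi [K [cK KO phi0]]] sf; split; first exact: smoothM.
by exists K; split => // x /phi0 ->; rewrite mulr0.
Qed.

Lemma cutoff_seq : exists2 C : R, 0 < C & exists chi : nat -> fct,
  [/\ forall m, test_function Omega (chi m), forall m x, `|chi m x| <= C &
   forall x, Omega x -> chi m x @[m --> \oo] --> (1 : R)].
Proof.
have [C C0 hC] := cutoff bO; exists C => //.
have d0 (m : nat) : 0 < m.+1%:R^-1 :> R by rewrite invr_gt0.
have /choice[chi hchi] := fun m : nat => hC _ (d0 m).
exists chi; split => [m|m x|x Ox]; [by have [] := hchi m|by have [] := hchi m|].
have : nbhs x Omega by exact: open_nbhs_nbhs.
rewrite -nbhs_ballE => -[e /= e0 eO].
apply: cvg_near_cst; near=> m; have [_ _ _ ->//] := hchi m => y yx.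
apply: eO; rewrite -ball_normE /ball_/= distrC (le_lt_trans yx)//.
rewrite mulrC -ltr_pdivlMr//; near: m.
by apply: (near_infty_natSinv_lt (PosNum _)); rewrite divr_gt0.
Unshelve. all: by end_near. Qed.

Lemma step_cvg (t : R) : step (m%:R * t) @[m --> \oo] --> (if 0 < t then 1 else 0 : R).
Proof.
case: ifP => t0.
  apply: cvg_near_cst; near=> m; apply: step_ge1; rewrite -ler_pdivrMr//.
  by near: m; exact: nbhs_infty_ger.
apply: cvg_near_cst; near=> m; apply: step_le0; rewrite mulr_ge0_le0//.
by rewrite leNgt t0.
Unshelve. all: by end_near. Qed.

Lemma cvg_prod (J : Type) (r : seq J) (F : J -> nat -> R) (l : J -> R) :
  (forall i, F i m @[m --> \oo] --> l i) ->
  \prod_(i <- r) F i m @[m --> \oo] --> \prod_(i <- r) l i.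
Proof.
move=> h; elim: r => [|i r IH].
  by under eq_cvg do rewrite big_nil; rewrite big_nil; exact: cvg_cst.
by under eq_cvg do rewrite big_cons; rewrite big_cons; apply: cvgM.
Qed.

(** Vanishing of the pairing is extended from test functions to smooth functions bounded on [Omega]
    by cutoffs, then to indicators of orthants by dominated convergence. The orthants force the zero
    extension of [h] to vanish almost everywhere. *)
Lemma int_test_eq0 (h : fct) : L2 h ->
  (forall phi, test_function Omega phi -> I h phi = 0) -> I h h = 0.
Proof.
move=> Lh h0; have mh := Lh.1.
have [C C0 [chi [tchi chiC chi1]]] := cutoff_seq.
have hsm phi : smooth phi -> (exists M, forall x, Omega x -> `|phi x| <= M) -> I h phi = 0.
  move=> sphi [M hM].
  have : I h (fun x => phi x * chi m x) @[m --> \oo] --> I h phi.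
    apply: (@int_mul_dominated _ _ _ mO h (fun m x => phi x * chi m x) phi (M * C)) => //.
    - by move=> m; apply: smooth_measurable; apply: smoothM => //; exact: (tchi m).1.
    - exact: smooth_measurable.
    - by move=> m x Ox; rewrite normrM ler_pM// hM.
    - move=> x Ox; rewrite -[X in _ --> X]mulr1; apply: cvgM; first exact: cvg_cst.
      exact: chi1.
  by apply: cvg_eq_cst => m; apply: h0; exact: test_functionM.
have L1 : L2 (fun=> 1) by apply: L2_bounded => //; exists 1 => x _; rewrite normr1.
have ih : leb.-integrable Omega (EFin \o h).
  by have := L2_integrable mO Lh L1; apply: eq_integrable => // x _ /=; rewrite mulr1.
pose f := h \_ Omega.
have fint : leb.-integrable setT (EFin \o f).
  by have := (integrable_mkcond (EFin \o h) mO).1 ih; rewrite restrict_EFin.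
have fE A : \int[leb]_(x in A) f x = I h (fun x => \1_A x).
  rewrite Rintegral_mkcond /f -patch_setI setIC patch_setI -Rintegral_mkcond.
  by apply: eq_Rintegral => x _; rewrite patchE indicE; case: ifP; rewrite ?mulr1 ?mulr0.
have fae : ae_eq leb setT (EFin \o f) (cst 0%E).
  apply: orthants_ae0 => //.
    rewrite fE -[RHS](hsm (fun=> 1))//; last 2 first.
    - exact: smooth_cst.
    - by exists 1 => x _; rewrite normr1.
    by apply: eq_Rintegral => x _; rewrite indicT.
  move=> b; rewrite fE.
  (* These products converge pointwise to the indicator of the open orthant, faces included, because
     [step] vanishes at 0. *)
  pose phi m (x : 'rV[R]_n) := \prod_i step (m%:R * (b ord0 i - x ord0 i)).
  have sphi m : smooth (phi m).
    apply: smooth_prod => i; apply: elementary_is_smooth; apply: step_elementary.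
    apply: elem_mul; first exact: elem_cst.
    by apply: elem_add; [exact: elem_cst|apply: elementaryN; exact: elem_coord].
  have phi1 m x : `|phi m x| <= 1.
    rewrite normr_prod; apply: prodr_ile1 => i _.
    by rewrite normr_ge0/= ger0_norm ?step_ge0// step_le1.
  have phicvg x : phi m x @[m --> \oo] --> (\1_(orthant b) x : R).
    have := @cvg_prod _ (index_enum 'I_n) (fun i m => step (m%:R * (b ord0 i - x ord0 i))) _
      (fun i => @step_cvg (b ord0 i - x ord0 i)).
    rewrite (_ : \prod_(i <- _) _ = \1_(orthant b) x)// indicE.
    have [bx|bx] := boolP (x \in orthant b); last first.
      have [i hi] : exists i, ~ (x ord0 i < b ord0 i).
        by apply/existsNP; move/negP: bx; rewrite inE.
      by rewrite (bigD1 i)//= subr_gt0 ifF ?mul0r//; exact/negP.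
    by rewrite big1// => i _; rewrite subr_gt0; move: bx; rewrite inE => ->.
  have : I h (phi m) @[m --> \oo] --> I h (\1_(orthant b)).
    apply: (@int_mul_dominated _ _ _ mO h phi _ 1) => //.
    - by move=> m; exact: smooth_measurable.
    - apply: (measurable_fun_cvg (h := phi)) => // m; exact: smooth_measurable.
  by apply: cvg_eq_cst => m; apply: hsm => //; exists 1.
rewrite /int_mul Rintegral_mkcond.
transitivity (\int[leb]_x (0 : R)); last by rewrite Rintegral_cst// mul0r.
congr fine; apply: ae_eq_integral => //.
- have := (integrable_mkcond _ mO).1 (L2_integrable mO Lh Lh).
  by rewrite restrict_EFin => /measurable_int.
- apply: filterS fae => x /(_ Logic.I) /= [fx] _.
  by rewrite patchE; case: ifP => // xO; move: fx; rewrite /f patchE xO => ->; rewrite mul0r.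
Qed.

Lemma smooth_bounded_cube (f : fct) (M : R) : smooth f ->
  exists2 C : R, 0 <= C & forall x, `|x| <= M -> `|f x| <= C.
Proof.
move=> sf; pose K := cube (\row_(i < n) (- M)) (M + M).
have KM x : `|x| <= M -> K x.
  move=> xM i; rewrite mxE addrA addNr add0r -ler_norml.
  exact: le_trans (normr_rV_le x i) xM.
have cK : compact (f @` K).
  apply: continuous_compact; last exact: compact_cube.
  exact/continuous_subspaceT/smooth_continuous.
have [C [_ hC]] := compact_bounded cK.
exists (`|C| + 1); first by rewrite addr_ge0.
move=> x xM; apply: (hC (`|C| + 1)); first by rewrite (le_lt_trans (ler_norm _))// ltrDl.
by exists x => //; exact: KM.
Qed.

Lemma bounded_norm : exists2 M : R, 0 <= M & forall x, Omega x -> `|x| <= M.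
Proof.
have [M0 [_ hM0]] := bO; exists (`|M0| + 1); first by rewrite addr_ge0.
by move=> x; apply: hM0; rewrite (le_lt_trans (ler_norm _))// ltrDl.
Qed.

Lemma smooth_bounded (f : fct) : smooth f -> exists C : R, forall x, Omega x -> `|f x| <= C.
Proof.
move=> sf; have [M _ hM] := bounded_norm; have [C _ hC] := smooth_bounded_cube M sf.
by exists C => x /hM; exact: hC.
Qed.

Lemma smooth_L2 (f : fct) : smooth f -> L2 f.
Proof. by move=> sf; apply: L2_bounded => //; [exact: smooth_measurable|exact: smooth_bounded]. Qed.

Lemma pderiv_near0 i (phi : fct) x : (\forall y \near x, phi y = 0) -> pderiv i phi x = 0.
Proof.
move=> phi0.
have D0 : is_derive x (unit_vec R i) (cst (0 : R)) 0 by exact: is_derive_cst.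
apply: (@derive_val _ _ _ _ _ _ _ (near_eq_is_derive _ D0)).
by apply: filterS phi0 => y.
Qed.

Lemma pderiv_out i (phi : fct) (K : set 'rV[R]_n) x : compact K ->
  (forall x, ~ K x -> phi x = 0) -> ~ K x -> pderiv i phi x = 0.
Proof.
move=> cK phi0 Kx; apply: pderiv_near0.
have oK : open (~` K) by apply: closed_openC; exact: compact_closed.
have nx : nbhs x (~` K) by exact: open_nbhs_nbhs.
exact: filterS nx.
Qed.

Lemma test_function_pderiv i (phi : fct) : test_function Omega phi -> test_function Omega (pderiv i phi).
Proof.
move=> [sphi [K [cK KO phi0]]]; split; first exact: smooth_pderiv.
by exists K; split => // x; exact: pderiv_out.
Qed.

Let big_cube (M : R) : set 'rV[R]_n := cube (\row_(i < n) (- M)) (M + M).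

Let big_cubeP M x : `|x| <= M -> big_cube M x.
Proof.
move=> xM i; rewrite mxE addrA addNr add0r -ler_norml.
exact: le_trans (normr_rV_le x i) xM.
Qed.

Let integrable_big_cube (C M : R) : 0 <= M ->
  leb.-integrable setT (EFin \o (fun x => C * \1_(big_cube M) x)).
Proof.
move=> M0; apply: (integrableZl measurableT C (f := EFin \o \1_(big_cube M))).
have mc : measurable (big_cube M) by exact: measurable_cube.
apply/integrableP; split; first by apply/measurable_EFinP; exact: measurable_indic.
rewrite (eq_integral (fun x => (\1_(big_cube M) x)%:E)); last first.
  by move=> x _ /=; rewrite indicE normr_nat.
rewrite integral_indic// setIT; apply: (le_lt_trans _ (ltry ((M + M) ^+ n))).
by rewrite -(lebesgue_rV_cube (\row_(i < n) (- M)) (addr_ge0 M0 M0)).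
Qed.

Let integrable_supp (f : fct) (C M : R) : 0 <= M -> measurable_fun setT f ->
  (forall x, `|x| <= M -> `|f x| <= C) -> (forall x, M < `|x| -> f x = 0) ->
  leb.-integrable setT (EFin \o f).
Proof.
move=> M0 mf fC f0; apply: (le_integrable _ _ _ (integrable_big_cube C M0)) => //.
  exact/measurable_EFinP.
move=> x _ /=; rewrite lee_fin; have [xM|xM] := leP `|x| M.
  rewrite indicE mem_set; last exact: big_cubeP.
  by rewrite mulr1 (le_trans (fC _ xM))// ler_norm.
by rewrite f0// normr0.
Qed.

(* The difference quotients of phi have zero integral by translation invariance. *)
Lemma int_pderiv_test i (phi : fct) : test_function Omega phi ->
  \int[leb]_(x in Omega) pderiv i phi x = 0.
Proof.
move=> tphi; have [sphi [K [cK KO phi0]]] := tphi.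
have dphi0 x : ~ K x -> pderiv i phi x = 0 by exact: pderiv_out.
have [M M0 OM] := bounded_norm.
have out x : M < `|x| -> ~ K x by rewrite ltNge => /negP xM /KO /OM.
have sdphi := smooth_pderiv i sphi.
have M1 : 0 <= M + 1 by rewrite addr_ge0.
have [C C0 hC] := smooth_bounded_cube (M + 1 + 1) sdphi.
have [C' _ hC'] := smooth_bounded_cube (M + 1) sphi.
have mphi : measurable_fun setT phi by exact: smooth_measurable.
pose v (m : nat) : 'rV[R]_n := m.+1%:R^-1 *: unit_vec R i.
have e1 : `|unit_vec R i| <= 1.
  apply: normr_rV_bound => // j; rewrite unit_vecE; case: (_ == _); rewrite ?normr1 ?normr0//.
have v1 m : `|v m| <= 1.
  rewrite normrZ mulr_ile1// ger0_norm ?invr_ge0// invf_le1 ?ltr0n//.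
  by rewrite ler1n.
pose q m (x : 'rV[R]_n) := m.+1%:R * (phi (x + v m) - phi x).
have mphiv m : measurable_fun setT (fun x : 'rV[R]_n => phi (x + v m)).
  exact: (measurableT_comp mphi (measurable_addr_rV (v m))).
have iphi : leb.-integrable setT (EFin \o phi).
  apply: (integrable_supp (C := C') M1) => // x xM; apply: phi0; apply: out.
  by rewrite (lt_trans _ xM)// ltrDl.
have iphiv m : leb.-integrable setT (EFin \o (fun x : 'rV[R]_n => phi (x + v m))).
  have [C'' _ hC''] := smooth_bounded_cube (M + 1 + 1) sphi.
  apply: (integrable_supp (C := C'') M1) => // x xM.
    by apply: hC''; rewrite (le_trans (ler_normD _ _))// lerD.
  apply: phi0; apply: out; have := ler_normB (x + v m) (v m).
  rewrite addrK => h; have := v1 m; lra.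
have mq m : measurable_fun setT (q m).
  by apply: measurable_funM => //; exact: measurable_funB.
have qcvg x : q m x @[m --> \oo] --> pderiv i phi x.
  have [h1 h2] := smooth_is_derive i x sphi.
  have hu : (forall m : nat, m.+1%:R^-1 != 0 :> R) /\ (m.+1%:R^-1 @[m --> \oo] --> (0 : R)).
    by split => [m|]; [rewrite invr_neq0|exact: cvg_harmonic].
  have := (cvgr_dnbhsP _ _ _).1 h1 _ hu.
  rewrite -[X in _ --> X]/('D_(unit_vec R i) phi x) h2.
  apply: cvg_trans; apply: near_eq_cvg; near=> m.
  by rewrite /q /v /= invrK [x + _]addrC.
(* The mean value theorem dominates the difference quotients by the bound on the derivative. The
   cube has half-side M + 1 because the shift has length at most 1. *)
have qC m x : `|q m x| <= C * \1_(big_cube (M + 1)) x.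
  have [xM|xM] := leP `|x| (M + 1).
    rewrite indicE mem_set ?mulr1; last exact: big_cubeP.
    have [c /andP[c0 c1]] := @line_MVT _ _ phi (v m) x (fun x => m.+1%:R^-1 * pderiv i phi x)
      (fun x => is_derive_dirZ m.+1%:R^-1 (smooth_is_derive i x sphi)).
    rewrite /q [x + v m]addrC => ->; rewrite mulrA mulfV// mul1r; apply: hC.
    rewrite (le_trans (ler_normD _ _))// addrC lerD// normrZ mulr_ile1//.
    by rewrite ger0_norm.
  rewrite /q !phi0 ?subrr ?mulr0 ?normr0.
  - by rewrite mulr_ge0// indicE.
  - by apply: out; rewrite (lt_trans _ xM)// ltrDl.
  - apply: out; have := ler_normB (x + v m) (v m).
    rewrite addrK => h; have := v1 m; lra.
have q0 m : (\int[leb]_x (q m x)%:E = 0)%E.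
  rewrite -[LHS]fineK; last first.
    apply: integrable_fin_num => //; apply: (le_integrable _ _ _ (integrable_big_cube C M1)) => //.
      exact/measurable_EFinP.
    by move=> x _; rewrite lee_fin (le_trans (qC m x))// ler_norm.
  rewrite -[fine _]/(\int[leb]_x (q m x)).
  rewrite /q RintegralZl//; last first.
    by have := integrableB measurableT (iphiv m) iphi.
  rewrite RintegralB// /Rintegral.
  by rewrite (integral_translate (v m) (f := EFin \o phi)) ?subrr ?mulr0//; exact/measurable_EFinP.
transitivity (\int[leb]_x pderiv i phi x).
  rewrite Rintegral_mkcond; apply: eq_Rintegral => x _; rewrite patchE; case: ifP => // xO.
  by rewrite dphi0// => /KO; move/negP: xO; rewrite inE.
have [] := @dominated_convergence _ _ R leb setT measurableT
  (fun m x => (q m x)%:E) (fun x => (pderiv i phi x)%:E) (fun x => (C * \1_(big_cube (M + 1)) x)%:E).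
- by move=> m; exact/measurable_EFinP.
- by apply/measurable_EFinP; exact: smooth_measurable.
- by apply: aeW => x _; apply: cvg_EFin; [near=> m|exact: qcvg].
- exact: integrable_big_cube.
- by apply: aeW => x m _; rewrite lee_fin.
move=> _ _ cv; rewrite /Rintegral.
have -> : (\int[leb]_x (pderiv i phi x)%:E = 0)%E; last by [].
move: cv; rewrite (_ : (fun _ => _) = fun=> 0%E); last exact/funext.
by move=> cv; apply: (cvg_unique _ cv) => //; exact: cvg_cst.
Unshelve. all: by end_near. Qed.

End fundamental_lemma.

(** * Sobolev spaces *)

Section H1_space.
Variables (R : realType) (n : nat) (Omega : set 'rV[R]_n).
Hypotheses (oO : open Omega) (bO : bounded_set Omega).
Local Notation leb := (lebesgue_rV R n).
Local Notation fct := ('rV[R]_n -> R).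
Local Notation field := ('I_n -> 'rV[R]_n -> R).
Local Notation I := (int_mul Omega).
Local Notation L2 := (L2 Omega).
Local Notation N := (L2norm Omega).
Local Notation H1 := (H1 Omega).
Local Notation D := (weak_pderiv Omega).
Local Notation test := (test_function Omega).

Let mO : measurable Omega. Proof. exact: open_measurable_rV. Qed.

Lemma test_L2 (phi : fct) : test phi -> L2 phi.
Proof. by move=> [sphi _]; exact: smooth_L2. Qed.

Lemma weak_pderivP i (u : fct) : H1 u -> is_weak_pderiv Omega i u (D i u).
Proof. by move=> [_ /(_ i)[g hg]]; exact: (xgetPex (cst 0) (ex_intro _ g hg)). Qed.

Local Opaque weak_pderiv.

Lemma H1_L2 (u : fct) : H1 u -> L2 u. Proof. by case. Qed.

Lemma weak_pderiv_L2 i (u : fct) : H1 u -> L2 (D i u).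
Proof. by move=> /(weak_pderivP i)[]. Qed.

Lemma is_weak_pderiv_int i (u g phi : fct) : is_weak_pderiv Omega i u g -> test phi ->
  I u (pderiv i phi) = - I g phi.
Proof. by move=> [_ h] tphi; exact: h. Qed.

(** The fundamental lemma applied to g1 - g2 puts them at L2 distance 0. Equality of pairings is the
    form in which uniqueness almost everywhere is used. *)
Lemma is_weak_pderiv_unique i (u g1 g2 w : fct) : is_weak_pderiv Omega i u g1 ->
  is_weak_pderiv Omega i u g2 -> L2 w -> I g1 w = I g2 w.
Proof.
move=> h1 h2 Lw; have [L1 _] := h1; have [L2' _] := h2.
apply: L2norm0_int_mul => //; apply: int_test_eq0 => //; first exact: L2B.
move=> phi tphi; rewrite int_mulBl//; last exact: test_L2.
apply/eqP; rewrite subr_eq0 -eqr_opp.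
by rewrite -(is_weak_pderiv_int h1 tphi) -(is_weak_pderiv_int h2 tphi).
Qed.

Lemma is_weak_pderiv_lin i (a : R) (u v g h : fct) : L2 u -> L2 v ->
  is_weak_pderiv Omega i u g -> is_weak_pderiv Omega i v h ->
  is_weak_pderiv Omega i (fun x => a * u x + v x) (fun x => a * g x + h x).
Proof.
move=> Lu Lv hg hh; have [Lg _] := hg; have [Lh _] := hh; split; first exact: L2_lin.
move=> phi tphi; have tdphi := test_function_pderiv i tphi.
rewrite -[LHS]/(I _ (pderiv i phi)) -[X in - X]/(I _ phi).
rewrite !int_mulDl//; [|exact: test_L2|exact: test_L2].
by rewrite (is_weak_pderiv_int hg tphi) (is_weak_pderiv_int hh tphi) mulrN opprD.
Qed.

Lemma H1_lin (a : R) (u v : fct) : H1 u -> H1 v -> H1 (fun x => a * u x + v x).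
Proof.
move=> Hu Hv; split; first by apply: L2_lin => //; exact: H1_L2.
move=> i; exists (fun x => a * D i u x + D i v x).
by apply: is_weak_pderiv_lin; (try exact: H1_L2); exact: weak_pderivP.
Qed.

(** The combination of the chosen derivatives is one weak derivative of a u + v, though perhaps not
    the chosen one; linearity is recovered after pairing. *)
Lemma int_weak_lin i (a : R) (u v w : fct) : H1 u -> H1 v -> L2 w ->
  I (D i (fun x => a * u x + v x)) w = a * I (D i u) w + I (D i v) w.
Proof.
move=> Hu Hv Lw; have Lu := weak_pderiv_L2 i Hu; have Lv := weak_pderiv_L2 i Hv.
rewrite -int_mulDl//; apply: (is_weak_pderiv_unique (weak_pderivP i (H1_lin a Hu Hv))) => //.
by apply: is_weak_pderiv_lin; (try exact: H1_L2); exact: weak_pderivP.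
Qed.

Lemma H1B (u v : fct) : H1 u -> H1 v -> H1 (fun x => u x - v x).
Proof. by move=> Hu Hv; have := H1_lin (-1) Hv Hu; under eq_fun do rewrite mulN1r addrC. Qed.

Lemma H1_cst0 : H1 (fun=> 0).
Proof.
split; first exact: L2_cst0.
move=> i; exists (fun=> 0); split; first exact: L2_cst0.
move=> phi _; rewrite -[LHS]/(I _ (pderiv i phi)) -[X in - X]/(I _ phi) /int_mul.
by under eq_Rintegral do rewrite mul0r; under [in RHS]eq_Rintegral do rewrite mul0r;
  rewrite Rintegral_cst// mul0r oppr0.
Qed.

Lemma int_weakB i (u v w : fct) : H1 u -> H1 v -> L2 w ->
  I (D i (fun x => u x - v x)) w = I (D i u) w - I (D i v) w.
Proof.
move=> Hu Hv Lw; have := int_weak_lin i (-1) Hv Hu Lw; rewrite mulN1r addrC => <-.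
by congr (I (D i _) w); apply/funext => x; rewrite mulN1r addrC.
Qed.

Lemma smooth_is_weak_pderiv i (f : fct) : smooth f -> is_weak_pderiv Omega i f (pderiv i f).
Proof.
move=> sf; have sdf := smooth_pderiv i sf; split; first exact: smooth_L2.
move=> phi tphi; have := int_pderiv_test bO i (test_functionM tphi sf).
have [sphi _] := tphi; have sdphi := smooth_pderiv i sphi.
rewrite pderivM//= RintegralD//.
- by move/eqP; rewrite addr_eq0 => /eqP ->; rewrite opprK.
- by apply: L2_integrable => //; exact: smooth_L2.
- by apply: L2_integrable => //; exact: smooth_L2.
Qed.

Lemma smooth_H1 (f : fct) : smooth f -> H1 f.
Proof.
move=> sf; split; first exact: smooth_L2.
by move=> i; exists (pderiv i f); exact: smooth_is_weak_pderiv.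
Qed.

Lemma int_weak_smooth i (f w : fct) : smooth f -> L2 w -> I (D i f) w = I (pderiv i f) w.
Proof.
move=> sf; apply: is_weak_pderiv_unique; first exact: weak_pderivP (smooth_H1 sf).
exact: smooth_is_weak_pderiv.
Qed.

Lemma L2norm_weak_smooth i (f : fct) : smooth f -> N (D i f) = N (pderiv i f).
Proof.
move=> sf; have Ldf : L2 (pderiv i f) by apply: smooth_L2 => //; exact: smooth_pderiv.
rewrite /L2norm int_weak_smooth//; last exact/weak_pderiv_L2/smooth_H1.
by rewrite int_mulC int_weak_smooth.
Qed.

Lemma Rintegral_sum_mul (J : Type) (r : seq J) (f g : J -> fct) :
  (forall i, L2 (f i)) -> (forall i, L2 (g i)) ->
  \int[leb]_(x in Omega) (\sum_(i <- r) f i x * g i x) = \sum_(i <- r) I (f i) (g i).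
Proof.
move=> Lf Lg; rewrite /int_mul; elim: r => [|i r IH].
  by under eq_Rintegral do rewrite big_nil; rewrite Rintegral_cst// mul0r big_nil.
under eq_Rintegral do rewrite big_cons; rewrite big_cons -IH RintegralD//; first exact: L2_integrable.
have : leb.-integrable Omega (fun x => \sum_(i <- r) (f i x * g i x)%:E)%E.
  by apply: integrable_sum => // j _; exact: L2_integrable.
by apply: eq_integrable => // x _; rewrite /= sumEFin.
Qed.

Lemma int_dotE (f g : field) : L2v Omega f -> L2v Omega g ->
  int_dot Omega f g = \sum_i I (f i) (g i).
Proof. exact: Rintegral_sum_mul. Qed.

Lemma int_mul_cst0r h : I h (fun=> 0) = 0.
Proof. by rewrite /int_mul; under eq_Rintegral do rewrite mulr0; rewrite Rintegral_cst// mul0r. Qed.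

Definition H1sqr (u : fct) : R := I u u + \sum_i I (D i u) (D i u).

Lemma H1sqr_ge0 u : 0 <= H1sqr u.
Proof. by rewrite addr_ge0 ?int_mul_ge0// sumr_ge0// => i _; exact: int_mul_ge0. Qed.

Lemma H1normE u : H1 u -> H1norm Omega u = Num.sqrt (H1sqr u).
Proof. by move=> Hu; rewrite /H1norm int_dotE// => i; exact: weak_pderiv_L2. Qed.

Lemma L2norm_le_H1norm u : H1 u -> N u <= H1norm Omega u.
Proof.
move=> Hu; rewrite H1normE// ler_wsqrtr// lerDl sumr_ge0// => i _; exact: int_mul_ge0.
Qed.

Lemma L2norm_weak_le_H1norm i u : H1 u -> N (D i u) <= H1norm Omega u.
Proof.
move=> Hu; rewrite H1normE// ler_wsqrtr// /H1sqr (bigD1 i)//= addrCA lerDl.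
by rewrite addr_ge0 ?int_mul_ge0// sumr_ge0// => j _; exact: int_mul_ge0.
Qed.

(** Expand the nonnegative integral of (a f - g)^2. *)
Lemma int_mul_sqrD_le (a : R) f g : L2 f -> L2 g ->
  I (fun x => a * f x + g x) (fun x => a * f x + g x) <= 2 * a ^+ 2 * I f f + 2 * I g g.
Proof.
move=> Lf Lg; have := int_mul_ge0 Omega (fun x => a * f x + (- 1) * g x).
have LN := L2_scale mO (-1) Lg.
rewrite !int_mul_sqrD//; have := int_mulDr mO (-1) Lg (L2_cst0 Omega) Lf.
have := int_mul_sqrD mO (-1) Lg (L2_cst0 Omega).
under [in X in X -> _]eq_fun do rewrite addr0.
have Z := int_mul_cst0r.
under [in X in _ -> X -> _]eq_fun do rewrite addr0.
rewrite !Z sqrrN expr1n => -> ->; lra.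
Qed.

(** Stands in for the triangle inequality without square roots; the factor 2 is harmless for
    convergence to 0. *)
Lemma H1sqr_lin (a : R) u v : H1 u -> H1 v ->
  H1sqr (fun x => a * u x + v x) <= 2 * a ^+ 2 * H1sqr u + 2 * H1sqr v.
Proof.
move=> Hu Hv; have Hw := H1_lin a Hu Hv.
have -> : H1sqr (fun x => a * u x + v x) = I (fun x => a * u x + v x) (fun x => a * u x + v x) +
    \sum_i I (fun x => a * D i u x + D i v x) (fun x => a * D i u x + D i v x).
  congr (_ + _); apply: eq_bigr => i _.
  have Lu := weak_pderiv_L2 i Hu; have Lv := weak_pderiv_L2 i Hv.
  have Lw := weak_pderiv_L2 i Hw.
  rewrite (int_weak_lin i a Hu Hv Lw) (int_mulC _ (D i u)) (int_weak_lin i a Hu Hv Lu).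
  rewrite (int_mulC _ (D i v) (D i (fun x => a * u x + v x))) (int_weak_lin i a Hu Hv Lv).
  rewrite (int_mul_sqrD mO a Lu Lv) (int_mulC _ (D i v) (D i u)).
  move: (I _ _) (I _ _) (I _ _) => x y z; ring.
rewrite /H1sqr !mulrDr addrACA lerD//; first by apply: int_mul_sqrD_le; exact: H1_L2.
rewrite !mulr_sumr -big_split/=; apply: ler_sum => i _.
by apply: int_mul_sqrD_le; exact: weak_pderiv_L2.
Qed.

Lemma H1norm_cvg0 (w : nat -> fct) (u : fct) : (forall j, H1 (w j)) -> H1 u ->
  H1_cvg Omega w u <-> H1sqr (fun x => w j x - u x) @[j --> \oo] --> (0 : R).
Proof.
move=> Hw Hu; have Hd j : H1 (fun x => w j x - u x) by exact: H1B.
split => h.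
  rewrite (_ : (fun j => _) = (fun j => H1norm Omega (fun x => w j x - u x) *
      H1norm Omega (fun x => w j x - u x))); last first.
    by apply/funext => j; rewrite H1normE// -expr2 sqr_sqrtr// H1sqr_ge0.
  by rewrite -[X in _ --> X](mulr0 (0 : R)); exact: cvgM.
rewrite /H1_cvg -[X in _ --> X](@sqrtr0 R).
apply: (cvg_ext _ (continuous_cvg _ (@sqrt_continuous R 0) h)) => j.
by rewrite H1normE.
Qed.

Lemma cvg_int_mul (w : nat -> fct) (u f : fct) : (forall j, H1 (w j)) -> H1 u -> L2 f ->
  H1_cvg Omega w u -> I (w j) f @[j --> \oo] --> I u f.
Proof.
move=> Hw Hu Lf h; apply/cvgrPdist_le => e e0.
have h2 : H1norm Omega (fun x => w j x - u x) * N f @[j --> \oo] --> 0 * N f.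
  by apply: cvgM; [exact: h|exact: cvg_cst].
move: h2; rewrite mul0r => /cvgrPdist_le /(_ e e0); apply: filterS => j.
rewrite sub0r normrN ger0_norm ?mulr_ge0 ?sqrtr_ge0// => hj; apply: le_trans hj.
rewrite distrC -int_mulBl//; try exact: H1_L2.
rewrite (le_trans (int_mul_CauchySchwarz mO _ Lf))//; first by apply: L2B => //; exact: H1_L2.
by rewrite ler_wpM2r ?L2norm_ge0//; apply: L2norm_le_H1norm; exact: H1B.
Qed.

Lemma cvg_int_weak i (w : nat -> fct) (u f : fct) : (forall j, H1 (w j)) -> H1 u -> L2 f ->
  H1_cvg Omega w u -> I (D i (w j)) f @[j --> \oo] --> I (D i u) f.
Proof.
move=> Hw Hu Lf h; apply/cvgrPdist_le => e e0.
have h2 : H1norm Omega (fun x => w j x - u x) * N f @[j --> \oo] --> 0 * N f.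
  by apply: cvgM; [exact: h|exact: cvg_cst].
move: h2; rewrite mul0r => /cvgrPdist_le /(_ e e0); apply: filterS => j.
rewrite sub0r normrN ger0_norm ?mulr_ge0 ?sqrtr_ge0// => hj; apply: le_trans hj.
have Hd : H1 (fun x => w j x - u x) by exact: H1B.
rewrite distrC -int_weakB// (le_trans (int_mul_CauchySchwarz mO (weak_pderiv_L2 i Hd) Lf))//.
by rewrite ler_wpM2r ?L2norm_ge0//; exact: L2norm_weak_le_H1norm.
Qed.

Lemma H10_H1 u : H10 Omega u -> H1 u. Proof. by case. Qed.

Lemma H10_lin (a : R) u v : H10 Omega u -> H10 Omega v -> H10 Omega (fun x => a * u x + v x).
Proof.
move=> [Hu [wu [twu cu]]] [Hv [wv [twv cv]]]; split; first exact: H1_lin.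
have Hwu j : H1 (wu j) by apply: smooth_H1; exact: (twu j).1.
have Hwv j : H1 (wv j) by apply: smooth_H1; exact: (twv j).1.
exists (fun j x => a * wu j x + wv j x); split.
  move=> j; have [su [K [cK KO K0]]] := twu j; have [sv [K' [cK' KO' K0']]] := twv j.
  split; first exact: (@smoothD _ _ (fun x => a * wu j x) (wv j) (@smoothM _ _ (fun=> a) (wu j) (smooth_cst a) su) sv).
  exists (K `|` K'); split => [||x /not_orP[xK xK']]; last by rewrite K0// K0'// mulr0 addr0.
    exact: compactU.
  by move=> x [/KO|/KO'].
have {}cu := (H1norm_cvg0 Hwu Hu).1 cu; have {}cv := (H1norm_cvg0 Hwv Hv).1 cv.
apply/(H1norm_cvg0 _ (H1_lin a Hu Hv)) => [j|]; first exact: H1_lin.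
have : 2 * a ^+ 2 * H1sqr (fun x => wu j x - u x) + 2 * H1sqr (fun x => wv j x - v x)
    @[j --> \oo] --> (0 : R) by exact: cvg_lin0.
apply: squeeze_cvgr; last exact: cvg_cst.
near=> j; rewrite H1sqr_ge0/=.
rewrite (_ : (fun x => _ - _) = (fun x => a * (wu j x - u x) + (wv j x - v x))); last first.
  by apply/funext => x; rewrite mulrBr opprD addrACA.
by apply: H1sqr_lin; exact: H1B.
Unshelve. all: by end_near. Qed.

(** For test functions this is the definition of the weak derivative of [r]. Both sides are
    continuous in [w] for the H1 norm, so the identity passes to the limit. *)
Lemma int_weak_H10 i (r w : fct) : H1 r -> H10 Omega w -> I (D i r) w = - I r (D i w).
Proof.
move=> Hr [Hw [phi [tphi cphi]]].
have Hphi j : H1 (phi j) by apply: smooth_H1; exact: (tphi j).1.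
have Lr := H1_L2 Hr; have LDr := weak_pderiv_L2 i Hr.
have c1 := cvg_int_mul Hphi Hw LDr cphi.
have c2 := cvg_int_weak (i := i) Hphi Hw Lr cphi.
rewrite int_mulC [I r _]int_mulC.
apply: (cvg_unique _ c1); first exact: Rhausdorff.
apply: (cvg_ext _ (cvgN c2)) => j.
have [sphi _] := tphi j.
rewrite (int_weak_smooth i sphi Lr) (int_mulC _ (pderiv i (phi j))) (is_weak_pderiv_int (weak_pderivP i Hr) (tphi j)).
by rewrite opprK int_mulC.
Qed.

(* For test functions, integrate d_i (x_i phi^2) = phi^2 + 2 x_i phi d_i phi. *)
Lemma poincare_test i (phi : fct) (M : R) : (forall x, Omega x -> `|x| <= M) -> 0 <= M ->
  test phi -> N phi <= 2 * M * N (pderiv i phi).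
Proof.
move=> OM M0 tphi; have [sphi _] := tphi; have sd := smooth_pderiv i sphi.
have sx : smooth (fun x : 'rV[R]_n => x ord0 i) by exact: smooth_coord.
have sxphi : smooth (fun x : 'rV[R]_n => x ord0 i * phi x) by exact: smoothM.
have := is_weak_pderiv_int (smooth_is_weak_pderiv i sphi) (test_functionM tphi sx).
rewrite pderivM//= pderiv_coord eqxx => h.
have Lphi := smooth_L2 oO bO sphi; have Ld := smooth_L2 oO bO sd.
have Lxphi := smooth_L2 oO bO sxphi.
have Lxd : L2 (fun x : 'rV[R]_n => x ord0 i * pderiv i phi x).
  exact: (smooth_L2 oO bO (smoothM sx sd)).
have e : I phi phi = - 2 * I (fun x : 'rV[R]_n => x ord0 i * phi x) (pderiv i phi).
  have -> : I (fun x : 'rV[R]_n => x ord0 i * phi x) (pderiv i phi) = I phi (fun x => x ord0 i * pderiv i phi x).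
    by apply: eq_Rintegral => x _; ring.
  have := int_mulDr mO 1 Lphi Lxd Lphi; rewrite h.
  rewrite [I (pderiv i phi) _]int_mulC mul1r.
  have -> : I (fun x : 'rV[R]_n => x ord0 i * phi x) (pderiv i phi) = I phi (fun x => x ord0 i * pderiv i phi x).
    by apply: eq_Rintegral => x _; ring.
  lra.
have [->|N0] := eqVneq (N phi) 0; first by rewrite !mulr_ge0// L2norm_ge0.
have Npos : 0 < N phi by rewrite lt_neqAle eq_sym N0 L2norm_ge0.
rewrite -(ler_pM2l Npos) -expr2 L2norm_sqr e.
rewrite (le_trans (ler_norm _))// normrM normrN (ger0_norm (_ : 0 <= 2))//.
rewrite (_ : N phi * _ = 2 * ((M * N phi) * N (pderiv i phi))); last by ring.
rewrite ler_pM2l// (le_trans (int_mul_CauchySchwarz mO Lxphi Ld))// ler_wpM2r ?L2norm_ge0//.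
rewrite -ler_sqr ?nnegrE ?mulr_ge0 ?L2norm_ge0// exprMn !L2norm_sqr /int_mul.
rewrite -RintegralZl//; last exact: L2_integrable.
apply: le_Rintegral => //.
- exact: L2_integrable.
- by have := L2_integrable mO (L2_scale mO (M ^+ 2) Lphi) Lphi; apply: eq_integrable => // x _ /=; rewrite mulrA.
- move=> x Ox; rewrite mulrACA -!expr2 ler_wpM2r ?sqr_ge0//.
  rewrite -real_normK ?num_real// lerXn2r ?nnegrE//.
  by rewrite (le_trans (normr_rV_le _ _))// OM.
Qed.

(** Combines the Poincare inequality for an approximating test function ([p], [dp]) with its H1
    distance [h] to the limit, which tends to 0. *)
Let ler_chain (M a p da dp du h : R) : 0 <= M -> a <= h -> da <= h ->
  p <= 2 * M * dp -> dp <= da + du -> a + p <= 2 * M * du + (2 * M + 1) * h.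
Proof. move=> *; nra. Qed.

Lemma poincare_H10 : exists2 C : R, 0 <= C & forall i u, H10 Omega u -> N u <= C * N (D i u).
Proof.
have [M M0 OM] := bounded_norm bO; exists (2 * M) => [|i u]; first by rewrite mulr_ge0.
move=> [Hu [phi [tphi cphi]]].
have Hphi j : H1 (phi j) by apply: smooth_H1; exact: (tphi j).1.
have : N u <= 2 * M * N (D i u) + (2 * M + 1) * 0.
  apply: (ler_cvg_to (f := fun=> N u)
    (g := fun j => 2 * M * N (D i u) + (2 * M + 1) * H1norm Omega (fun x => phi j x - u x))
    (cvg_cst _) (cvgD (cvg_cst _) (cvgM (cvg_cst _) cphi))).
  near=> j; have Hd : H1 (fun x => phi j x - u x) by exact: H1B.
  have Ld := weak_pderiv_L2 i Hd; have Lu := weak_pderiv_L2 i Hu.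
  have h1 := L2norm_le_H1norm Hd; have h2 := L2norm_weak_le_H1norm i Hd.
  have h3 := poincare_test i OM M0 (tphi j).
  rewrite -L2norm_weak_smooth in h3; last exact: (tphi j).1.
  have h4 : N u <= N (fun x => phi j x - u x) + N (phi j).
    have := L2norm_lin mO (-1) (H1_L2 Hd) (H1_L2 (Hphi j)); rewrite normrN1 mul1r.
    by under [in X in X <= _]eq_fun do rewrite mulN1r opprB subrK.
  have h5 : N (D i (phi j)) <= N (D i (fun x => phi j x - u x)) + N (D i u).
    have Lp := weak_pderiv_L2 i (Hphi j).
    have -> : N (D i (phi j)) = N (fun x => 1 * D i (fun x => phi j x - u x) x + D i u x).
      rewrite /L2norm int_mul_sqrD//; congr Num.sqrt.
      have B := int_weakB i (Hphi j) Hu.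
      set d := D i (fun x => phi j x - u x); set p := D i (phi j).
      rewrite (B d Ld) (int_mulC _ p d) (int_mulC _ (D i u) d) (B p Lp) (B _ Lu).
      rewrite (int_mulC _ (D i u) p); move: (I _ _) (I _ _) (I _ _) => x y z; ring.
    by have := L2norm_lin mO 1 Ld Lu; rewrite normr1 mul1r.
  exact: (le_trans h4 (ler_chain M0 h1 h2 h3 h5)).
by rewrite mulr0 addr0.
Unshelve. all: by end_near. Qed.

End H1_space.

(** * The Hausdorff measure *)

Section euclidean_norm.
Variables (R : realType) (n : nat).
Implicit Types x y z : 'rV[R]_n.

Lemma edotC x y : edot x y = edot y x.
Proof. by apply: eq_bigr => i _; rewrite mulrC. Qed.

Lemma edotDl (a : R) x y z : edot (a *: x + y) z = a * edot x z + edot y z.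
Proof.
rewrite /edot mulr_sumr -big_split/=; apply: eq_bigr => i _.
by rewrite !mxE mulrDl mulrA.
Qed.

Lemma edot_ge0 x : 0 <= edot x x.
Proof. by apply: sumr_ge0 => i _; rewrite -expr2 sqr_ge0. Qed.

Lemma enorm_ge0 x : 0 <= enorm x. Proof. exact: sqrtr_ge0. Qed.

Lemma enorm_sqr x : enorm x ^+ 2 = edot x x.
Proof. by rewrite sqr_sqrtr// edot_ge0. Qed.

Lemma edot_sqrD (a : R) x y :
  edot (a *: x + y) (a *: x + y) = a ^+ 2 * edot x x + 2 * a * edot x y + edot y y.
Proof.
rewrite edotDl (edotC x (_ + _)) (edotC y (_ + _)) !edotDl (edotC y x) expr2; ring.
Qed.

Lemma edot_le x y : `|edot x y| <= enorm x * enorm y.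
Proof.
rewrite -ler_sqr ?nnegrE ?mulr_ge0 ?enorm_ge0// exprMn !enorm_sqr real_normK ?num_real//.
have H a : 0 <= a ^+ 2 * edot x x + 2 * a * edot x y + edot y y by rewrite -edot_sqrD edot_ge0.
have := edot_ge0 x; rewrite le_eqVlt => /predU1P[x0|x0].
  rewrite -x0 mul0r; suff -> : edot x y = 0 by rewrite expr0n.
  apply/eqP; apply: contrapT => /negP xy0; have := H (- (edot y y + 1) / (2 * edot x y)).
  rewrite -x0 mulr0 add0r (_ : 2 * _ * _ = - (edot y y + 1)); last by field.
  lra.
have := H (- edot x y / edot x x).
rewrite (_ : _ + _ = edot y y - edot x y ^+ 2 / edot x x); last first.
  by field; rewrite gt_eqF.
by rewrite subr_ge0 ler_pdivrMr// mulrC.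
Qed.

Lemma ler_enormD x y : enorm (x + y) <= enorm x + enorm y.
Proof.
rewrite -ler_sqr ?nnegrE ?addr_ge0 ?enorm_ge0// sqrrD !enorm_sqr.
have := edot_sqrD 1 x y; rewrite scale1r => ->.
have := edot_le x y; rewrite ler_norml => /andP[_]; lra.
Qed.

Lemma enormZ (a : R) x : enorm (a *: x) = `|a| * enorm x.
Proof.
rewrite /enorm; have := edot_sqrD a x 0; rewrite addr0 => ->.
have E0 : edot x 0 = 0 by apply: big1 => i _; rewrite mxE mulr0.
have E1 : edot (0 : 'rV[R]_n) 0 = 0 by apply: big1 => i _; rewrite mxE mulr0.
by rewrite E0 E1 mulr0 !addr0 sqrtrM ?sqr_ge0// sqrtr_sqr.
Qed.

Lemma enormN x : enorm (- x) = enorm x.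
Proof. by rewrite -scaleN1r enormZ normrN1 mul1r. Qed.

Lemma enorm_coord x i : `|x ord0 i| <= enorm x.
Proof.
rewrite -ler_sqr ?nnegrE ?enorm_ge0// enorm_sqr real_normK ?num_real//.
rewrite /edot (bigD1 i)//= expr2 lerDl sumr_ge0// => j _.
by rewrite -expr2 sqr_ge0.
Qed.

(** The topology and the grid use the maximum norm, charts and diameters the Euclidean one; this
    bound and the next convert between them, with the crude factor n. *)
Lemma normr_le_enorm x : `|x| <= enorm x.
Proof. by apply: normr_rV_bound; [exact: enorm_ge0|exact: enorm_coord]. Qed.

Lemma enorm_le_normr x : enorm x <= n%:R * `|x|.
Proof.
rewrite -ler_sqr ?nnegrE ?mulr_ge0 ?enorm_ge0// enorm_sqr exprMn.
rewrite (@le_trans _ _ (\sum_(i < n) `|x| ^+ 2))//.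
  apply: ler_sum => i _; rewrite -expr2 -real_normK ?num_real// lerXn2r ?nnegrE//.
  exact: normr_rV_le.
rewrite sumr_const card_ord -[leLHS]mulr_natl ler_wpM2r ?sqr_ge0//.
by rewrite -natrX ler_nat; case: (n) => // m; rewrite expnS expn1 leq_pmulr.
Qed.

Lemma enorm_dist_continuous z : continuous (fun x => enorm (x - z)).
Proof.
move=> x; apply: (@cvgrPdist_le _ _ _ (nbhs x) _ _ _).2 => e e0.
have d0 : 0 < e / n.+1%:R by rewrite divr_gt0.
have : \forall y \near x, `|x - y| < e / n.+1%:R.
  by apply/nbhs_ballP; exists (e / n.+1%:R) => //= y; rewrite -ball_normE.
apply: filterS => y xy.
have h : enorm (x - y) <= e.
  rewrite (le_trans (enorm_le_normr _))// (@le_trans _ _ (n.+1%:R * `|x - y|))//.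
    by rewrite ler_wpM2r// ler_nat.
  by rewrite -ler_pdivlMl// mulrC ltW.
rewrite ler_norml; apply/andP; split.
  have := ler_enormD (y - x) (x - z); rewrite addrA subrK -(enormN (y - x)) opprB => h2; lra.
have := ler_enormD (x - y) (y - z); rewrite addrA subrK => h2; lra.
Qed.

End euclidean_norm.

Section caratheodory_criterion.
Variables (R : realType) (T : Type) (mu : {outer_measure set T -> \bar R}) (f : T -> R).
Local Open Scope ereal_scope.

(* Caratheodory's criterion: the slices D k of X between the levels converging to c
   have summable measures, as every other slice is at a positive distance from the previous ones. *)
Lemma caratheodory_halfspace :
  (forall A B (a b : R), (a < b)%R -> (forall x, A x -> (f x <= a)%R) ->
     (forall x, B x -> (b <= f x)%R) -> mu A + mu B <= mu (A `|` B)) ->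
  forall c : R, mu.-caratheodory [set x | (f x <= c)%R].
Proof.
move=> metric c; apply: le_caratheodory_measurable => X.
have [->|Xoo] := eqVneq (mu X) +oo; first exact: leey.
have {}Xoo : mu X < +oo by rewrite ltey.
pose lev (m : nat) : R := (c + m.+2%:R^-1)%R.
have levS m : (lev m.+1 < lev m)%R.
  by rewrite ltrD2l ltf_pV2 ?posrE// ltr_nat.
have lev_nd m k : (m <= k)%N -> (lev k <= lev m)%R.
  by move=> mk; rewrite lerD2l lef_pV2 ?posrE// ler_nat.
pose U m := X `&` [set x | (lev m <= f x)%R].
pose D k := X `&` [set x | (lev k.+2 <= f x < lev k.+1)%R].
have alt o K : \sum_(j < K) mu (D (j.*2 + o)%N) <= mu (U (K.*2 + o)%N).
  elim: K => [|K IH]; first by rewrite big_ord0 outer_measure_ge0.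
  rewrite big_ord_recr/=; apply: (le_trans (leeD IH (lexx _))).
  rewrite addeC; apply: (le_trans (metric _ _ _ _ (levS (K.*2 + o)%N) _ _)).
  - by move=> x [_ /= /andP[_ /ltW]].
  - by move=> x [].
  - apply: le_outer_measure => x [[Xx /= /andP[h _]]|[Xx /= h]]; split => //=.
    by apply: le_trans h; apply: lev_nd; rewrite leq_add2r leq_double.
have Dsum : \sum_(k <oo) mu (D k) < +oo.
  apply: (@le_lt_trans _ _ (mu X + mu X)); last by rewrite lte_add_pinfty.
  apply: lime_le; first by apply: is_cvg_nneseries => k _ _; exact: outer_measure_ge0.
  apply: nearW => N; rewrite big_mkord.
  apply: (@le_trans _ _ (\sum_(j < N) mu (D j.*2) + \sum_(j < N) mu (D j.*2.+1))).
    have -> : \sum_(j < N) mu (D j.*2) + \sum_(j < N) mu (D j.*2.+1) = \sum_(k < N.*2) mu (D k).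
      elim: N => [|N IH]; first by rewrite !big_ord0 adde0.
      by rewrite doubleS !big_ord_recr/= -IH -!addeA; congr (_ + _); rewrite addeCA.
    rewrite -!(big_mkord xpredT (fun k => mu (D k))).
    by apply: lee_sum_nneg_natr => [k _ _|]; [exact: outer_measure_ge0|rewrite -addnn leq_addr].
  apply: leeD.
    have := alt 0%N N; under eq_bigr do rewrite addn0.
    by move=> /le_trans; apply; apply: le_outer_measure => x [].
  have := alt 1%N N; under eq_bigr do rewrite addn1.
  by move=> /le_trans; apply; apply: le_outer_measure => x [].
have Dtail : mu X + \sum_(m <= k <oo) mu (D k) @[m --> \oo] --> mu X + 0.
  apply: cvgeD; first by rewrite fin_num_adde_defl.
    exact: cvg_cst.
  by apply: nneseries_tail_cvg => // k _; exact: outer_measure_ge0.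
rewrite -[leRHS]adde0 -(cvg_lim _ Dtail)//; apply: lime_ge; first exact: cvgP Dtail.
apply: nearW => m.
(* What lies above [c] is [U m.+1], at positive distance from the half-space, together with the
   slices from index [m] on, whose total measure tends to 0. *)
have sub : X `&` ~` [set x | (f x <= c)%R] `<=` U m.+1 `|` \bigcup_k D (k + m)%N.
  move=> x [Xx /= /negP]; rewrite -ltNge => cf.
  have [mf|fm] := leP (lev m.+1) (f x); first by left.
  right.
  have ex : exists k, (lev k.+2 <= f x)%R.
    have fc0 : (0 < f x - c)%R by rewrite subr_gt0.
    have : \forall k \near \oo, (k.+1%:R^-1 < f x - c)%R by exact: (near_infty_natSinv_lt (PosNum fc0)).
    case=> k0 _ hk; exists k0; rewrite /lev -lerBrDl ltW// (le_lt_trans _ (hk k0 _))//=.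
    by rewrite lef_pV2 ?posrE// ler_nat !ltnS -addn3 leq_addr.
  case: (ex_minnP ex) => k hk mink.
  have mk : (m <= k)%N.
    rewrite leqNgt; apply/negP => km; have := le_lt_trans hk fm.
    by rewrite ltNge lev_nd.
  exists (k - m)%N => //; rewrite subnK//; split => //=; rewrite hk/=.
  case: k hk mink mk => [|k] hk mink mk.
    by apply: lt_le_trans fm _; apply: lev_nd.
  by rewrite ltNge; apply/negP => /mink; rewrite ltnn.
apply: (@le_trans _ _ (mu (X `&` [set x | (f x <= c)%R]) + (mu (U m.+1) + \sum_(m <= k <oo) mu (D k)))).
  apply: leeD => //; apply: (le_trans (le_outer_measure _ _ _ sub)).
  apply: (le_trans (outer_measureU2 _ _ _)); apply: leeD => //.
  apply: (le_trans (outer_measure_sigma_subadditive _ _)).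
  rewrite (nneseries_addn (f := fun k => mu (D k)) m) //.
  by move=> k; exact: outer_measure_ge0.
rewrite addeA; apply: leeD => //.
have c1 : (c < lev m.+1)%R by rewrite ltrDl invr_gt0.
apply: (le_trans (metric _ _ _ _ c1 _ _)).
- by move=> x [].
- by move=> x [].
- by apply: le_outer_measure => x [[]|[]].
Qed.

End caratheodory_criterion.

(** * Borel sets are measurable for the Hausdorff measure *)

Section hausdorff_borel.
Variables (R : realType) (n s : nat).
Local Notation fct := ('rV[R]_n -> R).
Local Open Scope ereal_scope.

Lemma hausdorff_gauge_ge0 (d : R) (A : set 'rV[R]_n) : 0 <= hausdorff_gauge s d A.
Proof.
rewrite /hausdorff_gauge; case: asboolP => // /eqP/set0P[x Ax].
case: ifP => // _; apply: expe_ge0.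
apply: le_trans (ereal_sup_ubound _); last by exists x => //; exists x.
by rewrite lee_fin sqrtr_ge0.
Qed.

Lemma hausdorff_gauge_set0 (d : R) : hausdorff_gauge s d (set0 : set 'rV[R]_n) = 0.
Proof. by rewrite /hausdorff_gauge asboolT. Qed.

Lemma hausdorff_gauge_antitone (d1 d2 : R) (A : set 'rV[R]_n) : (d1 <= d2)%R ->
  hausdorff_gauge s d2 A <= hausdorff_gauge s d1 A.
Proof.
move=> d12; rewrite /hausdorff_gauge; case: asboolP => // _.
have [A1|A1] := boolP (ediam A <= d1%:E); last by case: ifP => _; rewrite leey.
by rewrite (le_trans A1 _)// lee_fin.
Qed.

Lemma hausdorff_pre_antitone (d1 d2 : R) (A : set 'rV[R]_n) : (d1 <= d2)%R ->
  hausdorff_pre s d2 A <= hausdorff_pre s d1 A.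
Proof.
move=> d12; apply: le_ereal_inf_tmp => _ [F [mF AF] <-].
apply: (@le_trans _ _ (\sum_(k <oo) hausdorff_gauge s d2 (F k))).
  by apply: ereal_inf_lbound; exists F.
by apply: lee_nneseries => [k _ _|k _]; [exact: hausdorff_gauge_ge0|exact: hausdorff_gauge_antitone].
Qed.

Lemma hausdorff_pre_le (d : R) (A : set 'rV[R]_n) : (0 < d)%R ->
  hausdorff_pre s d A <= hausdorff s A.
Proof. by move=> d0; apply: ereal_sup_ubound; exists d. Qed.

Lemma ediam_ge (A : set 'rV[R]_n) x y : A x -> A y -> (enorm (x - y))%:E <= ediam A.
Proof. by move=> Ax Ay; apply: ereal_sup_ubound; exists x => //; exists y. Qed.

(** A set of diameter at most d < b - a cannot meet both [A] and [B], so a cover of the union splits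
    into a cover of each; sets of larger diameter have infinite gauge. *)
Lemma hausdorff_pre_metric (i : 'I_n) (d a b : R) (A B : set 'rV[R]_n) : (d < b - a)%R ->
  (forall x, A x -> (x ord0 i <= a)%R) -> (forall x, B x -> (b <= x ord0 i)%R) ->
  hausdorff_pre s d A + hausdorff_pre s d B <= hausdorff_pre s d (A `|` B).
Proof.
move=> dab hA hB; apply: le_ereal_inf_tmp => _ [F [mF ABF] <-].
pose FA k := if `[< exists2 x, F k x & A x >] then F k else set0.
pose FB k := if `[< exists2 x, F k x & B x >] then F k else set0.
apply: (@le_trans _ _ (\sum_(k <oo) (hausdorff_gauge s d (FA k) + hausdorff_gauge s d (FB k)))).
  rewrite nneseriesD; [|by move=> *; exact: hausdorff_gauge_ge0..].
  apply: leeD; apply: ereal_inf_lbound.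
    exists FA => //; split => // x Ax; have [k _ Fx] := ABF x (or_introl Ax).
    by exists k => //; rewrite /FA; case: asboolP => // -[]; exists x.
  exists FB => //; split => // x Bx; have [k _ Fx] := ABF x (or_intror Bx).
  by exists k => //; rewrite /FB; case: asboolP => // -[]; exists x.
apply: lee_nneseries => [k _ _|k _]; first by rewrite adde_ge0// hausdorff_gauge_ge0.
rewrite /FA /FB; case: asboolP => [[x Fx Ax]|_]; last first.
  by rewrite hausdorff_gauge_set0 add0e; case: asboolP => // _; rewrite ?hausdorff_gauge_set0 ?hausdorff_gauge_ge0.
case: asboolP => [[y Fy By]|_]; last by rewrite hausdorff_gauge_set0 adde0.
rewrite [leRHS]/hausdorff_gauge; case: asboolP => [F0|_]; first by rewrite F0 in Fx.
rewrite ifF ?leey//; apply/negP => dF.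
have := le_trans (ediam_ge Fy Fx) dF; rewrite lee_fin.
have := enorm_coord (y - x) i; rewrite !mxE => h1 h2.
have := le_trans (ler_norm _) (le_trans h1 h2); have := hA x Ax; have := hB y By; lra.
Qed.

(** Two independent scales are first compared at a common one below the gap b - a. The suprema over
    the two scales are then taken one after the other, which is why finiteness has to be tracked. *)
Lemma hausdorff_metric (i : 'I_n) (A B : set 'rV[R]_n) (a b : R) : (a < b)%R ->
  (forall x, A x -> (x ord0 i <= a)%R) -> (forall x, B x -> (b <= x ord0 i)%R) ->
  hausdorff s A + hausdorff s B <= hausdorff s (A `|` B).
Proof.
move=> ab hA hB.
have pre_ge0 d C : 0 <= hausdorff_pre s d (C : set 'rV[R]_n).
  by apply: mu_ext_ge0 => X; exact: hausdorff_gauge_ge0.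
have key d1 d2 : (0 < d1)%R -> (0 < d2)%R ->
    hausdorff_pre s d1 A + hausdorff_pre s d2 B <= hausdorff s (A `|` B).
  move=> d10 d20; pose d := Num.min (Num.min d1 d2) ((b - a) / 2)%R.
  have d0 : (0 < d)%R by rewrite !lt_min d10 d20/= divr_gt0// subr_gt0.
  apply: le_trans (hausdorff_pre_le _ d0).
  apply: le_trans (hausdorff_pre_metric (d := d) _ hA hB); last first.
    rewrite /d gt_min; apply/orP; right; lra.
  by apply: leeD; apply: hausdorff_pre_antitone; rewrite /d !ge_min lexx ?orbT.
have h0 C : 0 <= hausdorff s (C : set 'rV[R]_n) by exact: outer_measure_ge0.
have [Aoo|Aoo] := eqVneq (hausdorff s (A `|` B)) +oo; first by rewrite Aoo leey.
have fin : hausdorff s (A `|` B) \is a fin_num by rewrite ge0_fin_numE// ltey.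
have finA d1 : (0 < d1)%R -> hausdorff_pre s d1 A \is a fin_num.
  move=> d0; rewrite ge0_fin_numE//; apply: le_lt_trans (_ : _ < +oo); last by rewrite ltey; exact: Aoo.
  by apply: le_trans (key d1 d1 d0 d0); rewrite leeDl.
have step1 d1 : (0 < d1)%R -> hausdorff_pre s d1 A + hausdorff s B <= hausdorff s (A `|` B).
  move=> d0; rewrite addeC -leeBrDr ?finA//; apply: ge_ereal_sup => _ [d2 d20 <-].
  by rewrite leeBrDr ?finA// addeC key.
have finB : hausdorff s B \is a fin_num.
  rewrite ge0_fin_numE//; apply: le_lt_trans (_ : _ < +oo); last by rewrite ltey; exact: Aoo.
  by apply: le_trans (step1 1%R ltr01); rewrite leeDr.
rewrite -leeBrDr//; apply: ge_ereal_sup => _ [d1 d10 <-].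
by rewrite leeBrDr// step1.
Qed.

(** Half-spaces satisfy Caratheodory's condition and generate the Borel sets. This makes Borel
    functions on R^n measurable for the surface measure. *)
Lemma measurable_hausdorff_id :
  measurable_fun setT (fun x : caratheodory_type (@hausdorff R n s) => x : 'rV[R]_n).
Proof.
apply: measurable_fun_rV => i; apply: (measurability _ (RGenOInfty.measurableE R)).
move=> _ [_ [c ->] <-]; rewrite setTI.
rewrite (_ : _ @^-1` _ = ~` [set x : 'rV[R]_n | (x ord0 i <= c)%R]); last first.
  by apply/seteqP; split => x /=; rewrite in_itv/= andbT ltNge => /negP.
apply: measurableC; apply: (caratheodory_halfspace (f := fun x : 'rV[R]_n => x ord0 i)).
exact: hausdorff_metric.
Qed.

End hausdorff_borel.

(* The tube of a set of diameter at most d under the translations by -t e, 0 <= t <= h,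
   is covered by about h / d cubes of side 4 d. *)
Section tube.
Variables (R : realType) (n : nat) (e : 'rV[R]_n) (h : R).
Hypotheses (e1 : enorm e = 1) (h0 : 0 < h).
Local Notation leb := (lebesgue_rV R n).

Definition tube (B : set 'rV[R]_n) : set 'rV[R]_n :=
  [set x | exists2 b, B b & exists2 t, 0 <= t <= h & x = b - t *: e].

Lemma tube_cover (B : set 'rV[R]_n) (d : R) : 0 < d <= h -> (ediam B <= d%:E)%E ->
  exists T : set 'rV[R]_n, [/\ measurable T, tube B `<=` T &
    (leb T <= (2 * h / d * (4 * d) ^+ n)%:E)%E].
Proof.
move=> /andP[d0 dh] Bd.
have [->|/set0P[b0 Bb0]] := eqVneq B set0.
  exists set0; split => //; first by move=> x [].
  by rewrite measure0 lee_fin mulr_ge0// ?exprn_ge0 ?divr_ge0 ?mulr_ge0// ltW.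
(* Since d <= h, [N] is at most 2 h / d. Rounding t down to a multiple of [d] moves a point by at
   most [d], and the diameter of [B] contributes another [d]: each coordinate is within 2 d of the
   centre of a cube, hence the side 4 d. *)
pose N := (Num.truncn (h / d)).+1.
pose c (l : nat) : 'rV[R]_n := \row_i ((b0 - (l%:R * d) *: e) ord0 i - 2 * d).
exists (\big[setU/set0]_(l < N) cube (c l) (4 * d)); split.
- by apply: bigsetU_measurable => l _; exact: measurable_cube.
- move=> x [b Bb [t /andP[t0 th] ->]].
  have td0 : 0 <= t / d by rewrite divr_ge0// ltW.
  have /andP[l1 l2] := truncn_itv td0; set l := Num.truncn (t / d) in l1 l2.
  have lN : (l < N)%N by rewrite ltnS le_truncn// ler_pM2r ?invr_gt0.
  rewrite -(bigcup_mkord N (fun l => cube (c l) (4 * d))); exists l => // i; rewrite !mxE.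
  have := enorm_coord (b - b0) i; rewrite !mxE => hb.
  have := ediam_ge Bb Bb0 => /le_trans /(_ Bd); rewrite lee_fin => /(le_trans hb).
  rewrite ler_norml => /andP[hb1 hb2].
  have := enorm_coord e i; rewrite e1 ler_norml => /andP[ei1 ei2].
  rewrite ler_pdivlMr// in l1; rewrite ltr_pdivrMr// -natr1 mulrDl mul1r in l2.
  have hu : `|(t - l%:R * d) * e ord0 i| <= d.
    rewrite normrM -[leRHS]mulr1 ler_pM// ?ler_norml; apply/andP; split; lra.
  by move: hu; rewrite mulrBl ler_norml => /andP[hu1 hu2]; apply/andP; split; lra.
- apply: (@le_trans _ _ (\sum_(l < N) leb (cube (c l) (4 * d)))%E).
    exact: (@Boole_inequality _ _ _ leb (fun l => cube (c l) (4 * d)) N (fun l _ => measurable_cube (c l) (4 * d))).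
  under eq_bigr do rewrite (lebesgue_rV_cube _ (_ : 0 <= 4 * d)) ?mulr_ge0 ?(ltW d0)//.
  rewrite sumEFin lee_fin sumr_const card_ord -[leLHS]mulr_natl ler_wpM2r ?exprn_ge0 ?mulr_ge0 ?(ltW d0)//.
  have hd1 : 1 <= h / d by rewrite ler_pdivlMr// mul1r.
  have /andP[l1 _] := truncn_itv (le_trans ler01 hd1).
  rewrite (_ : 2 * h / d = h / d + h / d); last by ring.
  by rewrite /N -[X in X%:R <= _]addn1 natrD lerD.
Qed.

(** With d the diameter, (2 h / d) (4 d)^n equals 2 h 4^n d^(n-1). A set of diameter 0 is covered at
    all the scales h / (m+1), and the intersection of these covers is a null set because n - 1 >
    0. *)
Lemma tube_cover_ediam (B : set 'rV[R]_n) : (1 < n)%N -> B !=set0 -> (ediam B <= h%:E)%E ->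
  exists T : set 'rV[R]_n, [/\ measurable T, tube B `<=` T &
    (leb T <= (2 * h * 4 ^+ n)%:E * ediam B ^+ n.-1)%E].
Proof.
move=> n1 [b0 Bb0] Bh.
have ediam0 : (0 <= ediam B)%E.
  by apply: le_trans (ediam_ge Bb0 Bb0); rewrite lee_fin enorm_ge0.
have nE : n = n.-1.+1 by rewrite prednK// ltnW.
have [d Ed] : exists d, ediam B = d%:E.
  by exists (fine (ediam B)); rewrite fineK// ge0_fin_numE// (le_lt_trans Bh)// ltry.
rewrite Ed in Bh ediam0 *; rewrite lee_fin in Bh; rewrite lee_fin in ediam0.
have calc (d' : R) : 0 < d' -> 2 * h / d' * (4 * d') ^+ n = 2 * h * 4 ^+ n * d' ^+ n.-1.
  move=> d'0; rewrite exprMn; have -> : d' ^+ n = d' * d' ^+ n.-1 by rewrite -exprS -nE.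
  by field; rewrite gt_eqF.
rewrite -EFin_expe -EFinM.
move: ediam0; rewrite le_eqVlt => /predU1P[d0|d0]; last first.
  have [||T [mT BT leT]] := @tube_cover B d; [by rewrite d0|by rewrite Ed|].
  by exists T; split => //; rewrite -calc.
have hm (m : nat) : 0 < h / m.+1%:R <= h.
  by rewrite divr_gt0//= ler_pdivrMr// ler_peMr ?(ltW h0)// ler1n.
have Bm (m : nat) : (ediam B <= (h / m.+1%:R)%:E)%E.
  by rewrite Ed lee_fin -d0; have /andP[/ltW] := hm m.
have /choice[T hT] := fun m : nat => @tube_cover B (h / m.+1%:R) (hm m) (Bm m).
have mT : measurable (\bigcap_m T m) by apply: bigcapT_measurable => m; have [] := hT m.
exists (\bigcap_m T m); split => //; first by move=> x Bx m _; have [_ + _] := hT m; apply.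
rewrite -d0 (_ : 0 ^+ n.-1 = 0 :> R); last first.
  by rewrite expr0n; case: eqP => // n0; move: n1; rewrite nE n0.
rewrite mulr0; apply/lee_addgt0Pr => eps eps0; rewrite add0e.
have hh : h / m.+1%:R @[m --> \oo] --> (0 : R).
  by rewrite -[X in _ --> X](mulr0 h); apply: cvgM; [exact: cvg_cst|exact: cvg_harmonic].
have cvX k : (h / m.+1%:R) ^+ k.+1 @[m --> \oo] --> (0 : R).
  elim: k => [|k IH]; first exact: hh.
  rewrite -[X in _ --> X](mulr0 (0 : R)); apply: (cvg_ext (v := fun m => h / m.+1%:R * (h / m.+1%:R) ^+ k.+1)).
    by move=> m; rewrite exprS.
  exact: cvgM.
have cv : 2 * h * 4 ^+ n * (h / m.+1%:R) ^+ n.-1 @[m --> \oo] --> (0 : R).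
  rewrite -[X in _ --> X](mulr0 (2 * h * 4 ^+ n)); apply: cvgM; first exact: cvg_cst.
  by case: (n) n1 => [|[|k]] // _; exact: cvX.
have /cvgrPdist_le /(_ _ eps0) [m _ /(_ m (leqnn m))] /= := cv.
have /andP[hm0 _] := hm m.
rewrite sub0r normrN ger0_norm; last first.
  by rewrite mulr_ge0 ?exprn_ge0 ?(ltW hm0)// mulr_ge0 ?exprn_ge0// mulr_ge0// ltW.
move=> hle; have [mTm _ leT] := hT m.
apply: (@le_trans _ _ (leb (T m))); first by apply: le_measure; rewrite ?inE//; exact: bigcap_inf.
by apply: (le_trans leT); rewrite lee_fin calc.
Qed.

(** Each set of a cover of [A] has a tube of measure at most C times its gauge; a set of diameter
    above [h] has infinite gauge and is given the whole space. Summing over the cover and taking the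
    infimum gives the bound at scale [h]. *)
Lemma le_hausdorff_tube (L A : set 'rV[R]_n) : (1 < n)%N -> measurable L -> L `<=` tube A ->
  (leb L <= (2 * h * 4 ^+ n)%:E * hausdorff n.-1 A)%E.
Proof.
move=> n1 mL LA; set C := 2 * h * 4 ^+ n.
have C0 : 0 < C by rewrite !mulr_gt0// exprn_gt0.
apply: (@le_trans _ _ (C%:E * hausdorff_pre n.-1 h A)%E); last first.
  by rewrite lee_pmul2l// hausdorff_pre_le.
rewrite -lee_pdivrMl//; apply: le_ereal_inf_tmp => _ [F [_ AF] <-].
rewrite lee_pdivrMl//.
have /choice[T hT] : forall k, exists T : set 'rV[R]_n, [/\ measurable T, tube (F k) `<=` T &
    (leb T <= C%:E * hausdorff_gauge n.-1 h (F k))%E].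
  move=> k; rewrite /hausdorff_gauge; case: asboolP => [->|/eqP/set0P Fk].
    exists set0; split => //; first by move=> x [].
    by rewrite measure0 mule0.
  case: ifP => Fh; first exact: tube_cover_ediam.
  by exists setT; split => //; rewrite gt0_muley ?lte_fin// leey.
have mT k : measurable (T k) by have [] := hT k.
rewrite -nneseriesZl; last by move=> k _; exact: hausdorff_gauge_ge0.
apply: (@le_trans _ _ (leb (\bigcup_k T k))).
  apply: le_measure; rewrite ?inE//; first exact: bigcupT_measurable.
  move=> x /LA[a Aa [t t01 xE]]; have [k _ Fa] := AF a Aa.
  by exists k => //; have [_ + _] := hT k; apply; exists a => //; exists t.
apply: (@le_trans _ _ (\sum_(k <oo) leb (T k))%E).
  by apply: generalized_Boole_inequality => //; exact: bigcupT_measurable.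
by apply: lee_nneseries => // k _; have [] := hT k.
Qed.

End tube.

(** * Functions of zero trace *)

Section compare_integrals.
Local Open Scope ereal_scope.

Lemma ge0_integral_mrestr d (T : measurableType d) (R : realType)
    (mu : {measure set T -> \bar R}) (D : set T) (mD : measurable D) (f : T -> \bar R) :
  measurable_fun setT f -> (forall x, 0 <= f x) ->
  \int[mrestr mu mD]_x f x = \int[mu]_(x in D) f x.
Proof.
move=> mf f0; rewrite -(setUv D) ge0_integral_setU//; first last.
- by rewrite disj_set2E setICr.
- by rewrite setUv.
- exact: measurableC.
rewrite [X in _ + X]null_set_integral ?adde0; last 3 first.
- exact: measurableC.
- exact: measurable_funS mf.
- by rewrite /= /mrestr setICl measure0.
by apply: eq_measure_integral => A mA AD; rewrite /= /mrestr setIidl.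
Qed.

(** The hypothesis compares the pushforwards to [T] of the two restricted measures, so it passes to
    integrals of nonnegative functions on [T]. It serves to compare an integral over a strip, taken
    at the feet of its points, with a surface integral. *)
Lemma le_integral_image d1 d2 d (T1 : measurableType d1) (T2 : measurableType d2)
    (T : measurableType d) (R : realType)
    (m1 : {measure set T1 -> \bar R}) (m2 : {measure set T2 -> \bar R})
    (D1 : set T1) (D2 : set T2) (g1 : T1 -> T) (g2 : T2 -> T) (C : R) (f : T -> \bar R) :
  measurable D1 -> measurable D2 -> measurable_fun setT g1 -> measurable_fun setT g2 ->
  (0 <= C)%R ->
  (forall A, measurable A -> m1 (g1 @^-1` A `&` D1) <= C%:E * m2 (g2 @^-1` A `&` D2)) ->
  measurable_fun setT f -> (forall x, 0 <= f x) ->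
  \int[m1]_(x in D1) f (g1 x) <= C%:E * \int[m2]_(x in D2) f (g2 x).
Proof.
move=> mD1 mD2 mg1 mg2 C0 m12 mf f0.
rewrite -(ge0_integral_mrestr _ mD1 (measurableT_comp mf mg1)); last by move=> x; exact: f0.
rewrite -(ge0_integral_mrestr _ mD2 (measurableT_comp mf mg2)); last by move=> x; exact: f0.
rewrite -[X in X <= _](ge0_integral_pushforward mg1 (mrestr m1 mD1) (D := setT) (f := f))//.
rewrite -[X in _ <= _ * X](ge0_integral_pushforward mg2 (mrestr m2 mD2) (D := setT) (f := f))//.
rewrite -[X in X%:E * _]/((NngNum C0)%:num)%R.
rewrite -(ge0_integral_mscale (pushforward_measure (mrestr m2 mD2) mg2))//.
apply: (ge0_le_measure_integral (m1 := pushforward_measure (mrestr m1 mD1) mg1)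
   (m2 := mscale (NngNum C0) (pushforward_measure (mrestr m2 mD2) mg2))) => //.
Qed.

Lemma ge0_le_integral_setU d (X : measurableType d) (R : realType) (mu : {measure set X -> \bar R})
    (A B : set X) (f : X -> \bar R) : measurable A -> measurable B ->
  measurable_fun setT f -> (forall x, 0 <= f x) ->
  \int[mu]_(x in A `|` B) f x <= \int[mu]_(x in A) f x + \int[mu]_(x in B) f x.
Proof.
move=> mA mB mf f0; have -> : A `|` B = A `|` (B `\` A).
  by apply/seteqP; split => x [Ax|]; [left|have [] := pselect (A x); [left|right]|left|case; right].
have mBA : measurable (B `\` A) by exact: measurableD.
rewrite ge0_integral_setU//; last first.
- by rewrite disj_set2E setIDA setIC -setIDA setDv setI0.
- by apply: measurable_funTS.
apply: leeD => //; apply: ge0_subset_integral => //; exact: measurable_funTS.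
Qed.

Lemma ge0_integral_sqrB d (X : measurableType d) (R : realType)
    (mu : {measure set X -> \bar R}) (D : set X) (a b : X -> R) : measurable D ->
  measurable_fun D a -> measurable_fun D b ->
  \int[mu]_(x in D) ((a x - b x) ^+ 2)%:E <=
  2%:E * \int[mu]_(x in D) (a x ^+ 2)%:E + 2%:E * \int[mu]_(x in D) (b x ^+ 2)%:E.
Proof.
move=> mD ma mb.
have msq (f : X -> R) : measurable_fun D f -> measurable_fun D (fun x => (f x ^+ 2)%:E).
  by move=> mf; apply/measurable_EFinP; exact: measurable_funX.
have sq0 (f : X -> R) x : 0 <= (f x ^+ 2)%:E by rewrite lee_fin sqr_ge0.
have ma2 := msq a ma; have mb2 := msq b mb.
apply: (@le_trans _ _ (\int[mu]_(x in D) (2%:E * (a x ^+ 2)%:E + 2%:E * (b x ^+ 2)%:E))).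
  apply: ge0_le_integral => //.
  - by move=> x _; exact: (sq0 (fun x => (a x - b x)%R)).
  - by apply: (msq (fun x => (a x - b x)%R)); exact: measurable_funB.
  - by apply: emeasurable_funD; exact: emeasurable_funM.
  - move=> x _; rewrite -!EFinM -EFinD lee_fin.
    have := sqr_ge0 (a x + b x)%R; rewrite sqrrD sqrrB; lra.
rewrite ge0_integralD//; last 4 first.
- by move=> x _; rewrite mule_ge0.
- exact: emeasurable_funM.
- by move=> x _; rewrite mule_ge0.
- exact: emeasurable_funM.
by rewrite !ge0_integralZl.
Qed.

End compare_integrals.

Section line_integrals.
Variable R : realType.

(** With m the mean slope, f'^2 >= 2 m f' - m^2. The right side has the explicit primitive [F], and
    its integral is (f s - f 0)^2 / s. This is Cauchy-Schwarz on the segment. *)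
Lemma sqr_increment_le (f f' : R -> R) (s : R) : 0 < s ->
  (forall t : R, is_derive t 1 f (f' t)) -> continuous f' ->
  (((f s - f 0) ^+ 2)%:E <=
   s%:E * \int[lebesgue_measure]_(t in `[0%R, s]) (f' t ^+ 2)%:E)%E.
Proof.
move=> s0 df cf'; pose m := (f s - f 0) / s.
have cg (g : R -> R) : continuous g -> {within `[0, s], continuous g}.
  by move=> c; exact: continuous_subspaceT.
have intg (g : R -> R) : continuous g -> lebesgue_measure.-integrable `[0, s] (EFin \o g).
  by move=> c; apply: continuous_compact_integrable; [exact: segment_compact|exact: cg].
have c1 : continuous (fun t => 2 * m * f' t - m ^+ 2).
  by move=> t; apply: cvgB; [apply: cvgM; [exact: cvg_cst|exact: cf']|exact: cvg_cst].
have c2 : continuous (fun t => f' t ^+ 2).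
  by move=> t; under eq_fun do rewrite expr2; apply: cvgM; exact: cf'.
pose F t := 2 * m * f t - m ^+ 2 * t.
have dF (t : R) : is_derive t 1 F (2 * m * f' t - m ^+ 2).
  have -> : F = (2 * m) *: f - (m ^+ 2) *: id by apply/funext.
  have := df t => dft.
  by apply: is_derive_eq; rewrite /GRing.scale/= mulr1.
have cF : continuous F.
  move=> t; apply: differentiable_continuous; apply/derivable1_diffP.
  by have [] := dF t.
have FTC : (\int[lebesgue_measure]_(t in `[0%R, s]) (2 * m * f' t - m ^+ 2)%:E = (F s)%:E - (F 0)%:E)%E.
  apply: continuous_FTC2 => //.
  - exact: cg.
  - split.
    + by move=> t _; have [] := dF t.
    + exact/cvg_at_right_filter/cF.
    + exact/cvg_at_left_filter/cF.
  - by move=> t _; rewrite derive1E; have [_] := dF t.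
have -> : ((f s - f 0) ^+ 2)%:E = (s%:E * ((F s)%:E - (F 0)%:E))%E.
  rewrite -EFinB -EFinM; congr EFin; rewrite /F /m; field; exact: lt0r_neq0.
rewrite -FTC lee_pmul2l ?lte_fin//.
apply: le_integral => //; [exact: intg c1|exact: intg c2|].
move=> t _; rewrite lee_fin; have := sqr_ge0 (f' t - m); rewrite sqrrB; lra.
Qed.

(** Tonelli exchanges the integrals, and translation invariance makes the inner one independent of
    [t]. *)
Lemma ge0_integral_segment (n : nat) (G : 'rV[R]_n -> \bar R) (e : 'rV[R]_n) (h : R) :
  measurable_fun setT G -> (forall x, 0 <= G x)%E -> 0 <= h ->
  measurable_fun setT (fun x : 'rV[R]_n => \int[lebesgue_measure]_(t in `[0%R, h]) G (x + t *: e)%R)%E /\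
  (\int[lebesgue_rV R n]_x \int[lebesgue_measure]_(t in `[0%R, h]) G (x + t *: e)%R =
   h%:E * \int[lebesgue_rV R n]_x G x)%E.
Proof.
move=> mG G0 h0.
pose H (p : 'rV[R]_n * measurableTypeR R) : \bar R :=
  (G (p.1 + p.2 *: e)%R * (\1_(`[0, h]%classic) p.2)%:E)%E.
have mH : measurable_fun setT H.
  apply: emeasurable_funM.
    apply: (measurableT_comp mG); apply: measurable_fun_rV => i.
    under eq_fun do rewrite !mxE; apply: measurable_funD.
      exact: (measurableT_comp (measurable_coord i) measurable_fst).
    by apply: measurable_funM => //; exact: measurable_snd.
  have m1 : measurable_fun setT (fun t : measurableTypeR R => (\1_(`[0, h]%classic) t)%:E : \bar R).
    by apply/measurable_EFinP; exact: measurable_indic.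
  exact: (measurableT_comp m1 measurable_snd).
have H0 p : (0 <= H p)%E by rewrite mule_ge0// lee_fin.
have HE x : (\int[lebesgue_measure]_(t in `[0%R, h]) G (x + t *: e)%R =
             \int[lebesgue_measure]_t H (x, t))%E.
  by rewrite integral_mkcond epatch_indic.
split.
  under eq_fun do rewrite HE.
  have := @measurable_fun_fubini_tonelli_F _ _ _ _ R
    (lebesgue_measure : {sigma_finite_measure set (measurableTypeR R) -> \bar R}) H mH H0.
  by rewrite /fubini_F.
under eq_integral do rewrite HE.
have -> := @fubini_tonelli _ _ _ _ R (lebesgue_rV R n)
  (lebesgue_measure : {sigma_finite_measure set (measurableTypeR R) -> \bar R}) H mH H0.
transitivity (\int[lebesgue_measure]_(t in `[0%R, h]) (cst (\int[lebesgue_rV R n]_x G x) t))%E.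
  rewrite [RHS]integral_mkcond epatch_indic; apply: eq_integral => t _.
  rewrite /H/= ge0_integralZr//=.
    by rewrite (ge0_integral_translate (t *: e) mG G0).
  exact: (measurableT_comp mG (measurable_addr_rV _)).
etransitivity; first exact: integral_cst.
rewrite muleC; congr (_ * _)%E; transitivity (lebesgue_measure `[0, h]) => //.
rewrite lebesgue_measure_itv/= lte_fin.
case: ltP => h1; first by rewrite oppr0 adde0.
by have -> : h = 0 by apply/eqP; rewrite eq_le h0 h1.
Qed.

End line_integrals.

Lemma measurable_boundary (R : realType) (n s : nat) (Omega : set 'rV[R]_n) :
  measurable (boundary Omega : set (caratheodory_type (@hausdorff R n s))).
Proof.
have mG : measurable (boundary Omega : set 'rV[R]_n).
  apply: measurableD; last exact: open_measurable_rV (open_interior _).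
  rewrite -[X in measurable X]setCK; apply: measurableC; apply: open_measurable_rV.
  exact/closed_openC/closed_closure.
by have := @measurable_hausdorff_id R n s measurableT _ mG; rewrite setTI.
Qed.

(** * The estimate in a strip below a Lipschitz graph *)

Section chart.
Variables (R : realType) (n : nat) (Omega : set 'rV[R]_n) (x0 e : 'rV[R]_n).
Variables (g : 'rV[R]_n -> R) (r L : R).
Hypothesis e1 : enorm e = 1.
Hypothesis gL : forall x y, `|g x - g y| <= L * enorm (x - y).
Hypothesis gO : forall y, enorm (y - x0) < r ->
  (Omega y <-> edot y e < g (y - edot y e *: e)).
Local Notation leb := (lebesgue_rV R n).

(* Within distance r of x0, Omega is the set where the height s is positive, and x + s(x) e is the
   boundary point above x. *)
Definition chart_height (x : 'rV[R]_n) : R := g (x - edot x e *: e) - edot x e.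
Local Notation s := chart_height.
Definition chart_foot (x : 'rV[R]_n) : 'rV[R]_n := x + s x *: e.
Definition chart_strip (rho h : R) : set 'rV[R]_n :=
  [set x | enorm (x - x0) < rho /\ 0 < s x <= h].

Lemma chart_height_gt0 y : enorm (y - x0) < r -> (Omega y <-> 0 < s y).
Proof. by move=> /gO; rewrite /s subr_gt0. Qed.

(** As [e] is a unit vector, moving along it leaves x - (x . e) e unchanged, hence also the value of
    [g]. *)
Lemma chart_heightD x t : s (x + t *: e) = s x - t.
Proof.
have ee : edot e e = 1 by rewrite -enorm_sqr e1 expr1n.
have E : edot (x + t *: e) e = edot x e + t.
  by rewrite addrC edotDl ee mulr1 addrC.
rewrite /s E; rewrite (_ : x + t *: e - _ = x - edot x e *: e); last first.
  by rewrite scalerDl opprD addrACA subrr addr0.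
ring.
Qed.

(** The component orthogonal to [e] moves by at most twice the distance, and the coordinate along
    [e] by at most the distance. *)
Lemma chart_height_lipschitz x y : `|s x - s y| <= (2 * `|L| + 1) * enorm (x - y).
Proof.
have E : edot (x - y) e = edot x e - edot y e.
  by have := edotDl (-1) y x e; rewrite scaleN1r addrC => ->; rewrite mulN1r addrC.
have h1 : `|edot x e - edot y e| <= enorm (x - y).
  by rewrite -E (le_trans (edot_le _ _))// e1 mulr1.
have h2 := gL (x - edot x e *: e) (y - edot y e *: e).
have h3 : enorm ((x - edot x e *: e) - (y - edot y e *: e)) <= 2 * enorm (x - y).
  have -> : (x - edot x e *: e) - (y - edot y e *: e) =
      (x - y) + (- (edot x e - edot y e)) *: e.
    by apply/rowP => i; rewrite !mxE; ring.
  by rewrite (le_trans (ler_enormD _ _))// enormZ normrN e1 mulr1 mulrDl mul1r lerD2l.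
have h4 : L * enorm ((x - edot x e *: e) - (y - edot y e *: e)) <= `|L| * (2 * enorm (x - y)).
  rewrite (le_trans (ler_norm _))// normrM ler_wpM2l// ger0_norm//; exact: enorm_ge0.
rewrite /s (_ : _ - _ - _ = (g (x - edot x e *: e) - g (y - edot y e *: e)) -
  (edot x e - edot y e)); last by ring.
rewrite (le_trans (ler_normB _ _))//; lra.
Qed.

Lemma chart_height_continuous : continuous s.
Proof.
move=> x; apply: (@cvgrPdist_le _ _ _ (nbhs x) _ _ _).2 => ep ep0.
pose M := 2 * `|L| + 1.
have M0 : 0 < M by rewrite /M; have := normr_ge0 L; lra.
have c : (fun y => enorm (y - x)) y @[y --> x] --> (0 : R).
  have -> : (0 : R) = enorm (x - x).
    by rewrite subrr /enorm /edot big1 ?sqrtr0// => i _; rewrite mxE mulr0.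
  exact: enorm_dist_continuous.
have epM : 0 < ep / M by rewrite divr_gt0.
have : \forall y \near x, `|0 - enorm (y - x)| <= ep / M.
  exact: (@cvgrPdist_le _ _ _ (nbhs x) _ _ _).1 c _ epM.
apply: filterS => y; rewrite sub0r normrN ger0_norm ?enorm_ge0// ler_pdivlMr// => h.
by rewrite (le_trans (chart_height_lipschitz x y))// mulrC -enormN opprB.
Qed.

Lemma measurable_chart_height : measurable_fun setT s.
Proof. exact: continuous_measurable_rV chart_height_continuous. Qed.

Lemma measurable_chart_foot : measurable_fun setT chart_foot.
Proof.
apply: measurable_fun_rV => i; under eq_fun do rewrite !mxE.
apply: measurable_funD; first exact: measurable_coord.
by apply: measurable_funM => //; exact: measurable_chart_height.
Qed.

Lemma measurable_chart_strip rho h : measurable (chart_strip rho h).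
Proof.
have -> : chart_strip rho h =
    (fun x => enorm (x - x0)) @^-1` `]-oo, rho[ `&` s @^-1` `]0, h].
  by apply/seteqP; split => x /=; rewrite !in_itv/=.
apply: measurableI; rewrite -[X in measurable X]setTI.
  apply: (continuous_measurable_rV (f := fun x => enorm (x - x0))) => //.
  exact: enorm_dist_continuous.
by apply: measurable_chart_height => //.
Qed.

Lemma chart_strip_sub h : chart_strip r h `<=` Omega.
Proof. by move=> x [xr /andP[sx _]]; apply/chart_height_gt0. Qed.

Lemma chart_stripD h x t : h < r / 2 -> chart_strip (r / 2) h x -> 0 <= t < s x ->
  chart_strip r h (x + t *: e).
Proof.
move=> hr [xr /andP[s0 sh]] /andP[t0 ts]; split; last by rewrite chart_heightD; lra.
rewrite addrAC (le_lt_trans (ler_enormD _ _))// enormZ e1 mulr1 ger0_norm//; lra.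
Qed.

(** The foot has height 0, hence lies outside [Omega]; points just below it along [e] have positive
    height, hence lie in [Omega]. The half radius and h < r / 2 keep all of them in the ball where
    the chart is valid. *)
Lemma chart_foot_boundary h x : h < r / 2 -> chart_strip (r / 2) h x ->
  boundary Omega (chart_foot x).
Proof.
move=> hr Lx; have [xr /andP[s0 sh]] := Lx; split; last first.
  move=> /interior_subset Of.
  have : enorm (chart_foot x - x0) < r.
    rewrite /chart_foot addrAC (le_lt_trans (ler_enormD _ _))// enormZ e1 mulr1 gtr0_norm//; lra.
  by move=> /chart_height_gt0 /iffLR /(_ Of); rewrite chart_heightD subrr ltxx.
move=> B /nbhs_ballP[d/= d0 dB].
have t0 : 0 < Num.min (s x) (d / 2) by rewrite lt_min s0 divr_gt0.
pose t := s x - Num.min (s x) (d / 2).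
have ts : 0 <= t < s x by rewrite subr_ge0 ge_min lexx/= ltrBlDr ltrDl.
exists (x + t *: e); split; first exact/chart_strip_sub/(chart_stripD hr Lx ts).
apply: dB; rewrite -ball_normE/=.
rewrite /chart_foot opprD addrACA subrr add0r -scalerBl.
rewrite (le_lt_trans (normr_le_enorm _))// enormZ e1 mulr1 /t subKr gtr0_norm// gt_min.
apply/orP; right; lra.
Qed.

(** A point of the strip is its foot moved back along [e] by at most [h], so the strip points with
    foot in [A] lie in the tube over the part of the boundary in [A], and [le_hausdorff_tube]
    applies. *)
Lemma le_integral_foot (h : R) (f : 'rV[R]_n -> \bar R) : (1 < n)%N -> 0 < h < r / 2 ->
  measurable_fun setT f -> (forall x, (0 <= f x)%E) ->
  (\int[leb]_(x in chart_strip (r / 2) h) f (chart_foot x) <=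
   (2 * h * 4 ^+ n)%:E * \int[surface_measure R n]_(x in boundary Omega) f x)%E.
Proof.
move=> n1 /andP[h0 hr] mf f0.
apply: (@le_integral_image _ _ _ _ (caratheodory_type (@hausdorff R n n.-1)) 'rV[R]_n R leb
  (surface_measure R n) (chart_strip (r / 2) h) (boundary Omega) chart_foot
  (fun x : caratheodory_type (@hausdorff R n n.-1) => x : 'rV[R]_n) (2 * h * 4 ^+ n) f).
- exact: measurable_chart_strip.
- exact: measurable_boundary.
- exact: measurable_chart_foot.
- exact: measurable_hausdorff_id.
- by rewrite !mulr_ge0 ?exprn_ge0// ltW.
- move=> A mA; apply: (le_hausdorff_tube e1 h0 n1) => //.
    apply: measurableI; last exact: measurable_chart_strip.
    by rewrite -[X in measurable X]setTI; exact: measurable_chart_foot.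
  move=> x [Ax Lx]; exists (chart_foot x); first by split => //; exact: chart_foot_boundary Lx.
  have [_ /andP[s0 sh]] := Lx; exists (s x); first by rewrite ltW.
  by rewrite /chart_foot addrK.
- exact: mf.
- exact: f0.
Qed.

(** Pointwise, w^2 <= 2 w(foot)^2 + 2 (w(foot) - w)^2. The first term contributes twice the constant
    2 h 4^n of the foot map. The squared increment is at most h times the integral of |grad w|^2
    along the segment, and integrating over [x] gives another factor [h]. *)
Lemma strip_estimate (h : R) (w : 'rV[R]_n -> R) : (1 < n)%N -> 0 < h < r / 2 -> smooth w ->
  (\int[leb]_(x in chart_strip (r / 2) h) (w x ^+ 2)%:E <=
   (4 * 4 ^+ n * h)%:E * \int[surface_measure R n]_(x in boundary Omega) (w x ^+ 2)%:E +
   (2 * h ^+ 2)%:E * \int[leb]_(x in chart_strip r h) (\sum_i pderiv i w x ^+ 2)%:E)%E.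
Proof.
move=> n1 hr sw; have /andP[h0 h2] := hr.
pose q x := \sum_i e ord0 i * pderiv i w x.
pose D x := \sum_i pderiv i w x ^+ 2.
have qD x : q x ^+ 2 <= D x.
  have := edot_le e (\row_i pderiv i w x); rewrite e1 mul1r => h1.
  rewrite (_ : D x = enorm (\row_i pderiv i w x) ^+ 2); last first.
    by rewrite enorm_sqr; apply: eq_bigr => i _; rewrite mxE expr2.
  have -> : q x = edot e (\row_i pderiv i w x).
    by apply: eq_bigr => i _; rewrite mxE.
  by rewrite -[leLHS]real_normK ?num_real// lerXn2r ?nnegrE ?enorm_ge0.
have sq : smooth q.
  apply: smooth_sum => i; apply: smoothM; [exact: smooth_cst|exact: smooth_pderiv].
have mD : measurable_fun setT D.
  apply: measurable_sum => i; apply: measurable_funX; apply: smooth_measurable.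
  exact: smooth_pderiv.
have D0 x : 0 <= D x by apply: sumr_ge0 => i _; exact: sqr_ge0.
have mw2 : measurable_fun setT (fun x => (w x ^+ 2)%:E).
  by apply/measurable_EFinP; apply: measurable_funX; exact: smooth_measurable.
pose G := (fun y => (D y)%:E) \_ (chart_strip r h).
have mG : measurable_fun setT G.
  apply/(measurable_restrictT _ (measurable_chart_strip _ _)).
  by apply: measurable_funTS; exact/measurable_EFinP.
have G0 x : (0 <= G x)%E by rewrite /G patchE; case: ifP => // _; rewrite lee_fin.
have [mI IE] := ge0_integral_segment e mG G0 (ltW h0).
set I := (fun x => _) in mI.
have I0 x : (0 <= I x)%E by apply: integral_ge0.
have wI x : chart_strip (r / 2) h x ->
    ((w x ^+ 2)%:E <= 2%:E * (w (chart_foot x) ^+ 2)%:E + (2 * h)%:E * I x)%E.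
  move=> Lx; have [_ /andP[s0 sh]] := Lx.
  have wd (t : R) : is_derive t 1 (fun t : R => w (t *: e + x)) (q (t *: e + x)).
    by apply: is_derive_line_at; exact: smooth_is_derive_dir.
  have cq : continuous (fun t : R => q (t *: e + x)).
    move=> t; apply: (@cvg_comp _ _ _ (fun t : R => t *: e + x) q _ (nbhs (t *: e + x))).
      by apply: cvgD; [apply: cvgZr_tmp; exact: cvg_id|exact: cvg_cst].
    exact: smooth_continuous sq _.
  have := sqr_increment_le s0 wd cq; rewrite scale0r add0r (addrC (_ *: e) x) -/(chart_foot x) => inc.
  have {}inc : (((w (chart_foot x) - w x) ^+ 2)%:E <= h%:E * I x)%E.
    apply: (le_trans inc); apply: (@le_trans _ _ ((s x)%:E * I x)%E); last by rewrite lee_wpmul2r// lee_fin.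
    rewrite lee_wpmul2l ?lee_fin ?(ltW s0)//.
    have mline : measurable_fun setT (fun t : measurableTypeR R => x + t *: e).
      apply: measurable_fun_rV => i; under eq_fun do rewrite !mxE.
      by apply: measurable_funD => //; exact: measurable_funM.
    have mq D' : measurable_fun D' (fun t : measurableTypeR R => (q (x + t *: e) ^+ 2)%:E).
      apply: measurable_funTS; apply/measurable_EFinP; apply: measurable_funX.
      exact: (measurableT_comp (smooth_measurable sq) mline).
    under eq_integral do rewrite addrC.
    (* At t = s x the point is the foot, which is outside the strip, so [G] vanishes there; the end
       point is dropped first. *)
    rewrite -integral_itv_bndo_bndc; last exact: mq.
    apply: (@le_trans _ _ (\int[lebesgue_measure]_(t in `[0%R, s x[) G (x + t *: e)%R)%E).
      apply: ge0_le_integral.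
      - exact: measurable_itv.
      - by move=> t _; rewrite lee_fin sqr_ge0.
      - exact: mq.
      - by apply: measurable_funTS; exact: (measurableT_comp mG mline).
      - move=> t; rewrite /= in_itv/= => ts.
        by rewrite /G patchE ifT ?lee_fin//; apply/mem_set; exact: (chart_stripD h2 Lx ts).
    apply: ge0_subset_integral => //.
      by apply: measurable_funTS; exact: (measurableT_comp mG mline).
    by move=> t; rewrite /= !in_itv/= => /andP[-> /ltW ts]; exact: le_trans ts sh.
  apply: (@le_trans _ _ (2 * w (chart_foot x) ^+ 2 + 2 * (w (chart_foot x) - w x) ^+ 2)%:E).
    rewrite lee_fin; have := sqr_ge0 (2 * w (chart_foot x) - w x); rewrite !expr2; lra.
  by rewrite EFinD EFinM leeD2l// (EFinM 2 h) EFinM -muleA lee_wpmul2l.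
apply: (@le_trans _ _ (\int[leb]_(x in chart_strip (r / 2) h)
    (2%:E * (w (chart_foot x) ^+ 2)%:E + (2 * h)%:E * I x))%E).
  apply: ge0_le_integral => //; [exact: measurable_chart_strip| | | ].
  - by move=> x _; rewrite lee_fin sqr_ge0.
  - exact: measurable_funTS.
  - apply: measurable_funTS; apply: emeasurable_funD; apply: emeasurable_funM => //.
    exact: (measurableT_comp mw2 measurable_chart_foot).
rewrite ge0_integralD//; first last.
- by apply: measurable_funTS; apply: emeasurable_funM.
- by move=> x _; rewrite mule_ge0// lee_fin mulr_ge0// ltW.
- apply: measurable_funTS; apply: emeasurable_funM => //.
  exact: (measurableT_comp mw2 measurable_chart_foot).
- by move=> x _; rewrite mule_ge0// lee_fin sqr_ge0.
- exact: measurable_chart_strip.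
apply: leeD.
  rewrite ge0_integralZl//; last 3 first.
  - exact: measurable_chart_strip.
  - by apply: measurable_funTS; exact: (measurableT_comp mw2 measurable_chart_foot).
  - by move=> x _; rewrite lee_fin sqr_ge0.
  rewrite (_ : (4 * 4 ^+ n * h)%:E = 2%:E * (2 * h * 4 ^+ n)%:E)%E; last first.
    by rewrite -EFinM; congr EFin; ring.
  rewrite -muleA lee_wpmul2l//.
  apply: (le_integral_foot (f := fun x => (w x ^+ 2)%:E) n1 hr mw2) => x.
  by rewrite lee_fin sqr_ge0.
rewrite ge0_integralZl//; last 3 first.
- exact: measurable_chart_strip.
- exact: measurable_funTS.
- by rewrite lee_fin mulr_ge0// ltW.
rewrite (_ : (2 * h ^+ 2)%:E = (2 * h)%:E * h%:E)%E; last first.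
  by rewrite -EFinM; congr EFin; ring.
rewrite -muleA lee_wpmul2l//; first by rewrite lee_fin mulr_ge0// ltW.
rewrite [X in (_ <= _ * X)%E]integral_mkcond -/G -IE.
by apply: ge0_subset_integral => //; exact: measurable_chart_strip.
Qed.

End chart.

(** If [P K] failed, the sets whose complement in [K] satisfies [P] would form a proper filter
    containing [K]; the local property at a cluster point contradicts this. *)
Lemma compact_local_property (T : topologicalType) (K : set T) (P : set T -> Prop) :
  compact K -> P set0 -> (forall A B, P A -> P B -> P (A `|` B)) ->
  (forall A B, A `<=` B -> P B -> P A) ->
  (forall x, K x -> exists2 U, nbhs x U & P U) -> P K.
Proof.
move=> cK P0 PU PS Ploc; apply: contrapT => nPK.
pose F := [set A | P (K `\` A)].
have FF : Filter F.
  split.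
  - by rewrite /F/= setDT.
  - by move=> A B FA FB; rewrite /F/= setDIr; exact: PU.
  - by move=> A B AB; apply: PS => x [Kx nBx]; split => // /AB.
have pF : ProperFilter F by split => //; rewrite /F/= setD0.
have FK : F K by rewrite /F/= setDv.
have [x [Kx]] := cK F pF FK; rewrite clusterE => clx.
have [U Ux PUx] := Ploc x Kx.
have FU : F (~` U) by apply: PS PUx => y [_ /contrapT].
by have [y [nUy Uy]] := clx _ FU _ Ux.
Qed.

(** * The layer along the whole boundary, by compactness *)

Section boundary_layer.
Variables (R : realType) (n : nat) (Omega : set 'rV[R]_n).
Hypotheses (n1 : (1 < n)%N) (oO : open Omega) (bO : bounded_set Omega).
Local Notation leb := (lebesgue_rV R n).
Local Notation sigma := (surface_measure R n).

(** The cutoff of scale delta is 1 where the 2 delta-neighbourhood lies in [Omega]. The third delta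
    makes it 1 on a whole neighbourhood of each point of [Omega] outside the layer, so that its
    derivatives vanish there too. *)
Definition boundary_layer (delta : R) : set 'rV[R]_n :=
  [set x | Omega x /\ exists2 y, ~ Omega y & `|y - x| <= 3 * delta].

Definition layer_estimate (C delta : R) (T E : set 'rV[R]_n) : Prop :=
  forall w : 'rV[R]_n -> R, smooth w ->
  (\int[leb]_(x in T) (w x ^+ 2)%:E <=
   (C * delta)%:E * \int[sigma]_(x in boundary Omega) (w x ^+ 2)%:E +
   (C * delta ^+ 2)%:E * \int[leb]_(x in E) (\sum_i pderiv i w x ^+ 2)%:E)%E.

(* In charts, T d and E d are the strips of height O(d) below the boundary in the half-size and in the
   full-size ball; hence E d shrinks to the empty set with d. *)
Definition layer_controlled (B : set 'rV[R]_n) : Prop :=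
  exists C delta0 (T E : R -> set 'rV[R]_n),
  [/\ 0 <= C /\ 0 < delta0,
    forall d, [/\ measurable (T d), measurable (E d), T d `<=` E d & E d `<=` Omega],
    forall d d', d <= d' -> E d `<=` E d',
    forall x, exists2 d, 0 < d & ~ E d x &
    forall d, 0 < d < delta0 ->
      boundary_layer d `&` B `<=` T d /\ layer_estimate C d (T d) (E d)].

Lemma layer_controlled0 : layer_controlled set0.
Proof.
exists 0, 1, (fun=> set0), (fun=> set0); split => //.
- by move=> _; split.
- by move=> *; exact: subset_refl.
- by move=> x; exists 1.
- move=> d d0; split; first by rewrite setI0.
  by move=> w sw; rewrite !integral_set0 !mul0r !mul0e adde0.
Qed.

Lemma layer_controlledS A B : A `<=` B -> layer_controlled B -> layer_controlled A.
Proof.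
move=> AB [C [d0 [T [E [C0 mTE Ei E0 H]]]]]; exists C, d0, T, E; split => // d hd.
by have [sub est] := H d hd; split => // x [lx Ax]; apply: sub; split => //; exact: AB.
Qed.

Lemma layer_controlledU A B : layer_controlled A -> layer_controlled B ->
  layer_controlled (A `|` B).
Proof.
move=> [C1 [d1 [T1 [E1 [[C10 d10] m1 i1 z1 H1]]]]] [C2 [d2 [T2 [E2 [[C20 d20] m2 i2 z2 H2]]]]].
exists (C1 + C2), (Num.min d1 d2), (fun d => T1 d `|` T2 d), (fun d => E1 d `|` E2 d); split.
- by rewrite addr_ge0// lt_min d10 d20.
- move=> d; have [a1 b1 c1 e1] := m1 d; have [a2 b2 c2 e2] := m2 d; split.
  + exact: measurableU.
  + exact: measurableU.
  + exact: setUSS.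
  + by rewrite subUset.
- by move=> d d' dd'; apply: setUSS; [exact: i1|exact: i2].
- move=> x; have [t1 t10 n1x] := z1 x; have [t2 t20 n2x] := z2 x.
  exists (Num.min t1 t2); first by rewrite lt_min t10 t20.
  by case=> h; [apply: n1x; apply: i1 h|apply: n2x; apply: i2 h]; rewrite ge_min lexx ?orbT.
- move=> d; rewrite lt_min => /andP[dgt0 /andP[dd1 dd2]].
  have d0 := ltW dgt0; have [|s1 h1] := H1 d; first by rewrite dgt0.
  have [|s2 h2] := H2 d; first by rewrite dgt0.
  have [a1 b1 c1 e1] := m1 d; have [a2 b2 c2 e2] := m2 d.
  split; first by rewrite setIUr; apply: setUSS.
  move=> w sw.
  have mw2 : measurable_fun setT (fun x => (w x ^+ 2)%:E).
    by apply/measurable_EFinP; apply: measurable_funX; exact: smooth_measurable.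
  have mD D : measurable_fun D (fun x => (\sum_i pderiv i w x ^+ 2)%:E).
    apply/measurable_EFinP; apply: measurable_sum => i; apply: measurable_funX.
    by apply: smooth_measurable; exact: smooth_pderiv.
  have D0 x : (0 <= (\sum_i pderiv i w x ^+ 2)%:E)%E.
    by rewrite lee_fin sumr_ge0// => i _; exact: sqr_ge0.
  have w0 x : (0 <= (w x ^+ 2)%:E)%E by rewrite lee_fin sqr_ge0.
  apply: (le_trans (ge0_le_integral_setU _ a1 a2 mw2 w0)).
  apply: (le_trans (leeD (h1 w sw) (h2 w sw))).
  rewrite addeACA mulrDl EFinD (ge0_muleDl _ (y := (C1 * d)%:E)) ?lee_fin ?mulr_ge0//.
  rewrite leeD2l// mulrDl EFinD (ge0_muleDl _ (y := (C1 * d ^+ 2)%:E)) ?lee_fin ?mulr_ge0 ?sqr_ge0//.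
  by apply: leeD; (rewrite lee_wpmul2l ?lee_fin ?mulr_ge0 ?sqr_ge0//);
    apply: ge0_subset_integral => //; exact: measurableU.
Qed.

Lemma layer_controlled_interior z : Omega z ->
  exists2 U, nbhs z U & layer_controlled U.
Proof.
move=> Oz; have /nbhs_ballP[rho /= rho0 hrho] : nbhs z Omega by exact: open_nbhs_nbhs.
exists (ball z (rho / 2)); first by apply: nbhsx_ballx; rewrite divr_gt0.
(* For 3 d < rho / 2 the layer does not meet the ball of radius rho / 2, so empty sets serve. *)
exists 0, (rho / 6), (fun=> set0), (fun=> set0); split => //.
- by rewrite divr_gt0.
- by move=> _; split.
- by move=> *; exact: subset_refl.
- by move=> x; exists 1.
- move=> d /andP[d0 drho]; split.
    move=> x [[Ox [y nOy yx]]]; rewrite -ball_normE/= => zx.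
    apply: nOy; apply: hrho; rewrite -ball_normE/= (_ : z - y = (z - x) - (y - x)).
      by rewrite (le_lt_trans (ler_normB _ _))//; lra.
    by rewrite opprB addrA subrK.
  by move=> w sw; rewrite !integral_set0 !mul0r !mul0e adde0.
Qed.

Lemma layer_controlled_boundary z : lipschitz_boundary Omega -> boundary Omega z ->
  exists2 U, nbhs z U & layer_controlled U.
Proof.
move=> lO /lO[e [g [r [e1 [L gL] r0 gO]]]].
have n0 : 0 < n%:R :> R by rewrite ltr0n ltnW.
(* The height changes by at most [M] times the distance in the maximum norm. A layer point is within
   3 d of a point of height at most 0, so its own height is at most 3 M d = K d. *)
pose M := (2 * `|L| + 1) * n%:R.
have M1 : n%:R <= M.
  by rewrite ler_peMl ?(ltW n0)// lerDr mulr_ge0.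
have M0 : 0 < M by exact: lt_le_trans M1.
pose K := 3 * M.
have K0 : 0 < K by rewrite mulr_gt0.
exists [set x | enorm (x - z) < r / 2].
  have c := @enorm_dist_continuous R n z z.
  have : \forall x \near z, enorm (x - z) < r / 2.
    apply: (c [set t | t < r / 2]); apply: open_nbhs_nbhs; split; first exact: open_lt.
    by rewrite /= subrr -(scale0r 0) enormZ normr0 mul0r divr_gt0.
  by [].
(* The sum of the two coefficients of [strip_estimate] at h = K d, without their powers of [d]; the
   range of [d] keeps K d below r / 2. *)
exists (4 * 4 ^+ n * K + 2 * K ^+ 2), (r / 2 / K),
  (fun d => chart_strip z e g (r / 2) (K * d)), (fun d => chart_strip z e g r (K * d)).
split.
- by split; [rewrite addr_ge0 ?mulr_ge0 ?exprn_ge0 ?sqr_ge0 ?(ltW K0)|rewrite !divr_gt0].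
- move=> d; split.
  + exact: measurable_chart_strip.
  + exact: measurable_chart_strip.
  + by move=> x [xr xs]; split => //; apply: lt_trans xr _; lra.
  + exact: chart_strip_sub.
- move=> d d' dd' x [xr /andP[s0 sd]]; split => //; rewrite s0/= (le_trans sd)//.
  by rewrite ler_pM2l.
- move=> x; have [s0|s0] := leP (chart_height e g x) 0.
    by exists 1 => // -[_ /andP[]]; rewrite ltNge s0.
  exists (chart_height e g x / 2 / K); first by rewrite !divr_gt0.
  by move=> [_ /andP[_]]; rewrite mulrC divfK ?gt_eqF//; lra.
- move=> d /andP[d0 dr]; rewrite ltr_pdivlMr// mulrC in dr.
  have Kd : 0 < K * d < r / 2 by rewrite dr mulr_gt0.
  split.
    move=> x [[Ox [y nOy yx]] /= xz].
    have yx' : enorm (y - x) <= n%:R * (3 * d).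
      by apply: (le_trans (enorm_le_normr _)); rewrite ler_wpM2l// ltW.
    have yxr : enorm (y - x) < r / 2.
      apply: (le_lt_trans yx'); apply: le_lt_trans dr.
      by rewrite /K [3 * M]mulrC -mulrA ler_wpM2r// mulr_ge0// ltW.
    have yz : enorm (y - z) < r.
      rewrite (_ : y - z = (y - x) + (x - z)); last by rewrite addrA subrK.
      rewrite (le_lt_trans (ler_enormD _ _))//; lra.
    have xz' : enorm (x - z) < r by lra.
    have sx := (chart_height_gt0 gO xz').1 Ox.
    have sy : chart_height e g y <= 0.
      by rewrite leNgt; apply/negP => /(chart_height_gt0 gO yz).2.
    split => //; rewrite sx/=.
    have := chart_height_lipschitz e1 gL y x; rewrite distrC => /(le_trans (ler_norm _)) h1.
    have : (2 * `|L| + 1) * enorm (y - x) <= K * d.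
      rewrite (_ : K * d = (2 * `|L| + 1) * (n%:R * (3 * d))); last by rewrite /K /M; ring.
      by rewrite ler_wpM2l// addr_ge0// mulr_ge0.
    lra.
  move=> w sw; apply: (le_trans (strip_estimate e1 gL gO n1 Kd sw)).
  apply: leeD.
    apply: lee_wpmul2r; first by apply: integral_ge0 => x _; rewrite lee_fin sqr_ge0.
    rewrite lee_fin mulrA ler_wpM2r ?(ltW d0)// lerDl mulr_ge0 ?sqr_ge0//.
  apply: lee_wpmul2r.
    by apply: integral_ge0 => x _; rewrite lee_fin sumr_ge0// => i _; exact: sqr_ge0.
  rewrite lee_fin exprMn mulrA ler_wpM2r ?sqr_ge0// lerDr !mulr_ge0 ?exprn_ge0 ?(ltW K0)//.
Qed.

Lemma layer_controlled_closure : lipschitz_boundary Omega -> layer_controlled (closure Omega).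
Proof.
move=> lO; apply: compact_local_property.
- have [M M0 hM] := bounded_norm bO.
  have cc := @compact_cube R n (\row_(i < n) (- M)) (M + M).
  apply: (subclosed_compact _ cc); first exact: closed_closure.
  have /closure_id -> : closed (cube (\row_(i < n) (- M)) (M + M)).
    by apply: compact_closed cc; exact: norm_hausdorff.
  apply: closureS => x Ox i; rewrite mxE; have := le_trans (normr_rV_le x i) (hM x Ox).
  by rewrite ler_norml; lra.
- exact: layer_controlled0.
- exact: layer_controlledU.
- exact: layer_controlledS.
- move=> z cz; have [Oz|nOz] := pselect (Omega z); first exact: layer_controlled_interior.
  by apply: layer_controlled_boundary => //; split => // /interior_subset.
Qed.

End boundary_layer.

(** Dominated convergence along t = 1/(m+1): every point eventually leaves [E t], and [f] itself
    dominates. *)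
Lemma small_integral d (T : measurableType d) (R : realType) (mu : {measure set T -> \bar R})
    (D : set T) (f : T -> R) (E : R -> set T) : measurable D ->
  mu.-integrable D (EFin \o f) -> (forall x, 0 <= f x) ->
  (forall t, measurable (E t)) -> (forall t, E t `<=` D) ->
  (forall t t', t <= t' -> E t `<=` E t') -> (forall x, exists2 t, 0 < t & ~ E t x) ->
  forall eps : R, 0 < eps -> exists2 t0, 0 < t0 &
    forall t, t <= t0 -> (\int[mu]_(x in E t) (f x)%:E <= eps%:E)%E.
Proof.
move=> mD intf f0 mE ED homoE vanE eps eps0.
pose a (m : nat) : R := m.+1%:R^-1.
have mf : measurable_fun D (EFin \o f) by exact: measurable_int intf.
pose F m := (fun x => (f x)%:E) \_ (E (a m)).
have FE m : (\int[mu]_(x in E (a m)) (f x)%:E = \int[mu]_(x in D) F m x)%E.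
  by rewrite /F -integral_mkcondr setIC setIidl.
have : (\int[mu]_(x in D) F m x @[m --> \oo] --> \int[mu]_(x in D) cst 0 x)%E.
  apply: (dominated_cvg mD (g := EFin \o f)) => //.
  - move=> m; apply/(measurable_restrict _ (mE _) mD).
    by apply: measurable_funS mf => // x [].
  - move=> x Dx; apply: cvg_near_cst; have [t t0 nEx] := vanE x.
    have : \forall k \near \oo, a k < t by exact: (near_infty_natSinv_lt (PosNum t0)).
    apply: filterS => k akt; rewrite /F patchE ifF//; apply/negbTE/negP => /set_mem.
    by move/(homoE _ _ (ltW akt)).
  - move=> m x Dx; rewrite /F patchE; case: ifP => _; last by rewrite abse0 lee_fin.
    by rewrite /= ger0_norm.
rewrite integral0 => /fine_cvgP[finF /cvgrPdist_le /(_ _ eps0) H].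
have [m _ /(_ m (leqnn m))[h1 h2]] := filterI finF H.
exists (a m); first by rewrite invr_gt0.
move=> t tm; apply: (@le_trans _ _ (\int[mu]_(x in E (a m)) (f x)%:E)%E).
  apply: ge0_subset_integral => //; [|by move=> x _; rewrite lee_fin|exact: homoE].
  exact: measurable_funS (ED _) mf.
rewrite FE -(fineK h1) lee_fin; move: h2; rewrite /= sub0r normrN; exact/le_trans/ler_norm.
Qed.

(** * Functions with equal traces differ by an element of H^1_0 *)

Section zero_trace.
Variables (R : realType) (n : nat) (Omega : set 'rV[R]_n).
Hypotheses (n1 : (1 < n)%N) (oO : open Omega) (bO : bounded_set Omega).
Hypothesis lO : lipschitz_boundary Omega.
Local Notation leb := (lebesgue_rV R n).
Local Notation sigma := (surface_measure R n).
Local Notation fct := ('rV[R]_n -> R).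
Let mO : measurable Omega := open_measurable_rV oO.

Lemma int_mul_sqrE (f : fct) : L2 Omega f ->
  (int_mul Omega f f)%:E = (\int[leb]_(x in Omega) (f x ^+ 2)%:E)%E.
Proof.
move=> Lf; have int_f := L2_integrable mO Lf Lf.
rewrite /int_mul /Rintegral fineK ?integrable_fin_num//.
Qed.

Lemma H1sqr_smoothE (f : fct) : smooth f ->
  (H1sqr Omega f)%:E = (\int[leb]_(x in Omega) (f x ^+ 2 + \sum_i pderiv i f x ^+ 2)%:E)%E.
Proof.
move=> sf; have Lf := smooth_L2 oO bO sf.
have LDf i := smooth_L2 oO bO (smooth_pderiv i sf).
have msq (g : fct) : smooth g -> measurable_fun Omega (fun x => (g x ^+ 2)%:E).
  by move=> sg; apply/measurable_EFinP; apply: measurable_funX; exact: smooth_measurable.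
rewrite /H1sqr EFinD int_mul_sqrE//.
under [RHS]eq_integral do rewrite EFinD.
rewrite ge0_integralD//; last 4 first.
- by move=> x _; rewrite lee_fin sqr_ge0.
- exact: msq.
- move=> x _; rewrite lee_fin sumr_ge0// => i _; exact: sqr_ge0.
- apply/measurable_EFinP; apply: measurable_sum => i.
  by apply: measurable_funX; apply: smooth_measurable; exact: smooth_pderiv.
congr (_ + _)%E.
under [RHS]eq_integral do rewrite -sumEFin.
rewrite ge0_integral_sum//; last 2 first.
- by move=> i; apply: msq; exact: smooth_pderiv.
- by move=> i x _; rewrite lee_fin sqr_ge0.
rewrite -sumEFin; apply: eq_bigr => i _; rewrite -int_mul_sqrE//; congr EFin.
rewrite (int_weak_smooth oO bO i sf) ?(int_mulC _ (pderiv i f))//; last first.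
  by apply: weak_pderiv_L2; exact: smooth_H1.
exact: int_weak_smooth.
Qed.

(** [f] is (1 - chi) w. Each derivative contributes at most twice the squares of (1 - chi) d_i w and
    of w d_i chi; delta <= 1 lets the zeroth-order term be absorbed into the delta^-2 term. *)
Lemma cutoff_smooth_sqr (chi w f : fct) (C delta : R) (x : 'rV[R]_n) :
  smooth chi -> smooth w -> 0 < delta <= 1 -> 0 <= C ->
  `|chi x| <= C -> (forall i, `|pderiv i chi x| <= C / delta) ->
  f = (fun y => (-1) * (w y * chi y) + w y) ->
  f x ^+ 2 + \sum_i pderiv i f x ^+ 2 <=
  (2 + 2 * n%:R) * (1 + C) ^+ 2 / delta ^+ 2 * w x ^+ 2 +
  (2 + 2 * n%:R) * (1 + C) ^+ 2 * \sum_i pderiv i w x ^+ 2.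
Proof.
move=> sc sw /andP[d0 d1] C0 cC dC fdef.
have pf i : pderiv i f x = (1 - chi x) * pderiv i w x - w x * pderiv i chi x.
  rewrite fdef pderivD; [|exact: smoothM (smooth_cst _) (smoothM sw sc)|exact: sw].
  rewrite pderivM; [|exact: smooth_cst|exact: smoothM].
  by rewrite pderiv_cst pderivM//; ring.
have fE : f x = (1 - chi x) * w x by rewrite fdef; ring.
have h1 : (1 - chi x) ^+ 2 <= (1 + C) ^+ 2.
  rewrite -real_normK ?num_real// lerXn2r ?nnegrE ?addr_ge0//.
  by rewrite (le_trans (ler_normB _ _))// normr1 lerD2l.
have h2 i : pderiv i chi x ^+ 2 <= (1 + C) ^+ 2 / delta ^+ 2.
  rewrite -real_normK ?num_real// -expr_div_n lerXn2r ?nnegrE ?divr_ge0 ?addr_ge0 ?(ltW d0)//.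
  by rewrite (le_trans (dC i))// ler_wpM2r ?invr_ge0 ?(ltW d0)// lerDr.
have h3 : 1 <= (delta ^+ 2)^-1.
  by rewrite invf_ge1 ?exprn_gt0// exprn_ile1// ltW.
set A := (1 + C) ^+ 2 in h1 h2 *; have A0 : 0 <= A by exact: sqr_ge0.
set b := (delta ^+ 2)^-1 in h2 h3 *; set W := w x ^+ 2; have W0 : 0 <= W by exact: sqr_ge0.
set S := \sum_i pderiv i w x ^+ 2.
have S0 : 0 <= S by apply: sumr_ge0 => i _; exact: sqr_ge0.
have hsum : \sum_i pderiv i f x ^+ 2 <= 2 * A * S + 2 * n%:R * (A * b * W).
  rewrite (_ : 2 * n%:R * (A * b * W) = \sum_(i < n) 2 * (A * b * W)); last first.
    by rewrite sumr_const card_ord -[RHS]mulr_natl; ring.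
  rewrite /S mulr_sumr -big_split/=; apply: ler_sum => i _.
  rewrite pf; have := sqr_ge0 ((1 - chi x) * pderiv i w x + w x * pderiv i chi x).
  have e1 : (1 - chi x) ^+ 2 * pderiv i w x ^+ 2 <= A * pderiv i w x ^+ 2.
    by rewrite ler_wpM2r// sqr_ge0.
  have e2 : pderiv i chi x ^+ 2 * W <= A * b * W by rewrite ler_wpM2r.
  move: e1 e2; rewrite /W; move: (chi x) (pderiv i w x) (w x) (pderiv i chi x) => c p y z.
  rewrite sqrrD sqrrB !exprMn; lra.
have hf : f x ^+ 2 <= A * b * W.
  rewrite fE exprMn ler_wpM2r//; apply: (le_trans h1).
  by rewrite ler_peMr.
have b0 : 0 <= b by exact: le_trans ler01 h3.
have hn : 0 <= A * b * W by rewrite mulr_ge0// mulr_ge0.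
have hm : 0 <= n%:R * (A * S) by rewrite mulr_ge0// mulr_ge0.
have hs := mulr_ge0 A0 S0.
rewrite (_ : (2 + 2 * n%:R) * A * b * W = 2 * (A * b * W) + 2 * n%:R * (A * b * W)); last by ring.
rewrite (_ : (2 + 2 * n%:R) * A * S = 2 * A * S + 2 * (n%:R * (A * S))); last by ring.
lra.
Qed.

(** The strip is fixed before the approximant [w], so smallness of grad w on it has to be inherited
    from the fixed function [d], up to the H1 distance. *)
Lemma integral_pderiv_sqr_le (w d : fct) (E : set 'rV[R]_n) : smooth w -> H1 Omega d ->
  measurable E -> E `<=` Omega ->
  (\int[leb]_(x in E) (\sum_i pderiv i w x ^+ 2)%:E <=
   2%:E * \int[leb]_(x in E) (\sum_i weak_pderiv Omega i d x ^+ 2)%:E +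
   (2 * H1sqr Omega (fun x => w x - d x))%:E)%E.
Proof.
move=> sw Hd mE EO.
have mpd D i : measurable_fun D (pderiv i w) by apply: smooth_measurable; exact: smooth_pderiv.
have Lg i : L2 Omega (fun x => pderiv i w x - weak_pderiv Omega i d x).
  by apply: L2B => //; [apply: smooth_L2 => //; exact: smooth_pderiv|exact: weak_pderiv_L2].
have mg i : measurable_fun Omega (fun x => pderiv i w x - weak_pderiv Omega i d x).
  by have [] := Lg i.
have mD i : measurable_fun Omega (weak_pderiv Omega i d) by have [] := weak_pderiv_L2 i Hd.
pose Sw x := \sum_i pderiv i w x ^+ 2.
pose Sd x := \sum_i weak_pderiv Omega i d x ^+ 2.
pose Sg x := \sum_i (pderiv i w x - weak_pderiv Omega i d x) ^+ 2.
have Sw0 x : (0 <= (Sw x)%:E)%E by rewrite lee_fin sumr_ge0// => i _; exact: sqr_ge0.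
have Sd0 x : (0 <= (Sd x)%:E)%E by rewrite lee_fin sumr_ge0// => i _; exact: sqr_ge0.
have Sg0 x : (0 <= (Sg x)%:E)%E by rewrite lee_fin sumr_ge0// => i _; exact: sqr_ge0.
have mSw : measurable_fun E (EFin \o Sw).
  by apply/measurable_EFinP; apply: measurable_sum => i; exact: measurable_funX.
have mSd : measurable_fun E (EFin \o Sd).
  apply: measurable_funS EO _ => //; apply/measurable_EFinP.
  by apply: measurable_sum => i; exact: measurable_funX.
have mSg' : measurable_fun Omega (EFin \o Sg).
  by apply/measurable_EFinP; apply: measurable_sum => i; exact: measurable_funX.
have mSg : measurable_fun E (EFin \o Sg) by exact: measurable_funS EO mSg'.
have HwE : (\int[leb]_(x in Omega) (\sum_i (pderiv i w x - weak_pderiv Omega i d x) ^+ 2)%:E <=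
    (H1sqr Omega (fun x => w x - d x))%:E)%E.
  under eq_integral do rewrite -sumEFin.
  rewrite ge0_integral_sum//; last 2 first.
  - by move=> i; apply/measurable_EFinP; exact: measurable_funX.
  - by move=> i x _; rewrite lee_fin sqr_ge0.
  under eq_bigr do rewrite -int_mul_sqrE//.
  rewrite sumEFin lee_fin /H1sqr -[leLHS]add0r lerD ?int_mul_ge0//.
  apply: ler_sum => i _; rewrite le_eqVlt; apply/orP; left; apply/eqP.
  have Hw := smooth_H1 oO bO sw; have Hwd := H1B oO bO Hw Hd.
  have is_wd : is_weak_pderiv Omega i (fun x => w x - d x)
      (fun x => pderiv i w x - weak_pderiv Omega i d x).
    have := is_weak_pderiv_lin oO bO (-1) (H1_L2 Hd) (H1_L2 Hw) (weak_pderivP i Hd)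
      (smooth_is_weak_pderiv oO bO i sw).
    by congr (is_weak_pderiv _ _ _ _); apply/funext => x; ring.
  have U v := is_weak_pderiv_unique oO bO (w := v) (weak_pderivP i Hwd) is_wd.
  rewrite (U _ (weak_pderiv_L2 i Hwd)) (int_mulC _ (fun x => pderiv i w x - _)).
  by rewrite (U _ (Lg i)).
apply: (@le_trans _ _ (\int[leb]_(x in E) (2%:E * (Sd x)%:E + 2%:E * (Sg x)%:E))%E).
  apply: ge0_le_integral => //.
  - by move=> x _; exact: Sw0.
  - by apply: emeasurable_funD; exact: emeasurable_funM.
  - move=> x _; rewrite -!EFinM -EFinD lee_fin !mulr_sumr -big_split/=.
    apply: ler_sum => i _.
    have := sqr_ge0 (pderiv i w x - 2 * weak_pderiv Omega i d x).
    move: (pderiv i w x) (weak_pderiv Omega i d x) => a b; rewrite !expr2; lra.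
rewrite ge0_integralD//; last 4 first.
- by move=> x _; rewrite mule_ge0.
- exact: emeasurable_funM.
- by move=> x _; rewrite mule_ge0.
- exact: emeasurable_funM.
rewrite !ge0_integralZl// leeD2l// EFinM lee_wpmul2l//; apply: le_trans HwE.
exact: ge0_subset_integral.
Qed.

Lemma H10_of_vanishing_boundary (d : fct) : H1 Omega d ->
  (forall eta : R, 0 < eta -> exists w : fct, [/\ smooth w,
     (\int[sigma]_(x in boundary Omega) (w x ^+ 2)%:E <= eta%:E)%E &
     H1sqr Omega (fun x => w x - d x) <= eta]) ->
  H10 Omega d.
Proof.
move=> Hd approx.
have [C1 [d0 [T [E [[C10 d00] mTE homoE vanE layer]]]]] := layer_controlled_closure n1 oO bO lO.
have [C C0 cut] := cutoff bO.
pose A : R := (2 + 2 * n%:R) * (1 + C) ^+ 2.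
have A0 : 0 <= A by rewrite mulr_ge0 ?sqr_ge0// addr_ge0// mulr_ge0.
pose f x := \sum_i weak_pderiv Omega i d x ^+ 2.
have f0 x : 0 <= f x by apply: sumr_ge0 => i _; exact: sqr_ge0.
have intf : leb.-integrable Omega (EFin \o f).
  rewrite (_ : EFin \o f = fun x => (\sum_i (weak_pderiv Omega i d x ^+ 2)%:E)%E); last first.
    by apply/funext => x; rewrite /f/= sumEFin.
  apply: integrable_sum => // i _; have LD := weak_pderiv_L2 i Hd.
  by have := L2_integrable mO LD LD; congr (_.-integrable _ _); apply/funext => x /=; rewrite expr2.
have key (eps : R) : 0 < eps -> exists2 phi, test_function Omega phi &
    H1sqr Omega (fun x => phi x - d x) <= eps.
  (* [K] collects the final constants in units of eta: twice the bound for (1 - chi) w, plus 2 for w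
     - d. *)
  move=> eps0; pose K := 2 * (A * C1 + A * (C1 + 1) * 4) + 2.
  have K0 : 0 < K by have := mulr_ge0 A0 C10; rewrite /K; lra.
  pose eta := eps / K; have eta0 : 0 < eta by rewrite divr_gt0.
  have [t0 t00 ht0] := small_integral mO intf f0 (fun t => let: And4 _ h _ _ := mTE t in h)
    (fun t => let: And4 _ _ _ h := mTE t in h) homoE vanE eta0.
  pose delta := Num.min (Num.min t0 (d0 / 2)) 1.
  have delta0 : 0 < delta by rewrite !lt_min t00 ltr01 divr_gt0.
  have delta1 : delta <= 1 by rewrite ge_min lexx orbT.
  have deltat : delta <= t0 by rewrite !ge_min lexx.
  have deltad : 0 < delta < d0.
    by rewrite delta0/= (@le_lt_trans _ _ (d0 / 2)) ?ge_min ?lexx ?orbT//; lra.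
  have [chi [tchi chiC dchiC chi1]] := cut _ delta0.
  (* The boundary integral, at most delta eta, meets the factor C1 delta of the layer estimate;
     together they cancel the delta^-2 of the cutoff. *)
  have [|w [sw wG wd]] := approx (delta * eta); first by rewrite mulr_gt0.
  have {}wd : H1sqr Omega (fun x => w x - d x) <= eta by rewrite (le_trans wd)// ger_pMl.
  have [sub /(_ w sw) est] := layer delta deltad.
  have [mT mE TE EO] := mTE delta.
  have schi : smooth chi by have [] := tchi.
  exists (fun x => w x * chi x); first exact: test_functionM.
  pose g := fun y => (-1) * (w y * chi y) + w y.
  have sg : smooth g := smoothD (smoothM (smooth_cst (-1)) (smoothM sw schi)) sw.
  have -> : (fun x => w x * chi x - d x) = (fun x => (-1) * g x + (w x - d x)).
    by apply/funext => x; rewrite /g; ring.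
  have Hwd := H1B oO bO (smooth_H1 oO bO sw) Hd.
  apply: (le_trans (H1sqr_lin oO bO _ (smooth_H1 oO bO sg) Hwd)).
  suff : H1sqr Omega g <= A * C1 * eta + A * (C1 + 1) * (4 * eta).
    move=> hg; rewrite sqrrN expr1n mulr1 (_ : eps = K * eta); last by rewrite mulrC divfK ?gt_eqF.
    have -> : K * eta = 2 * (A * C1 * eta + A * (C1 + 1) * (4 * eta)) + 2 * eta by rewrite /K; ring.
    by apply: lerD; rewrite ler_wpM2l.
  have ES : (\int[leb]_(x in E delta) (\sum_i pderiv i w x ^+ 2)%:E <= (4 * eta)%:E)%E.
    apply: (le_trans (integral_pderiv_sqr_le sw Hd mE EO)).
    apply: (@le_trans _ _ (2%:E * eta%:E + (2 * eta)%:E)%E).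
      apply: leeD; last by rewrite lee_fin ler_wpM2l.
      by rewrite lee_wpmul2l//; exact: ht0.
    by rewrite -EFinM -EFinD lee_fin; lra.
  have mw D : measurable_fun D (fun x => (w x ^+ 2)%:E).
    by apply/measurable_EFinP; apply: measurable_funX; exact: smooth_measurable.
  have mS D : measurable_fun D (fun x => (\sum_i pderiv i w x ^+ 2)%:E).
    apply/measurable_EFinP; apply: measurable_sum => i; apply: measurable_funX.
    by apply: smooth_measurable; exact: smooth_pderiv.
  have S0 x : (0 <= (\sum_i pderiv i w x ^+ 2)%:E)%E.
    by rewrite lee_fin sumr_ge0// => i _; exact: sqr_ge0.
  have w0 x : (0 <= (w x ^+ 2)%:E)%E by rewrite lee_fin sqr_ge0.
  have gT x : Omega x -> ~ T delta x -> g x ^+ 2 + \sum_i pderiv i g x ^+ 2 = 0.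
    move=> Ox nTx.
    have full z : `|z - x| <= 3 * delta -> Omega z.
      move=> zx; apply: contrapT => nOz; apply: nTx; apply: sub; split.
        by split => //; exists z.
      exact: subset_closure.
    have g0 : \forall z \near x, g z = 0.
      apply/nbhs_ballP; exists delta => //= z; rewrite -ball_normE/= distrC => zx.
      rewrite /g chi1; first by ring.
        by apply: full; lra.
      move=> y yz; apply: full; rewrite -(subrK z y) -addrA.
      by rewrite (le_trans (ler_normD _ _))//; lra.
    rewrite (nbhs_singleton g0) expr0n add0r big1// => i _.
    by rewrite pderiv_near0// expr0n.
  rewrite -lee_fin H1sqr_smoothE//.
  have Ad0 : 0 <= A / delta ^+ 2 by rewrite divr_ge0// sqr_ge0.
  apply: (@le_trans _ _ (\int[leb]_(x in T delta)
      ((A / delta ^+ 2)%:E * (w x ^+ 2)%:E + A%:E * (\sum_i pderiv i w x ^+ 2)%:E))%E).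
    have mh D : measurable_fun D (fun x => (g x ^+ 2 + \sum_i pderiv i g x ^+ 2)%:E).
      apply/measurable_EFinP; apply: measurable_funD.
        by apply: measurable_funX; exact: smooth_measurable.
      apply: measurable_sum => i; apply: measurable_funX.
      by apply: smooth_measurable; exact: smooth_pderiv.
    have h0 x : (0 <= (g x ^+ 2 + \sum_i pderiv i g x ^+ 2)%:E)%E.
      by rewrite lee_fin addr_ge0 ?sqr_ge0// sumr_ge0// => i _; exact: sqr_ge0.
    have TO : T delta `<=` Omega by exact: subset_trans EO.
    rewrite -[X in (\int[_]_(x in X) _ <= _)%E](setDUK TO).
    have mOT : measurable (Omega `\` T delta) by exact: measurableD.
    apply: (le_trans (ge0_le_integral_setU leb mT mOT (mh _) h0)).
    rewrite [X in (_ + X)%E]integral0_eq ?adde0; last by move=> x [Ox nTx]; rewrite gT.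
    apply: ge0_le_integral => //.
      by apply: emeasurable_funD; exact: emeasurable_funM.
    move=> x _; rewrite -!EFinM -EFinD lee_fin.
    by apply: (cutoff_smooth_sqr (chi := chi)) => //; [rewrite delta0 delta1|exact: ltW].
  rewrite ge0_integralD//; last 4 first.
  - by move=> x _; rewrite mule_ge0.
  - exact: emeasurable_funM.
  - by move=> x _; rewrite mule_ge0.
  - exact: emeasurable_funM.
  rewrite !ge0_integralZl//.
  have iE0 : (0 <= \int[leb]_(x in E delta) (\sum_i pderiv i w x ^+ 2)%:E)%E.
    by apply: integral_ge0.
  have h1 : (\int[leb]_(x in T delta) (\sum_i pderiv i w x ^+ 2)%:E <= (4 * eta)%:E)%E.
    by apply: le_trans ES; apply: ge0_subset_integral.
  have h2 : (\int[leb]_(x in T delta) (w x ^+ 2)%:E <=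
      (C1 * delta * (delta * eta) + C1 * delta ^+ 2 * (4 * eta))%:E)%E.
    apply: (le_trans est); rewrite EFinD (EFinM (C1 * delta)) (EFinM (C1 * delta ^+ 2)).
    by apply: leeD; apply: lee_wpmul2l => //; rewrite lee_fin mulr_ge0 ?sqr_ge0// ltW.
  apply: (@le_trans _ _ ((A / delta ^+ 2)%:E *
    (C1 * delta * (delta * eta) + C1 * delta ^+ 2 * (4 * eta))%:E + A%:E * (4 * eta)%:E)%E).
    by apply: leeD; rewrite lee_wpmul2l// lee_fin.
  rewrite -!EFinM -EFinD lee_fin le_eqVlt; apply/orP; left; apply/eqP.
  by field; rewrite gt_eqF.
split => //; have /choice[phi hphi] : forall m : nat, exists phi, test_function Omega phi /\
    H1sqr Omega (fun x => phi x - d x) <= m.+1%:R^-1.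
  by move=> m; have [|phi t le] := key m.+1%:R^-1; [rewrite invr_gt0|exists phi].
exists phi; split; first by move=> m; have [] := hphi m.
apply/H1norm_cvg0 => //.
  by move=> m; have [[s _] _] := hphi m; exact: smooth_H1.
apply: (@squeeze_cvgr _ _ _ _ (cst 0) (fun m => m.+1%:R^-1)); last 2 first.
- exact: cvg_cst.
- exact: cvg_harmonic.
by apply: nearW => m; rewrite H1sqr_ge0; have [] := hphi m.
Qed.

(** The boundary values [g] cancel in the difference of the two approximating sequences, which
    therefore tends to u - v in H1 and to 0 in L2 of the boundary. *)
Lemma H10_trace (u v g : fct) : is_trace Omega u g -> is_trace Omega v g ->
  H10 Omega (fun x => u x - v x).
Proof.
move=> [Hu [mg _] [w [sw wu wg]]] [Hv _ [z [sz zv zg]]].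
have mid := @measurable_hausdorff_id R n n.-1.
have mG := @measurable_boundary R n n.-1 Omega.
have msig (f : fct) D : smooth f ->
    measurable_fun (D : set (caratheodory_type (@hausdorff R n n.-1))) (f : _ -> R).
  move=> sf; apply: measurable_funTS; exact: (measurableT_comp (smooth_measurable sf) mid).
apply: H10_of_vanishing_boundary; first exact: H1B.
move=> eta eta0; have eta4 : 0 < eta / 4 by rewrite divr_gt0.
have le0 (x : R) : `|0 - x| <= eta / 4 -> x <= eta / 4.
  by rewrite sub0r normrN; exact/le_trans/ler_norm.
have Hw m := smooth_H1 oO bO (sw m); have Hz m := smooth_H1 oO bO (sz m).
have /cvgrPdist_le /(_ _ eta4) wu' := (H1norm_cvg0 oO bO Hw Hu).1 wu.
have /cvgrPdist_le /(_ _ eta4) zv' := (H1norm_cvg0 oO bO Hz Hv).1 zv.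
have /fine_cvgP[wf /cvgrPdist_le /(_ _ eta4) wg'] := wg.
have /fine_cvgP[zf /cvgrPdist_le /(_ _ eta4) zg'] := zg.
have [m _ /(_ m (leqnn m))[[h1 h2] [[wf1 wg1] [zf1 zg1]]]] :=
  filterI (filterI wu' zv') (filterI (filterI wf wg') (filterI zf zg')).
have sgw : smooth (fun x => w m x - z m x).
  have -> : (fun x => w m x - z m x) = (fun x => (-1) * z m x + w m x) by apply/funext => x; ring.
  by apply: smoothD => //; apply: smoothM => //; exact: smooth_cst.
exists (fun x => w m x - z m x); split => //.
- have mgw : measurable_fun (boundary Omega : set (caratheodory_type (@hausdorff R n n.-1)))
      (fun x : caratheodory_type (@hausdorff R n n.-1) => w m x - g x).
    by apply: measurable_funB => //; exact: msig.
  have mgz : measurable_fun (boundary Omega : set (caratheodory_type (@hausdorff R n n.-1)))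
      (fun x : caratheodory_type (@hausdorff R n n.-1) => z m x - g x).
    by apply: measurable_funB => //; exact: msig.
  have le_sqr := ge0_integral_sqrB sigma mG mgw mgz.
  apply: (@le_trans _ _ _ _ _ _ (le_trans le_sqr _)).
    rewrite le_eqVlt; apply/orP; left; apply/eqP; apply: eq_integral => x _.
    by congr ((_ ^+ 2)%:E); ring.
  rewrite -(fineK wf1) -(fineK zf1) -!EFinM -EFinD lee_fin.
  have wg2 := le0 _ wg1; have zg2 := le0 _ zg1.
  have -> : eta = 2 * (eta / 4) + 2 * (eta / 4) by field.
  by apply: lerD; rewrite ler_wpM2l.
- have -> : (fun x => w m x - z m x - (u x - v x)) =
      (fun x => (-1) * (z m x - v x) + (w m x - u x)) by apply/funext => x; ring.
  apply: (le_trans (H1sqr_lin oO bO _ (H1B oO bO (Hz m) Hv) (H1B oO bO (Hw m) Hu))).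
  have -> : eta = 2 * (-1) ^+ 2 * (eta / 4) + 2 * (eta / 4) by field.
  apply: lerD; apply: ler_wpM2l => //.
  - by rewrite mulr_ge0// sqr_ge0.
  - exact: le0 h2.
  - exact: le0 h1.
Qed.

End zero_trace.

(** * The expansion *)

Lemma le_sum_term (R : numDomainType) (J : finType) (F : J -> R) i :
  (forall j, 0 <= F j) -> F i <= \sum_j F j.
Proof. by move=> F0; rewrite (bigD1 i)//= lerDl sumr_ge0. Qed.

Section energy_estimate.
Variables (R : realType) (n : nat) (Omega : set 'rV[R]_n).
Hypotheses (oO : open Omega) (bO : bounded_set Omega).
Local Notation fct := ('rV[R]_n -> R).
Local Notation field := ('I_n -> 'rV[R]_n -> R).
Local Notation I := (int_mul Omega).
Local Notation D := (weak_pderiv Omega).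
Local Opaque weak_pderiv.
Let mO : measurable Omega := open_measurable_rV oO.

Lemma H1v_L2v (u : field) : H1v Omega u -> L2v Omega u.
Proof. by move=> Hu i; exact: H1_L2. Qed.

Lemma grad_L2v (p : fct) : H1 Omega p -> L2v Omega (grad Omega p).
Proof. by move=> Hp i; exact: weak_pderiv_L2. Qed.

Lemma int_grad_gradE (u phi : field) : H1v Omega u -> H1v Omega phi ->
  int_grad_grad Omega u phi = \sum_i \sum_j I (D i (u j)) (D i (phi j)).
Proof.
move=> Hu Hphi; rewrite /int_grad_grad pair_bigA/=.
rewrite -(@Rintegral_sum_mul R n Omega oO _ _ (fun p => D p.1 (u p.2)) (fun p => D p.1 (phi p.2))).
- by apply: eq_Rintegral => x _; rewrite pair_bigA.
- by move=> p; exact: weak_pderiv_L2.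
- by move=> p; exact: weak_pderiv_L2.
Qed.

Lemma int_divE (u : field) (psi : fct) : H1v Omega u -> L2 Omega psi ->
  I (div Omega u) psi = \sum_i I (D i (u i)) psi.
Proof. by move=> Hu Lpsi; apply: int_mul_suml => // i; exact: weak_pderiv_L2. Qed.

Lemma H1v_lin (a : R) (u v : field) : H1v Omega u -> H1v Omega v ->
  H1v Omega (a *: u + v).
Proof. by move=> Hu Hv i; exact: H1_lin. Qed.

Lemma int_grad_grad_lin (a : R) (u v phi : field) :
  H1v Omega u -> H1v Omega v -> H1v Omega phi ->
  int_grad_grad Omega (a *: u + v) phi =
  a * int_grad_grad Omega u phi + int_grad_grad Omega v phi.
Proof.
move=> Hu Hv Hphi; rewrite !int_grad_gradE//; last exact: H1v_lin.
rewrite mulr_sumr -big_split/=; apply: eq_bigr => i _.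
rewrite mulr_sumr -big_split/=; apply: eq_bigr => j _.
by apply: int_weak_lin => //; exact: weak_pderiv_L2.
Qed.

Lemma int_grad_lin (a : R) (p q : fct) (phi : field) :
  H1 Omega p -> H1 Omega q -> L2v Omega phi ->
  int_dot Omega (grad Omega (a *: p + q)) phi =
  a * int_dot Omega (grad Omega p) phi + int_dot Omega (grad Omega q) phi.
Proof.
move=> Hp Hq Lphi; rewrite !int_dotE//; last 3 first.
- exact: grad_L2v.
- exact: grad_L2v.
- by apply: grad_L2v; exact: H1_lin.
rewrite mulr_sumr -big_split/=; apply: eq_bigr => i _.
exact: int_weak_lin.
Qed.

Lemma int_div_lin (a : R) (u v : field) (psi : fct) :
  H1v Omega u -> H1v Omega v -> L2 Omega psi ->
  I (div Omega (a *: u + v)) psi = a * I (div Omega u) psi + I (div Omega v) psi.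
Proof.
move=> Hu Hv Lpsi; rewrite !int_divE//; last exact: H1v_lin.
rewrite mulr_sumr -big_split/=; apply: eq_bigr => i _.
exact: int_weak_lin.
Qed.

Lemma int_grad_H10v (r : fct) (w : field) : H1 Omega r -> H10v Omega w ->
  int_dot Omega (grad Omega r) w = - I (div Omega w) r.
Proof.
move=> Hr Hw; have Hw1 : H1v Omega w by move=> i; exact: H10_H1.
rewrite int_dotE//; [|exact: grad_L2v|exact: H1v_L2v].
rewrite int_divE//; last exact: H1_L2.
rewrite -sumrN; apply: eq_bigr => i _; rewrite (int_mulC _ _ r).
exact: int_weak_H10.
Qed.

Lemma L2normv_sqr (f : field) : L2v Omega f ->
  L2normv Omega f ^+ 2 = \sum_i L2norm Omega (f i) ^+ 2.
Proof.
move=> Lf; rewrite sqr_sqrtr int_dotE//; last first.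
  by apply: sumr_ge0 => i _; exact: int_mul_ge0.
by apply: eq_bigr => i _; rewrite L2norm_sqr.
Qed.

Lemma L2normv_ge0 (f : field) : 0 <= L2normv Omega f.
Proof. exact: sqrtr_ge0. Qed.

Lemma int_dot_sqr (f : field) : L2v Omega f -> int_dot Omega f f = L2normv Omega f ^+ 2.
Proof.
by move=> Lf; rewrite L2normv_sqr// int_dotE//; apply: eq_bigr => i _; rewrite L2norm_sqr.
Qed.

Lemma int_grad_grad_sqr (u : field) : H1v Omega u ->
  int_grad_grad Omega u u = \sum_i \sum_j L2norm Omega (D i (u j)) ^+ 2.
Proof.
by move=> Hu; rewrite int_grad_gradE//; apply: eq_bigr => i _; apply: eq_bigr => j _; rewrite L2norm_sqr.
Qed.

Lemma int_grad_grad_ge0 (u : field) : H1v Omega u -> 0 <= int_grad_grad Omega u u.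
Proof.
by move=> Hu; rewrite int_grad_grad_sqr//; do 2 (apply: sumr_ge0 => ? _); exact: sqr_ge0.
Qed.

Lemma H1norm_le (u : fct) (b : R) : H1 Omega u -> 0 <= b ->
  L2norm Omega u ^+ 2 + L2normv Omega (grad Omega u) ^+ 2 <= b ^+ 2 -> H1norm Omega u <= b.
Proof.
move=> Hu b0 h; rewrite -[leRHS]ger0_norm// -sqrtr_sqr; apply: ler_wsqrtr.
by rewrite int_dot_sqr -?L2norm_sqr//; exact: grad_L2v.
Qed.

Lemma H1normv_le (u : field) (b : R) : H1v Omega u -> 0 <= b ->
  L2normv Omega u ^+ 2 + int_grad_grad Omega u u <= b ^+ 2 -> H1normv Omega u <= b.
Proof.
move=> Hu b0 h; rewrite -[leRHS]ger0_norm// -sqrtr_sqr; apply: ler_wsqrtr.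
by rewrite int_dot_sqr//; exact: H1v_L2v.
Qed.

Local Opaque int_mul int_dot int_grad_grad L2norm L2normv H1norm H1normv.

Lemma L2norm_le_grad_grad (u : field) (Y : R) i j : H1v Omega u -> 0 <= Y ->
  int_grad_grad Omega u u = Y ^+ 2 -> L2norm Omega (D i (u j)) <= Y.
Proof.
move=> Hu Y0 YE; have sq0 k l : 0 <= L2norm Omega (D k (u l)) ^+ 2 by exact: sqr_ge0.
rewrite -ler_sqr; [|by rewrite nnegrE; exact: L2norm_ge0|exact: Y0].
rewrite -YE (int_grad_grad_sqr Hu).
apply: (@le_trans _ _ (\sum_l L2norm Omega (D i (u l)) ^+ 2)).
  exact: (le_sum_term (F := fun l => L2norm Omega (D i (u l)) ^+ 2)).
apply: (le_sum_term (F := fun k => \sum_l L2norm Omega (D k (u l)) ^+ 2)) => k.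
by apply: sumr_ge0 => l _; exact: sq0.
Qed.

Lemma L2norm_le_L2normv (f : field) i : L2v Omega f ->
  L2norm Omega (f i) <= L2normv Omega f.
Proof.
move=> Lf; rewrite -ler_sqr ?nnegrE ?L2norm_ge0 ?L2normv_ge0//.
rewrite L2normv_sqr// (bigD1 i)//= lerDl; apply: sumr_ge0 => j _; exact: sqr_ge0.
Qed.

(** The derivatives agree up to the factor [a] only after pairing, which suffices for the norms. *)
Lemma L2normv_grad_scale (phi psi : fct) (a : R) : H1 Omega phi -> H1 Omega psi ->
  (forall w i, L2 Omega w -> I (D i phi) w = a * I (D i psi) w) ->
  L2normv Omega (grad Omega phi) = `|a| * L2normv Omega (grad Omega psi).
Proof.
move=> Hphi Hpsi Da; have [La Lp] := (grad_L2v Hphi, grad_L2v Hpsi).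
have S i : L2norm Omega (D i phi) ^+ 2 = a ^+ 2 * L2norm Omega (D i psi) ^+ 2.
  have Lai : L2 Omega (D i phi) := La i; have Lpi : L2 Omega (D i psi) := Lp i.
  transitivity (I (D i phi) (D i phi)); first exact: L2norm_sqr.
  transitivity (a * I (D i psi) (D i phi)); first exact: Da.
  transitivity (a * (a * I (D i psi) (D i psi))).
    by congr (a * _); exact: etrans (int_mulC Omega (D i psi) (D i phi)) (Da _ i Lpi).
  rewrite mulrA -expr2; congr (_ * _); exact: esym (L2norm_sqr Omega (D i psi)).
have N2 : L2normv Omega (grad Omega phi) ^+ 2 = (`|a| * L2normv Omega (grad Omega psi)) ^+ 2.
  transitivity (\sum_i L2norm Omega (D i phi) ^+ 2); first exact: L2normv_sqr.
  transitivity (a ^+ 2 * \sum_i L2norm Omega (D i psi) ^+ 2).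
    by rewrite mulr_sumr; apply: eq_bigr => i _; exact: S.
  rewrite [RHS]exprMn (real_normK (num_real a)); congr (_ * _).
  exact: esym (L2normv_sqr Lp).
apply/eqP; rewrite -(@eqrXn2 _ 2); [exact/eqP| by [] | exact: L2normv_ge0|].
by apply: mulr_ge0; [exact: normr_ge0|exact: L2normv_ge0].
Qed.

(** * The dual norm and the energy estimate *)

Section dual.
Variables (Q : set fct) (c : R).
Hypotheses (QH : Q `<=` H1 Omega).
Hypothesis Q0 : Q (cst 0).
Hypothesis Qlin : forall (a : R) u v, Q u -> Q v -> Q (fun x => a * u x + v x).
Hypothesis Qc : forall q, Q q -> L2norm Omega q <= c * L2normv Omega (grad Omega q).

Lemma dual_of_L2Z (h psi : fct) (a : R) : L2 Omega h -> Q psi ->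
  [/\ Q (a *: psi), I h (a *: psi) = a * I h psi &
    L2normv Omega (grad Omega (a *: psi)) = `|a| * L2normv Omega (grad Omega psi)].
Proof.
move=> Lh Qpsi.
have E : a *: psi = (fun x => a * psi x + cst 0 x) by apply/funext => x; rewrite /= addr0.
have Hpsi := QH Qpsi; have H0 := QH Q0; have QE : Q (a *: psi) by rewrite E; exact: Qlin.
(* Writing a psi as a combination of psi with itself lets the two-term linearity lemmas give the
   scaling. *)
have E1 : (fun x => (a - 1) * psi x + psi x) = a *: psi.
  by apply/funext => x; rewrite -[RHS]/(a * psi x); ring.
have Da w i : L2 Omega w -> I (D i (a *: psi)) w = a * I (D i psi) w.
  move=> Lw; have := int_weak_lin oO bO i (a - 1) Hpsi Hpsi Lw.
  by rewrite E1 => ->; ring.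
split => //.
  rewrite !(int_mulC _ h); have := int_mulDl mO (a - 1) (H1_L2 Hpsi) (H1_L2 Hpsi) Lh.
  by rewrite E1 => ->; ring.
by apply: L2normv_grad_scale => //; exact: QH.
Qed.

(** Poincare's inequality on [Q] bounds psi by its gradient. Boundedness is what makes the [sup] in
    [dual_norm] a genuine supremum. *)
Lemma dual_norm_ubound (h : fct) : L2 Omega h ->
  has_ubound [set dual_of_L2 Omega h psi | psi in
    [set psi | Q psi /\ L2normv Omega (grad Omega psi) = 1]].
Proof.
move=> Lh; exists (L2norm Omega h * c) => _ [psi [Qpsi psi1] <-].
have Hpsi := QH Qpsi.
rewrite (le_trans (ler_norm _))// (le_trans (int_mul_CauchySchwarz mO Lh (H1_L2 Hpsi)))//.
by rewrite ler_wpM2l ?L2norm_ge0// (le_trans (Qc Qpsi))// psi1 mulr1.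
Qed.

(** Both psi and -psi are admissible, and one of the two pairings is nonnegative. If no element of
    [Q] has gradient norm 1, [sup] takes its default value 0. *)
Lemma dual_norm_ge0 (h : fct) : L2 Omega h -> 0 <= dual_norm Omega Q (dual_of_L2 Omega h).
Proof.
move=> Lh; rewrite /dual_norm; set S := (X in sup X).
have [->|/set0P[_ [psi [Qpsi psi1] _]]] := eqVneq S set0; first by rewrite sup0.
have [Qn En Nn] := dual_of_L2Z (-1) Lh Qpsi.
have h1 : I h psi <= sup S.
  by apply: (ub_le_sup (dual_norm_ubound Lh)); exists psi.
have h2 : - I h psi <= sup S.
  apply: (ub_le_sup (dual_norm_ubound Lh)); exists (-1 *: psi).
    by split; [exact: Qn|rewrite Nn psi1 normrN1 mulr1].
  by rewrite /dual_of_L2 En mulN1r.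
case: (leP 0 (I h psi)) => [h0|/ltW h0]; first exact: le_trans h0 h1.
by apply: le_trans h2; rewrite oppr_ge0.
Qed.

(** [r] is scaled to gradient norm 1, with a sign [a] for either half of the absolute value. If its
    gradient norm is 0, Poincare's inequality makes [r] zero in L2. *)
Lemma dual_norm_le (h r : fct) : L2 Omega h -> Q r ->
  `|I h r| <= dual_norm Omega Q (dual_of_L2 Omega h) * L2normv Omega (grad Omega r).
Proof.
move=> Lh Qr; have [r0|r0] := eqVneq (L2normv Omega (grad Omega r)) 0.
  have r00 : L2norm Omega r = 0.
    by apply/eqP; rewrite eq_le L2norm_ge0 andbT (le_trans (Qc Qr))// r0 mulr0.
  have := int_mul_CauchySchwarz mO Lh (H1_L2 (QH Qr)).
  by rewrite r00 r0 !mulr0.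
have N0 : 0 < L2normv Omega (grad Omega r) by rewrite lt_neqAle eq_sym r0 L2normv_ge0.
have bound (a : R) : `|a| = 1 -> a * I h r <= dual_norm Omega Q (dual_of_L2 Omega h) * L2normv Omega (grad Omega r).
  move=> a1; have [Qn En Nn] := dual_of_L2Z (a / L2normv Omega (grad Omega r)) Lh Qr.
  rewrite -ler_pdivrMr// mulrAC -En; apply: (ub_le_sup (dual_norm_ubound Lh)).
  exists ((a / L2normv Omega (grad Omega r)) *: r) => //; split; first exact: Qn.
  by rewrite Nn normrM a1 mul1r normfV gtr0_norm// mulVf.
rewrite ler_norml; apply/andP; split.
  by rewrite lerNl -mulN1r; apply: bound; rewrite normrN1.
by rewrite -[I h r]mul1r; apply: bound; rewrite normr1.
Qed.

(** The constant is chosen before [eps] and [delta], so it is uniform in both; the expansion uses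
    delta = eps^-k and h = div v_k. *)
Lemma energy_estimate : (0 < n)%N -> 0 < c -> exists2 C : R, 0 < C &
  forall (w : field) (r h : fct) (eps delta : R),
    H10v Omega w -> Q r -> L2 Omega h -> 0 < eps -> 0 <= delta ->
    int_grad_grad Omega w w + int_dot Omega (grad Omega r) w = 0 ->
    eps * int_dot Omega (grad Omega r) (grad Omega r) + I (div Omega w) r =
      - (delta * I h r) ->
    H1normv Omega w <= C * (delta / eps * dual_norm Omega Q (dual_of_L2 Omega h)) /\
    H1norm Omega r <= C * (delta / eps * dual_norm Omega Q (dual_of_L2 Omega h)).
Proof.
move=> n0 c0; have [P P0 hP] := poincare_H10 oO bO; pose i0 := Ordinal n0.
pose K := n%:R * P; have K0 : 0 <= K by rewrite mulr_ge0.
(* [K1] and [K2] compare squared norms; being at least 1 they bound their own square roots, which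
   keeps roots out of the constant. *)
pose K1 := 1 + n%:R * P ^+ 2; have K11 : 1 <= K1 by rewrite lerDl mulr_ge0// sqr_ge0.
pose K2 := 1 + c ^+ 2; have K21 : 1 <= K2 by rewrite lerDl sqr_ge0.
have K10 := le_trans ler01 K11; have K20 := le_trans ler01 K21.
exists (K1 * K + K2); first by rewrite ltr_wpDl ?mulr_ge0// (lt_le_trans ltr01).
move=> w r h eps delta Hw Qr Lh eps0 delta0 eqw eqr.
have Hw1 : H1v Omega w by move=> i; exact: H10_H1.
have Hr := QH Qr; have Lr := grad_L2v Hr.
set M := dual_norm _ _ _; have M0 : 0 <= M by exact: dual_norm_ge0.
pose N := L2normv Omega (grad Omega r); have N0 : 0 <= N by exact: L2normv_ge0.
have NE : int_dot Omega (grad Omega r) (grad Omega r) = N ^+ 2 by exact: int_dot_sqr.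
have a0 := int_grad_grad_ge0 Hw1.
have [Y Y0 YE] : exists2 Y : R, 0 <= Y & int_grad_grad Omega w w = Y ^+ 2.
  by exists (Num.sqrt (int_grad_grad Omega w w)); [exact: sqrtr_ge0|rewrite sqr_sqrtr].
have DY i j : L2norm Omega (D i (w j)) <= Y by exact: L2norm_le_grad_grad.
have wY j : L2norm Omega (w j) <= P * Y.
  by rewrite (le_trans (hP i0 _ (Hw j)))// ler_wpM2l.
(* The momentum equation tested with [w]: each of the [n] components contributes at most N P Y. *)
have YN : Y <= K * N.
  have : Y ^+ 2 <= K * N * Y.
    have -> : Y ^+ 2 = - int_dot Omega (grad Omega r) w.
      by rewrite -YE; apply/eqP; rewrite -addr_eq0; exact/eqP.
    rewrite int_dotE//; last exact: H1v_L2v.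
    rewrite -sumrN (_ : K * N * Y = \sum_(i < n) N * (P * Y)); last first.
      by rewrite sumr_const card_ord -[RHS]mulr_natl /K; ring.
    apply: ler_sum => i _; rewrite (le_trans (ler_norm _))// normrN.
    rewrite (le_trans (int_mul_CauchySchwarz mO (Lr i) (H1_L2 (Hw1 i))))//.
    by rewrite ler_pM ?L2norm_ge0// L2norm_le_L2normv.
  have [->|Yn0] := eqVneq Y 0; first by rewrite mulr_ge0.
  have Y1 : 0 < Y by rewrite lt_neqAle eq_sym Yn0.
  by rewrite expr2 ler_pM2r.
(* Green's formula turns the mixed term into Y^2; dropping this nonnegative term leaves eps N^2 <=
   delta M N. *)
have NM : N <= delta / eps * M.
  have [->|Nn0] := eqVneq N 0; first by rewrite mulr_ge0// divr_ge0// ltW.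
  have N1 : 0 < N by rewrite lt_neqAle eq_sym Nn0.
  have X : I (div Omega w) r = Y ^+ 2.
    have := int_grad_H10v Hr Hw; rewrite -YE => h1; move: eqw; rewrite h1 => /eqP.
    by rewrite subr_eq0 => /eqP.
  move: eqr; rewrite NE X => eqr.
  have h1 : - (delta * I h r) <= delta * (M * N).
    rewrite -mulrN ler_wpM2l// (le_trans (ler_norm _))// normrN; exact: dual_norm_le.
  have h2 : eps * N * N <= delta * M * N.
    rewrite -!mulrA -expr2 (le_trans _ h1)// -eqr lerDl sqr_ge0//.
  rewrite ler_pM2r// in h2.
  by rewrite mulrAC ler_pdivlMr// mulrC.
have key : H1normv Omega w <= K1 * K * N /\ H1norm Omega r <= K2 * N.
  split.
    apply: H1normv_le; rewrite ?mulr_ge0// L2normv_sqr; last exact: H1v_L2v.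
    rewrite YE; apply: (@le_trans _ _ (K1 * Y ^+ 2)).
      rewrite /K1 mulrDl mul1r addrC lerD2l (_ : n%:R * _ * _ = \sum_(i < n) (P * Y) ^+ 2).
        by apply: ler_sum => i _; rewrite lerXn2r ?nnegrE ?L2norm_ge0 ?mulr_ge0.
      by rewrite sumr_const card_ord -[RHS]mulr_natl; ring.
    rewrite -mulrA exprMn; apply: ler_pM; rewrite ?sqr_ge0//.
      by rewrite expr2 ler_peMl.
    by rewrite lerXn2r ?nnegrE ?mulr_ge0.
  apply: H1norm_le; rewrite ?mulr_ge0// -/N exprMn.
  apply: (@le_trans _ _ (K2 * N ^+ 2)); last by rewrite ler_wpM2r ?sqr_ge0// expr2 ler_peMl.
  rewrite /K2 mulrDl mul1r addrC lerD2l -exprMn lerXn2r ?nnegrE ?L2norm_ge0 ?mulr_ge0 ?(ltW c0)//.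
  exact: Qc.
have [k1 k2] := key; split.
  apply: (le_trans k1); apply: ler_pM; rewrite ?mulr_ge0//; by rewrite lerDl.
by apply: (le_trans k2); apply: ler_pM; rewrite // lerDr mulr_ge0.
Qed.

End dual.

End energy_estimate.

(** * Linear functionals evaluated on the error of the expansion *)

Section linear_combinations.
Variables (R : realType) (V : lmodType R) (P : set V) (c : nat -> R) (v : nat -> V).
Hypothesis P0 : P 0.
Hypothesis Plin : forall (a : R) u w, P u -> P w -> P (a *: u + w).

Lemma linear_comb_closed (k : nat) : (forall i, (1 <= i <= k)%N -> P (v i)) ->
  P (\sum_(1 <= i < k.+1) c i *: v i).
Proof.
elim: k => [|k IH] Pv; first by rewrite big_geq.
rewrite big_nat_recr//= addrC; apply: Plin; first by apply: Pv; rewrite /= leqnn.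
by apply: IH => i /andP[i1 ik]; apply: Pv; rewrite i1 (leq_trans ik).
Qed.

Variable f : V -> R.
Hypothesis flin : forall (a : R) u w, P u -> P w -> f (a *: u + w) = a * f u + f w.

(** Linearity is asked on [P] only, because the pairings with weak derivatives are linear on H1,
    where the chosen derivatives are genuine. *)
Lemma linear_comb_map (k : nat) : (forall i, (1 <= i <= k)%N -> P (v i)) ->
  f (\sum_(1 <= i < k.+1) c i *: v i) = \sum_(1 <= i < k.+1) c i * f (v i).
Proof.
elim: k => [|k IH] Pv.
  rewrite !big_geq//; have := flin 1 P0 P0; rewrite scale1r addr0 mul1r => /eqP.
  by rewrite addrC -subr_eq subrr eq_sym => /eqP.
have Pv' i : (1 <= i <= k)%N -> P (v i).
  by move=> /andP[i1 ik]; apply: Pv; rewrite i1 (leq_trans ik).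
rewrite big_nat_recr// [in RHS]big_nat_recr//= addrC flin.
- by rewrite IH// addrC.
- by apply: Pv; rewrite /= leqnn.
- exact: linear_comb_closed.
Qed.

Lemma linear_expansion_error (k : nat) (u u0 : V) : P u -> P u0 ->
  (forall i, (1 <= i <= k)%N -> P (v i)) ->
  f (u - (u0 + \sum_(1 <= i < k.+1) c i *: v i)) =
  f u - (f u0 + \sum_(1 <= i < k.+1) c i * f (v i)).
Proof.
move=> Pu Pu0 Pv; have PS := linear_comb_closed Pv.
have PT : P (u0 + \sum_(1 <= i < k.+1) c i *: v i).
  by rewrite -[u0]scale1r; exact: Plin.
rewrite addrC -scaleN1r flin// -[u0 in f (u0 + _)]scale1r flin// linear_comb_map//.
by rewrite mulN1r mul1r addrC.
Qed.

End linear_combinations.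

(** The relation between [d] and [X] turns eps eps^-i d_i into -eps^-(i-1) X_(i-1), which cancels
    the preceding term of the second sum; only the two ends survive. *)
Lemma telescope_scaled (R : realType) (eps : R) (X d : nat -> R) (k : nat) : 0 < eps ->
  (forall i, (1 <= i <= k)%N -> d i = - X i.-1) ->
  eps * (\sum_(1 <= i < k.+1) eps^-1 ^+ i * d i) + \sum_(1 <= i < k.+1) eps^-1 ^+ i * X i =
  eps^-1 ^+ k * X k - X 0%N.
Proof.
move=> eps0; elim: k => [|k IH] dX; first by rewrite !big_geq// mulr0 addr0 expr0 mul1r subrr.
rewrite big_nat_recr// [X in _ + X]big_nat_recr//= (dX k.+1) ?leqnn// mulrDr addrACA IH; last first.
  by move=> i /andP[i1 ik]; apply: dX; rewrite i1 (leq_trans ik).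
have E : eps * eps^-1 ^+ k.+1 = eps^-1 ^+ k by rewrite exprS mulrA divff ?mul1r// gt_eqF.
by rewrite mulrA E /=; ring.
Qed.

(** Here [a], [b] stand for the terms of (u_eps, p_eps), [a0], [b0] for those of the limit pair, and
    [s], [t] for the sums over the correctors. *)
Lemma momentum_residual (R : realType) (a b a0 b0 s t F : R) :
  a + b = F -> a0 + b0 = F -> s + t = 0 -> a - (a0 + s) + (b - (b0 + t)) = 0.
Proof. by move=> *; lra. Qed.

Lemma pressure_residual (R : realType) (eps a b a0 b0 s t G X Y : R) :
  eps * a + b = eps * G -> a0 = G -> b0 = X -> eps * t + s = Y - X ->
  eps * (a - (a0 + t)) + (b - (b0 + s)) = - Y.
Proof. by move=> h1 -> -> h2; rewrite mulrBr mulrDr; lra. Qed.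

Theorem theorem3p5 (R : realType) (n : nat) (Omega : set 'rV[R]_n)
    (Q : set ('rV[R]_n -> R))
    (F u_b : 'I_n -> 'rV[R]_n -> R) (p_b : 'rV[R]_n -> R)
    (G : ('rV[R]_n -> R) -> R)
    (u_PP : 'I_n -> 'rV[R]_n -> R) (p_PP : 'rV[R]_n -> R)
    (u : R -> 'I_n -> 'rV[R]_n -> R) (p : R -> 'rV[R]_n -> R)
    (k : nat)
    (v : nat -> 'I_n -> 'rV[R]_n -> R) (q : nat -> 'rV[R]_n -> R)
    (hn : (2 <= n)%N)
    (hOmega : bounded_lipschitz_domain Omega)
    (hQ : closed_subspace Omega Q) (hQp : poincare Omega Q)
    (hF : L2v Omega F)
    (hub : Hhalfv Omega u_b) (hub0 : flux Omega u_b = 0)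
    (hpb : H1 Omega p_b)
    (hG : in_dual Omega Q G)
    (hPP : solves_PP Omega Q F u_b p_b G u_PP p_PP)
    (hES : forall eps : R, 0 < eps ->
      solves_ES Omega Q F u_b p_b G eps (u eps) (p eps))
    (hk : (1 <= k)%N)
    (hv0 : v 0%N = u_PP)
    (hvq : forall i : nat, (1 <= i <= k)%N ->
      [/\ H10v Omega (v i), Q (q i),
        forall phi, H10v Omega phi ->
          int_grad_grad Omega (v i) phi + int_dot Omega (grad Omega (q i)) phi
          = 0 &
        forall psi, Q psi ->
          int_dot Omega (grad Omega (q i)) (grad Omega psi)
          = - int_mul Omega (div Omega (v i.-1)) psi]) :
  exists2 c : R, 0 < c &
    forall eps : R, 0 < eps ->
      H1normv Omega (fun j x =>
        u eps j x - (u_PP j x + \sum_(1 <= i < k.+1) eps^-1 ^+ i * v i j x))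
      <= c / eps ^+ k.+1 * dual_norm Omega Q (dual_of_L2 Omega (div Omega (v k)))
      /\
      H1norm Omega (fun x =>
        p eps x - (p_PP x + \sum_(1 <= i < k.+1) eps^-1 ^+ i * q i x))
      <= c / eps ^+ k.+1 * dual_norm Omega Q (dual_of_L2 Omega (div Omega (v k))).
Proof.
have [oO _ _ bO lO] := hOmega; have [QH Q0 Qlin _] := hQ; have [cQ cQ0 hcQ] := hQp.
have n0 : (0 < n)%N by apply: leq_trans hn.
have [C C0 est] := energy_estimate oO bO QH Q0 Qlin hcQ n0 cQ0.
have [[HuPP HpPP] eqPP eqpPP trPP bPP] := hPP.
have H1v0 : H1v Omega 0 by move=> j; exact: H1_cst0.
have H10v1 : H10v Omega (v 1%N) by have [] := hvq 1%N; rewrite // hk.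
(* Zero is obtained as v_1 - v_1, available because k >= 1. *)
have H10v0 : H10v Omega 0.
  move=> j; have := H10_lin oO bO (-1) (H10v1 j) (H10v1 j).
  by congr (H10 _ _); apply/funext => x; rewrite mulN1r addNr.
have H10v_lin a (f g : 'I_n -> 'rV[R]_n -> R) :
    H10v Omega f -> H10v Omega g -> H10v Omega (a *: f + g).
  by move=> Hf Hg j; exact: H10_lin.
have Hv10 i : (1 <= i <= k)%N -> H10v Omega (v i) by move=> /hvq[].
have Hv i : (1 <= i <= k)%N -> H1v Omega (v i) by move=> /Hv10 h j; exact: H10_H1.
have Hq i : (1 <= i <= k)%N -> Q (q i) by move=> /hvq[].
have Hq1 i : (1 <= i <= k)%N -> H1 Omega (q i) by move=> /Hq /QH.
have Hvk := Hv k; rewrite hk leqnn in Hvk; have {}Hvk := Hvk isT.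
have Ldiv : L2 Omega (div Omega (v k)).
  by apply: L2_sum => [|i]; [exact: open_measurable_rV|exact: weak_pderiv_L2].
exists C => // eps eps0; have [[Hu Hp] eqES eqpES trES bES] := hES eps eps0.
pose c (i : nat) := eps^-1 ^+ i.
set U := (fun (j : 'I_n) (x : 'rV[R]_n) => _); set r := (X in H1norm _ X).
have UE : U = u eps - (u_PP + \sum_(1 <= i < k.+1) c i *: v i).
  apply/funext => j; apply/funext => x; rewrite /U; congr (_ - (_ + _)).
  by rewrite !fct_sumE.
have rE : r = p eps - (p_PP + \sum_(1 <= i < k.+1) c i *: q i).
  by apply/funext => x; rewrite /r; congr (_ - (_ + _)); rewrite fct_sumE.
(* The two velocities share the trace [u_b], so their difference lies in H^1_0, as the correctors
   do. *)
have HU10 : H10v Omega U.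
  have -> : U = (-1) *: (\sum_(1 <= i < k.+1) c i *: v i) + (u eps - u_PP).
    by rewrite UE scaleN1r opprD addrA addrC.
  apply: (H10v_lin (-1)); first exact: (@linear_comb_closed R _ (H10v Omega) c v H10v0 H10v_lin k Hv10).
  by move=> j; exact: H10_trace (trES j) (trPP j).
(* [p_b] cancels: both pressures differ from it by an element of [Q]. *)
have Qr : Q r.
  have -> : r = (-1) *: (1 *: (fun x => p_PP x - p_b x) + \sum_(1 <= i < k.+1) c i *: q i) +
      (fun x => p eps x - p_b x).
    rewrite rE scaleN1r scale1r; apply/funext => x.
    move: (\sum_(1 <= i < k.+1) c i *: q i) => S.
    change (p eps x - (p_PP x + S x) = - (p_PP x - p_b x + S x) + (p eps x - p_b x)); ring.
  apply: (Qlin (-1)) bES; apply: (Qlin 1) => //.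
  exact: (@linear_comb_closed R _ Q c q Q0 Qlin k Hq).
have HU : H1v Omega U by move=> j; exact: H10_H1.
have Hr := QH r Qr; have Lr := grad_L2v Hr.
(* The energy estimate is applied with delta = eps^-k, so its factor delta / eps is the announced
   rate. *)
have c1 : eps^-1 ^+ k / eps = (eps ^+ k.+1)^-1 by rewrite exprS invfM exprVn mulrC.
have [|||e1 e2] := est U r (div Omega (v k)) eps (eps^-1 ^+ k) HU10 Qr Ldiv eps0.
- by rewrite exprn_ge0// invr_ge0 ltW.
- have gU := @linear_expansion_error R _ (H1v Omega) c v H1v0 (H1v_lin oO bO)
    (fun W => int_grad_grad Omega W U)
    (fun a f g Hf Hg => int_grad_grad_lin oO bO a Hf Hg HU) k _ _ Hu HuPP Hv.
  have gr := @linear_expansion_error R _ (H1 Omega) c q (H1_cst0 oO) (H1_lin oO bO)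
    (fun W => int_dot Omega (grad Omega W) U)
    (fun a f g Hf Hg => int_grad_lin oO bO a Hf Hg (H1v_L2v HU)) k _ _ Hp HpPP Hq1.
  rewrite -UE in gU; rewrite -rE in gr; rewrite gU gr.
  apply: momentum_residual (eqES _ HU10) (eqPP _ HU10) _.
  rewrite -big_split/= big_nat_cond big1// => i /andP[/andP[i1 ik] _].
  have [|_ _ eqv _] := hvq i; first by rewrite i1.
  by rewrite -mulrDr eqv// mulr0.
- have gU := @linear_expansion_error R _ (H1v Omega) c v H1v0 (H1v_lin oO bO)
    (fun W => int_mul Omega (div Omega W) r)
    (fun a f g Hf Hg => int_div_lin oO bO a Hf Hg (H1_L2 Hr)) k _ _ Hu HuPP Hv.
  have gr := @linear_expansion_error R _ (H1 Omega) c q (H1_cst0 oO) (H1_lin oO bO)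
    (fun W => int_dot Omega (grad Omega W) (grad Omega r))
    (fun a f g Hf Hg => int_grad_lin oO bO a Hf Hg Lr) k _ _ Hp HpPP Hq1.
  rewrite -UE in gU; rewrite -rE in gr; rewrite gU gr.
  apply: pressure_residual (eqpES _ Qr) (eqpPP _ Qr) _ _; last first.
    apply: (telescope_scaled (X := fun i => int_mul Omega (div Omega (v i)) r) eps0) => i hi.
    by have [_ _ _ ->] := hvq i hi.
  (* The lower end of the telescoped sum is the pairing with div v_0; as v_0 is [u_PP], it cancels
     the divergence of the limit velocity. *)
  by rewrite /= hv0.
by split; [move: e1|move: e2]; rewrite c1 mulrA.
Qed.
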